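(* Let $\Omega$ be a rational $n\times n$ matrix $1$-form on $\mathbb{C}P^1$ with polar locus $\Sigma=\{\tau_1,\dots,\tau_m\}$ consisting of $m$ distinct points, all of which are first order poles of $\Omega$ (so that the linear system $\mathrm{d}x=\Omega x$ is Fuchsian). Assume that all residue matrices $A_i=\operatorname{Res}_{\tau_i}\Omega\in\mathrm{Mat}_{n\times n}(\mathbb{C})$ have only real eigenvalues, $\operatorname{Spec}A_i\subseteq\mathbb{R}$ for $i=1,\dots,m$. Then the bound for the number of isolated zeros of solutions is finite: $\mathcal{N}(\Omega)<\infty$.
   Context: Solutions $x(t)=(x_1(t),\dots,x_n(t))$ of $\mathrm{d}x=\Omega x$ are multivalued holomorphic vector functions on $\mathbb{C}P^1\setminus\Sigma$. Let $U=\{U_\alpha\}$ be a covering of $\mathbb{C}P^1\setminus\Sigma$ by finitely many simply connected polygonal domains $U_\alpha\subseteq\mathbb{C}P^1\setminus\Sigma$, where polygonal means that $U_\alpha$ is bounded by finitely many circular arcs and line segments. In each $U_\alpha$ one can choose holomorphic branches of all solutions; put $$N_\alpha(\Omega)=\sup_{x(\cdot),\,c\in\mathbb{C}^n}\#\{t\in U_\alpha:\ c_1x_1(t)+\cdots+c_nx_n(t)=0\}\le+\infty,$$ where $\#\{\cdot\}$ denotes the number of isolated points of the set and the supremum is over all solutions $x(\cdot)$ of the system and all $c\in\mathbb{C}^n$ (it does not depend on the choice of branches). Put $N(\Omega,U)=\sum_\alpha N_\alpha(\Omega)$ and $\mathcal{N}(\Omega)=\inf_U N(\Omega,U)$, the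 infimum being over all such polygonal coverings $U$. *)

(* Defs.v *)
From HB Require Import structures.
From mathcomp Require Import all_boot all_order all_algebra.
From mathcomp Require Import all_classical all_reals all_analysis.
From mathcomp Require Import complex.

Set Implicit Arguments.
Unset Strict Implicit.
Unset Printing Implicit Defensive.

Import Order.TTheory GRing.Theory Num.Theory.
Import numFieldNormedType.Exports.

Local Open Scope classical_set_scope.
Local Open Scope ring_scope.

(* [R[i]] carries no topology by itself; packaged as a [numClosedFieldType] it
   inherits the one given by the modulus, and [is_derive _ 1 _ _] is then
   complex differentiability. *)
Definition cplx (R : realType) : numClosedFieldType := R[i].

(* [None] is the point at infinity. *)
Definition CP1 (R : realType) := one_point_compactification (cplx R).

Section RationalFunctions.
Variable R : realType.
Local Notation C := (cplx R).
Implicit Types (f : {fraction {poly C}}) (t : C).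

(* [repr] returns an arbitrary fraction, hence the division by the gcd. *)
Definition rat_num f : {poly C} :=
  (frac (repr f)).1 %/ gcdp (frac (repr f)).1 (frac (repr f)).2.

Definition rat_den f : {poly C} :=
  (frac (repr f)).2 %/ gcdp (frac (repr f)).1 (frac (repr f)).2.

Definition rat_eval f t : C := (rat_num f).[t] / (rat_den f).[t].

Definition rat_pole_order f t : nat := mup t (rat_den f).

Definition horner_inv (p : {poly C}) : {fraction {poly C}} :=
  (map_poly (fun c : C => tofrac c%:P) p).[(tofrac 'X)^-1].

(* The coefficient of [f(t) dt] in the coordinate [s = 1/t]:
   [f(t) dt = - s^-2 f(1/s) ds]. *)
Definition pullback_inv f : {fraction {poly C}} :=
  - (horner_inv (frac (repr f)).1 / horner_inv (frac (repr f)).2) / (tofrac 'X) ^+ 2.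

End RationalFunctions.

Section System.
Variables (R : realType) (n : nat).
Local Notation C := (cplx R).
Local Notation P1 := (CP1 R).

(* A rational matrix 1-form on CP1 is [Omega = A(t) dt] with [A] a matrix of
   rational functions; it is represented by [A]. *)
Definition rat_form := 'M[{fraction {poly C}}]_n.

Implicit Types (Omega : rat_form) (p : P1) (U : set P1) (x : P1 -> 'cV[C]_n).

(* Each point [p] is looked at in an affine coordinate regular at [p], namely
   [t] if [p] is finite and [s = 1/t] if [p] is infinite: [local_coord p] is the
   coordinate of [p], [chart p] the inverse of the coordinate map, and
   [coef Omega p] the coefficient matrix of [Omega]. *)
Definition local_coord p : C := if p is Some t then t else 0.

Definition chart p (s : C) : P1 :=
  if p is Some _ then Some s else if s == 0 then None else Some s^-1.

Definition coef Omega p : 'M[{fraction {poly C}}]_n :=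
  if p is Some _ then Omega else map_mx (@pullback_inv R) Omega.

Definition pole_order Omega p : nat :=
  \max_(i < n) \max_(j < n) rat_pole_order (coef Omega p i j) (local_coord p).

Definition polar_locus Omega : set P1 :=
  [set p | (0 < pole_order Omega p)%N].

(* The value at [p] of [(s - local_coord p) * coef Omega p], which is the residue
   when [p] is a pole of order at most 1. *)
Definition residue Omega p : 'M[C]_n :=
  map_mx (fun f => rat_eval (f * tofrac ('X - (local_coord p)%:P)) (local_coord p))
         (coef Omega p).

(* [x] is holomorphic on [U] and [dx = Omega x]; when [U] is open, simply
   connected and disjoint from the polar locus, these are the branches on [U]
   of the multivalued solutions. *)
Definition solution Omega U x : Prop :=
  forall p, U p -> forall i : 'I_n,
    is_derive (local_coord p) 1 (fun s : C => x (chart p s) i 0)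
      ((map_mx (@rat_eval R ^~ (local_coord p)) (coef Omega p) *m x p) i 0).

Definition zeros U x (c : 'rV[C]_n) : set P1 :=
  [set t | U t /\ \sum_(j < n) c 0 j * x t j 0 = 0].

Definition zero_count Omega U : \bar R :=
  ereal_sup [set N | exists x (c : 'rV[C]_n),
    solution Omega U x /\ N = counting (isolated (zeros U x c))].

End System.

Section PolygonalDomains.
Variable R : realType.
Local Notation C := (cplx R).
Local Notation P1 := (CP1 R).
Implicit Types U E : set P1.

Definition circular_arc (c : C) (r a b : R) : set P1 :=
  [set Some (c + real_complex R r * Complex (cos u) (sin u)) | u in `[a, b]].

Definition segment (z w : C) : set P1 :=
  [set Some (z + real_complex R u * (w - z)) | u in `[0, 1]].

(* On CP1 a line passes through infinity, and so do some of its segments. *)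
Definition ray (z v : C) : set P1 :=
  [set Some (z + real_complex R u * v) | u in `[0, +oo[] `|` [set None].

Definition edge E : Prop :=
  [\/ exists c r a b, [/\ 0 < r, a < b & E = circular_arc c r a b],
      exists z w, z != w /\ E = segment z w
    | exists z v, v != 0 /\ E = ray z v].

Definition loop_in U (g : R -> P1) : Prop :=
  [/\ {within `[0, 1], continuous g}, g 0 = g 1 & g @` `[0, 1] `<=` U].

(* For the loop [g], [H (_, v)] is the loop at time [v]. *)
Definition contractible_in U (g : R -> P1) : Prop :=
  exists (H : R * R -> P1) (q : P1),
    [/\ {within `[0, 1] `*` `[0, 1], continuous H},
        H @` (`[0, 1] `*` `[0, 1]) `<=` U,
        forall u, 0 <= u <= 1 -> H (u, 0) = g u /\ H (u, 1) = q
      & forall v, 0 <= v <= 1 -> H (0, v) = H (1, v)].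

Definition simply_connected U : Prop :=
  connected U /\ forall g, loop_in U g -> contractible_in U g.

Definition polygonal_domain U : Prop :=
  [/\ open U, U !=set0, simply_connected U
    & exists (k : nat) (E : 'I_k -> set P1),
        (forall j, edge (E j)) /\
        closure U `\` interior U = \bigcup_j E j].

End PolygonalDomains.

Section ZeroBound.
Variables (R : realType) (n : nat).
Implicit Types Omega : rat_form R n.

Definition polygonal_covering Omega (k : nat) (U : 'I_k -> set (CP1 R)) : Prop :=
  (forall a, polygonal_domain (U a)) /\
  \bigcup_a U a = ~` polar_locus Omega.

Definition covering_zero_count Omega (k : nat) (U : 'I_k -> set (CP1 R))
  : \bar R := (\sum_(a < k) zero_count Omega (U a))%E.

Definition zero_bound Omega : \bar R :=
  ereal_inf [set N | exists (k : nat) (U : 'I_k -> set (CP1 R)),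
    polygonal_covering Omega U /\ N = covering_zero_count Omega U].

End ZeroBound.

(* Main.v *)
(* Near a point [p] put [u = exp z], where [u] is a coordinate vanishing at [p]. A combination of
   the components of a solution becomes a function [f] on a left half strip, and the sectors used
   around the poles correspond to half strips of width [pi]. The derivatives of [f] lie in a
   module of finite rank over the rational functions of [u], and by Cayley-Hamilton the product of
   the operators [d/dz - (l + k)], over the residue eigenvalues [l] and [k < b], maps [f] to
   [u^b] times such a combination. For large [b] this says that an operator with constant
   coefficients and real roots almost annihilates [f], relatively to the size of its jet.

   On each horizontal line, the real and imaginary parts of the jet of [f] are therefore close,
   in the relative sense, to a real quasipolynomial; by Rolle's theorem it has boundedly many
   sign changes, this being where real eigenvalues are needed. Away from those sign changes a
   small value of [f] forces the whole jet to be small, which is absurd. So all zeros lie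
   in boundedly many small discs, in each of which some derivative of [f] is nearly constant and
   nonzero, so that [f] has boundedly many zeros there (division by [z - z0] replaces the argument
   principle). This bounds the zeros in half discs centred at [p], and the compactness of the
   sphere leaves finitely many discs and half discs to consider. *)
Require Import Defs.
From HB Require Import structures.
From mathcomp Require Import all_boot all_order all_algebra.
From mathcomp Require Import all_classical all_reals all_analysis.
From mathcomp Require Import complex.
From mathcomp Require Import ring lra zify.

Set Implicit Arguments.
Unset Strict Implicit.
Unset Printing Implicit Defensive.

Import Order.TTheory GRing.Theory Num.Theory.
Import numFieldNormedType.Exports.

Local Open Scope classical_set_scope.
Local Open Scope ring_scope.

(** * Real linear differential operators *)

(** The difficulty is uniformity: the bound may depend neither on the solution nor on [c], and no
    compactness of the set of solutions is invoked. Every estimate is therefore relative to the jet,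
    the vector of the first [J] derivatives of [f]: its constants come from the system alone, and by
    Gronwall's inequality the jet varies at most exponentially, at a rate fixed by the constant [K0]
    that bounds the next derivative by the jet.

    Two values of [b] occur, to avoid a circle. The factor [u^b] must decay faster than the jet can
    vary, so [b] has to be large in terms of [K0]; but [K0] would depend on [b] if the order of the
    jet did. So [J] and [K0] are fixed by a first value [b0], just large enough for the jet to
    contain generators of the module; then a large [b] is chosen while that jet is kept.

    The half strip is unbounded, whereas the quasipolynomial is built on a segment [[a, b]], so no
    constant may depend on [a]. This is why first order equations are solved one at a time, each
    from the end point at which exponentially weighted bounds are preserved.

    Ordinary points are treated as Fuchsian points with residue 0. *)

Section DeriveRules.
Variable K : numFieldType.
Implicit Types (f g : K -> K) (x : K).

Lemma is_derive_mul f g x (df dg : K) : is_derive x 1 f df -> is_derive x 1 g dg ->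
  is_derive x 1 (fun y => f y * g y) (f x * dg + df * g x).
Proof.
move=> Hf Hg; have H := is_deriveM Hf Hg.
apply: (is_derive_eq H); rewrite /GRing.scale /=; ring.
Qed.

Lemma is_derive_add f g x (df dg : K) : is_derive x 1 f df -> is_derive x 1 g dg ->
  is_derive x 1 (fun y => f y + g y) (df + dg).
Proof. exact: is_deriveD. Qed.

Lemma is_derive_sub f g x (df dg : K) : is_derive x 1 f df -> is_derive x 1 g dg ->
  is_derive x 1 (fun y => f y - g y) (df - dg).
Proof. exact: is_deriveB. Qed.

End DeriveRules.

(** * First order linear equations with exponentially weighted bounds *)

Section RealFamilies.
Variable R : realType.
Implicit Types (a b c l x y s t K C : R) (f g z nu : R -> R) (G h q : nat -> R -> R).

Lemma is_derive_expR_scale c x :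
  is_derive x 1 (fun y => expR (c * y)) (c * expR (c * x)).
Proof.
have H1 : is_derive x 1 (fun y : R => c * y) c.
  have := is_derive_mul (is_derive_cst c x 1) (is_derive_id x (1 : R)).
  by move=> H; apply: (is_derive_eq H); rewrite /cst /= mulr1 mul0r addr0.
have := @is_derive1_comp _ expR (fun y => c * y) x _ _ (is_derive_expR (c * x)) H1.
by move=> H; apply: (is_derive_eq H); rewrite mulrC.
Qed.

Lemma is_derive_continuous f x (df : R) : is_derive x 1 f df -> {for x, continuous f}.
Proof. by move=> [H _]; apply/differentiable_continuous/derivable1_diffP. Qed.

Lemma is_derive_within f (df : R -> R) a b : (forall x, a <= x <= b -> is_derive x 1 f (df x)) ->
  {within `[a, b], continuous f}.
Proof.
move=> H; apply: continuous_in_subspaceT => x; rewrite inE /= in_itv /= => xab.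
exact: is_derive_continuous (H x xab).
Qed.

Lemma derive_ge0_le f (df : R -> R) a b : a <= b ->
  (forall x, a <= x <= b -> is_derive x 1 f (df x)) ->
  (forall x, a <= x <= b -> 0 <= df x) -> f a <= f b.
Proof.
move=> ab Hf Hd.
have [|c cab E] := @MVT_segment R f df a b ab _ (is_derive_within Hf).
  by move=> x; rewrite in_itv /= => /andP[H1 H2]; apply: Hf; rewrite !ltW.
rewrite -subr_ge0 E; apply: mulr_ge0; last by rewrite subr_ge0.
by apply: Hd; move: cab; rewrite in_itv.
Qed.

(** For both signs [e], the function [expR (- l * x) * (A * expR (mu * x) + e * z x)] is nonnegative
    at [a] and nondecreasing: as [mu - l >= 1], the growth of the first term absorbs [g]. *)
Lemma forward_bound l mu A z g a s : a <= s -> 0 <= A -> l + 1 <= mu ->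
  (forall x, a <= x <= s -> is_derive x 1 z (l * z x + g x)) ->
  (forall x, a <= x <= s -> `|g x| <= A * expR (mu * x)) -> z a = 0 ->
  `|z s| <= A * expR (mu * s).
Proof.
move=> as_ A0 lmu Hz Hg za.
have H (e : R) : e = 1 \/ e = -1 -> 0 <= A * expR (mu * s) + e * z s.
  move=> he.
  have /= := @derive_ge0_le (fun x => A * expR ((mu - l) * x) + e * (expR ((- l) * x) * z x))
    (fun x => A * ((mu - l) * expR ((mu - l) * x)) + e * (expR ((- l) * x) * g x)) a s as_ _ _.
  rewrite za mulr0 mulr0 addr0.
  have -> : (mu - l) * s = - l * s + mu * s by ring.
  rewrite expRD => H.
  have : 0 <= A * (expR (- l * s) * expR (mu * s)) + e * (expR (- l * s) * z s).
    apply: le_trans (H _ _); first by rewrite mulr_ge0 ?expR_ge0.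
    - move=> x xas.
      have D1 := is_derive_mul (is_derive_cst A x 1) (is_derive_expR_scale (mu - l) x).
      have D2 := is_derive_mul (is_derive_cst e x 1)
        (is_derive_mul (is_derive_expR_scale (- l) x) (Hz x xas)).
      apply: (is_derive_eq (is_derive_add D1 D2)); rewrite /cst /=; ring.
    - move=> x xas; have := Hg x xas.
      have -> : (mu - l) * x = - l * x + mu * x by ring.
      rewrite expRD => gb.
      have E0 := expR_gt0 (- l * x); have E1 := expR_gt0 (mu * x).
      set u := expR (- l * x) in E0 *; set v := expR (mu * x) in E1 gb *.
      have -> : A * ((mu - l) * (u * v)) + e * (u * g x) =
        u * (A * v * (mu - l - 1) + (A * v + e * g x)) by ring.
      apply: mulr_ge0; first exact: ltW.
      apply: addr_ge0.
        by apply: mulr_ge0; [apply: mulr_ge0 => //; exact: ltW|lra].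
      move: gb; rewrite ler_norml => /andP[].
      by case: he => ->; lra.
  set u := expR (- l * s); have u0 : 0 < u by exact: expR_gt0.
  have -> : A * (u * expR (mu * s)) + e * (u * z s) = u * (A * expR (mu * s) + e * z s) by ring.
  by rewrite pmulr_rge0.
rewrite ler_norml; have := H 1 (or_introl erefl); have := H (-1) (or_intror erefl).
by move=> H1 H2; apply/andP; split; lra.
Qed.

Lemma is_derive_neg_arg f (df : R) x : is_derive (- x) 1 f df ->
  is_derive x 1 (fun y => f (- y)) (- df).
Proof.
move=> H; have := @is_derive1_comp _ f (fun y => - y) x _ _ H (is_deriveNid x (1:R)).
by move=> H1; apply: (is_derive_eq H1); rewrite mulrN1.
Qed.

(** The reflection [x -> - x] turns this into the forward case. *)
Lemma backward_bound l mu A z g b s : s <= b -> 0 <= A -> mu + 1 <= l ->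
  (forall x, s <= x <= b -> is_derive x 1 z (l * z x + g x)) ->
  (forall x, s <= x <= b -> `|g x| <= A * expR (mu * x)) -> z b = 0 ->
  `|z s| <= A * expR (mu * s).
Proof.
move=> sb A0 lmu Hz Hg zb.
have := @forward_bound (- l) (- mu) A (fun y => z (- y)) (fun y => - g (- y)) (- b) (- s).
rewrite !opprK mulrNN => H; apply: H => //.
- by rewrite lerN2.
- by lra.
- move=> x xbs; have := @is_derive_neg_arg z _ x (Hz (- x) _).
  by move=> H; apply: (is_derive_eq (H _)); [lra|ring].
- move=> x xbs; rewrite normrN mulNr -mulrN; apply: Hg; lra.
Qed.

Lemma primitive_exists g a b : a <= b ->
  (forall x, a <= x <= b -> {for x, continuous g}) ->
  exists z, forall x, a <= x <= b -> is_derive x 1 z (g x).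
Proof.
move=> ab Hg.
(* Clamping extends [g] continuously to the whole line, and integrating from [a - 1] makes both end
   points interior, so that two-sided derivatives are obtained on the closed segment. *)
pose k := fun x => g (Num.max a (Num.min b x)).
have kE x : a <= x <= b -> k x = g x.
  by move=> /andP[ax xb]; rewrite /k (min_idPr _) // (max_idPr _).
have kc : continuous k.
  move=> x; apply: (@continuous_comp _ _ _ (fun x => Num.max a (Num.min b x)) g).
    apply: continuous_max; first exact: cst_continuous.
    by apply: continuous_min; [exact: cst_continuous|exact: cvg_id].
  apply: Hg; rewrite le_max lexx /= ge_max ab /= ge_min lexx //.
pose z := fun x => (\int[lebesgue_measure]_(t in `[a - 1, x]) (k t))%R.
exists z => x xab.
have xb : x < b + 1 by lra.
have [] := @continuous_FTC1_closed R k (a - 1) x (b + 1) xb _ _ (kc x).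
- apply: continuous_compact_integrable; first exact: segment_compact.
  exact: continuous_subspaceT.
- lra.
- rewrite -/z -(kE x xab) => D E; split; first exact: D.
  by rewrite -derive1E; exact: E.
Qed.

(** Carrying all the derivatives as one sequence avoids iterating [derive]. Derivatives are
    two-sided even at the end points. *)
Definition family_on a b G := forall k x, a <= x <= b -> is_derive x 1 (G k) (G k.+1 x).

End RealFamilies.

(* [G] lists a function and its successive derivatives; [shift_op l] is [D - l]. *)
Definition shift_op (K : pzRingType) (T : Type) (l : K) (G : nat -> T -> K) : nat -> T -> K :=
  fun k x => G k.+1 x - l * G k x.

Definition shift_ops (K : pzRingType) (T : Type) (ls : seq K) (G : nat -> T -> K) :=
  foldr (@shift_op K T) G ls.

Lemma shift_opC (K : comPzRingType) (T : Type) (l m : K) (G : nat -> T -> K) :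
  shift_op l (shift_op m G) = shift_op m (shift_op l G).
Proof. by apply/funext => k; apply/funext => x; rewrite /shift_op; ring. Qed.

(** Lets the roots be sorted by the side from which each one is integrated. *)
Lemma shift_ops_perm (K : comPzRingType) (T : Type) (s t : seq K) (G : nat -> T -> K) :
  perm_eq s t -> shift_ops s G = shift_ops t G.
Proof.
have H l u v : shift_ops (u ++ l :: v) G = shift_op l (shift_ops (u ++ v) G).
  by elim: u => [//|m u IH]; rewrite /= -/(shift_ops _ G) IH shift_opC.
elim: s t => [|l s IH] t; first by rewrite perm_sym => /perm_nilP ->.
move=> st; have lt : l \in t by rewrite -(perm_mem st) mem_head.
have [u [v E]] : exists u v, t = u ++ l :: v.
  by case/splitPr: lt => u v; exists u, v.
rewrite E H /= -/(shift_ops _ G) (IH (u ++ v)) //.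
by move: st; rewrite E perm_sym -[l :: v]cat1s perm_catCA cat1s perm_cons perm_sym.
Qed.

Lemma shift_ops_cat (K : pzRingType) (T : Type) (s t : seq K) (G : nat -> T -> K) :
  shift_ops (s ++ t) G = shift_ops s (shift_ops t G).
Proof. exact: foldr_cat. Qed.

Lemma shift_opsB (K : comPzRingType) (T : Type) (s : seq K) (G H : nat -> T -> K) :
  shift_ops s (fun k x => G k x - H k x) =
  fun k x => shift_ops s G k x - shift_ops s H k x.
Proof.
elim: s => [//|l s IH]; rewrite /= -!/(shift_ops _ _) IH.
by apply/funext => k; apply/funext => x; rewrite /shift_op; ring.
Qed.

Section StageSolve.
Variable R : realType.
Implicit Types (a b c l x y s t K C : R) (f g z nu : R -> R) (G h q : nat -> R -> R).

Lemma family_shift_op a b l G : family_on a b G -> family_on a b (shift_op l G).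
Proof.
move=> H k x xab.
have D := is_derive_mul (is_derive_cst l x 1) (H k x xab).
apply: (is_derive_eq (is_derive_sub (H k.+1 x xab) D)).
by rewrite /cst /= mul0r addr0.
Qed.

Lemma family_shift_ops a b ls G : family_on a b G -> family_on a b (shift_ops ls G).
Proof. by move=> H; elim: ls => [//|l ls IH]; exact: family_shift_op. Qed.

(* The two alternatives correspond to solving [z' = l z + h 0] from the left,
   respectively the right, end point; [nu] is an a priori size of growth rate at most [K]. *)
Lemma stage_solve a b l K C beta nu h (J : nat) : a <= b -> 0 <= C ->
  (forall s, a <= s <= b -> 0 <= nu s) ->
  (forall s t, a <= s <= b -> a <= t <= b -> nu t <= nu s * expR (K * `|s - t|)) ->
  family_on a b h ->
  (forall k s, (k <= J)%N -> a <= s <= b -> `|h k s| <= C * expR (beta * s) * nu s) ->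
  l <= beta - K - 1 \/ beta + K + 1 <= l ->
  exists2 z, family_on a b z /\ (forall k x, shift_op l z k x = h k x) &
   forall k s, (k <= J)%N -> a <= s <= b ->
     `|z k s| <= C * (`|l| + 1) ^+ k * expR (beta * s) * nu s.
Proof.
move=> ab C0 nu0 nuK hf hb hl.
have [z0 [z0d z0b]] : exists z0, (forall x, a <= x <= b -> is_derive x 1 z0 (l * z0 x + h 0%N x)) /\
    forall s, a <= s <= b -> `|z0 s| <= C * expR (beta * s) * nu s.
  have [g gd] : exists g, forall x, a <= x <= b -> is_derive x 1 g (expR (- l * x) * h 0%N x).
    apply: primitive_exists => // x xab; apply: cvgM.
      exact: is_derive_continuous (is_derive_expR_scale (- l) x).
    exact: is_derive_continuous (hf 0%N x xab).
  pose z0 c x := expR (l * x) * (g x - g c).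
  have z0d c x : a <= x <= b -> is_derive x 1 (z0 c) (l * z0 c x + h 0%N x).
    move=> xab.
    have D := is_derive_mul (is_derive_expR_scale l x)
      (is_derive_sub (gd x xab) (is_derive_cst (g c) x 1)).
    have E : expR (l * x) * expR (- l * x) = 1 by rewrite mulNr expRN mulfV // expR_eq0.
    by apply: (is_derive_eq D); rewrite /z0 /cst /= subr0 [X in X + _]mulrA E; ring.
  have z0c c : z0 c c = 0 by rewrite /z0 subrr mulr0.
  have [hl1|hl1] := hl.
    exists (z0 a); split=> [x|s sab]; first exact: z0d.
    have sab' : a <= s by case/andP: sab.
    (* To the left of [s], [nu x <= nu s * expR (K * (s - x))]. With [s] fixed, the right-hand side
       is thus bounded by a pure exponential of rate [beta - K], at least 1 above [l]. *)
    have -> : C * expR (beta * s) * nu s = (C * nu s * expR (K * s)) * expR ((beta - K) * s).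
      have -> : beta * s = K * s + (beta - K) * s by ring.
      by rewrite expRD; ring.
    apply: (@forward_bound _ l (beta - K) _ (z0 a) (h 0%N) a s) => //.
    - by rewrite !mulr_ge0 ?expR_ge0 ?nu0.
    - by lra.
    - by move=> x xas; apply: z0d; lra.
    - move=> x xas; have xab : a <= x <= b by lra.
      apply: le_trans (hb 0%N x isT xab) _.
      have := nuK s x sab xab; rewrite ger0_norm; last by lra.
      move=> H; rewrite -!mulrA; apply: ler_wpM2l => //.
      apply: le_trans (ler_wpM2l (expR_ge0 _) H) _.
      rewrite mulrCA -!expRD; apply: ler_wpM2l; first exact: nu0.
      rewrite ler_expR; lra.
  exists (z0 b); split=> [x|s sab]; first exact: z0d.
  have sab' : s <= b by case/andP: sab.
  (* The mirror image: to the right of [s] the rate is [beta + K], at least 1 below [l]. *)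
  have -> : C * expR (beta * s) * nu s = (C * nu s * expR (- K * s)) * expR ((beta + K) * s).
    have -> : beta * s = - K * s + (beta + K) * s by ring.
    by rewrite expRD; ring.
  apply: (@backward_bound _ l (beta + K) _ (z0 b) (h 0%N) b s) => //.
  - by rewrite !mulr_ge0 ?expR_ge0 ?nu0.
  - by move=> x xas; apply: z0d; lra.
  - move=> x xas; have xab : a <= x <= b by lra.
    apply: le_trans (hb 0%N x isT xab) _.
    have := nuK s x sab xab; rewrite ler0_norm; last by lra.
    move=> H; rewrite -!mulrA; apply: ler_wpM2l => //.
    apply: le_trans (ler_wpM2l (expR_ge0 _) H) _.
    rewrite mulrCA -!expRD; apply: ler_wpM2l; first exact: nu0.
    rewrite ler_expR; lra.
(* The higher derivatives are read off from the equation, which makes [shift_op l z = h] hold by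
   construction. *)
pose z := fix z (k : nat) : R -> R :=
  if k is k'.+1 then fun x => l * z k' x + h k' x else z0.
exists z.
  split; last by move=> k x; rewrite /shift_op /=; ring.
  elim=> [|k IH] x xab; first exact: z0d.
  have D := is_derive_mul (is_derive_cst l x 1) (IH x xab).
  apply: (is_derive_eq (is_derive_add D (hf k x xab))).
  by rewrite /cst /= mul0r addr0.
elim=> [|k IH] s kJ sab; first by rewrite expr0 mulr1; exact: z0b.
have kJ' : (k <= J)%N by exact: ltnW.
rewrite /=; apply: le_trans (ler_normD _ _) _; rewrite normrM.
have H1 := ler_wpM2l (normr_ge0 l) (IH s kJ' sab).
have H2 := hb k s kJ' sab.
apply: le_trans (lerD H1 H2) _.
have w0 : 0 <= C * expR (beta * s) * nu s by rewrite !mulr_ge0 ?expR_ge0 ?nu0.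
set w := C * _ * nu s in w0 H2 *; set p := `|l| + 1; set r := p ^+ k.
have p1 : 1 <= p by rewrite /p lerDr.
have r1 : 1 <= r by exact: exprn_ege1.
have -> : C * r * expR (beta * s) * nu s = r * w by rewrite /w; ring.
have -> : C * p ^+ k.+1 * expR (beta * s) * nu s = p * (r * w) by rewrite /w exprS -/r; ring.
have : 0 <= (r - 1) * w by rewrite mulr_ge0 // subr_ge0.
rewrite /p; lra.
Qed.

End StageSolve.

(** * Approximation by quasipolynomials *)

Section RealWindow.
Variable R : realType.
Implicit Types (a b c l x y s t K C : R) (f g u z nu : R -> R) (G h q : nat -> R -> R).

(** The loss over all stages: as [z' = l z + h], a root [l] costs a factor [|l| + 1] per derivative,
    for at most [J] derivatives. *)
Definition stage_const (J : nat) (ls : seq R) := \prod_(l <- ls) (`|l| + 1) ^+ J.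

Lemma stage_const_ge0 J ls : 0 <= stage_const J ls.
Proof. by apply: prodr_ge0 => l _; rewrite exprn_ge0 // addr_ge0. Qed.

Lemma stages_solve a b K C beta nu (J : nat) ls h : a <= b -> 0 <= C ->
  (forall s, a <= s <= b -> 0 <= nu s) ->
  (forall s t, a <= s <= b -> a <= t <= b -> nu t <= nu s * expR (K * `|s - t|)) ->
  family_on a b h ->
  (forall k s, (k <= J)%N -> a <= s <= b -> `|h k s| <= C * expR (beta * s) * nu s) ->
  (forall l, l \in ls -> l <= beta - K - 1 \/ beta + K + 1 <= l) ->
  exists2 z, family_on a b z /\ shift_ops ls z = h &
   forall k s, (k <= J)%N -> a <= s <= b ->
     `|z k s| <= C * stage_const J ls * expR (beta * s) * nu s.
Proof.
move=> ab C0 nu0 nuK; elim: ls C C0 h => [|l ls IH] C C0 h hf hb hl.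
  by exists h => // k s kJ sab; rewrite /stage_const big_nil mulr1; exact: hb.
have [z1 [z1f z1h] z1b] := stage_solve ab C0 nu0 nuK hf hb (hl l (mem_head _ _)).
have C1 : 0 <= C * (`|l| + 1) ^+ J by rewrite mulr_ge0 // exprn_ge0 // addr_ge0.
have [||z [zf zh] zb] := IH _ C1 z1 z1f.
- move=> k s kJ sab; apply: le_trans (z1b k s kJ sab) _.
  apply: ler_wpM2r; first exact: nu0.
  apply: ler_wpM2r; first exact: expR_ge0.
  by apply: ler_wpM2l => //; rewrite ler_weXn2l // lerDr.
- by move=> m ml; apply: hl; rewrite in_cons ml orbT.
exists z.
  split=> //; rewrite /= -/(shift_ops ls z) zh.
  by apply/funext => k; apply/funext => x.
by move=> k s kJ sab; rewrite /stage_const big_cons mulrA; exact: zb.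
Qed.

(* Roots up to [beta - K - 1] are integrated from the left. The weight is then lowered once,
   so that all remaining roots can be integrated from the right. *)
Lemma approx_quasipolynomial a b K C beta nu (J : nat) ls G : a <= b -> b <= 0 -> 0 <= K -> 0 <= C ->
  (forall s, a <= s <= b -> 0 <= nu s) ->
  (forall s t, a <= s <= b -> a <= t <= b -> nu t <= nu s * expR (K * `|s - t|)) ->
  family_on a b G ->
  (forall k s, (k <= J)%N -> a <= s <= b ->
     `|shift_ops ls G k s| <= C * expR (beta * s) * nu s) ->
  exists2 q, family_on a b q /\ (forall k s, shift_ops ls q k s = 0) &
   forall k s, (k <= J)%N -> a <= s <= b ->
     `|G k s - q k s| <= C * stage_const J ls * expR ((beta - (2 * K + 2)) * s) * nu s.
Proof.
move=> ab b0 K0 C0 nu0 nuK Gf Gb.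
pose low := fun l => l <= beta - K - 1.
pose ls1 := [seq l <- ls | low l]; pose ls2 := [seq l <- ls | predC low l].
have P : perm_eq (ls1 ++ ls2) ls by apply/permPl; exact: perm_filterC.
have [|z1 [z1f z1h] z1b] := @stages_solve a b K C beta nu J ls1 (shift_ops ls G) ab C0 nu0 nuK
   (family_shift_ops ls Gf) Gb.
  by move=> l; rewrite mem_filter => /andP[H _]; left.
have C1 : 0 <= C * stage_const J ls1 by rewrite mulr_ge0 // stage_const_ge0.
(* Lowering [beta] by [2 * K + 2] turns [l > beta - K - 1] into the condition for integrating from
   the right; since [s <= 0], the old bound implies the new one. *)
have [||z [zf zh] zb] := @stages_solve a b K _ (beta - (2 * K + 2)) nu J ls2 z1 ab C1 nu0 nuK z1f.
- move=> k s kJ sab; apply: le_trans (z1b k s kJ sab) _.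
  apply: ler_wpM2r; first exact: nu0.
  apply: ler_wpM2l => //; rewrite ler_expR.
  have : 0 <= (2 * K + 2) * - s by apply: mulr_ge0; lra.
  lra.
- move=> l; rewrite mem_filter /= /low -ltNge => /andP[H _]; right; lra.
exists (fun k x => G k x - z k x).
  split; first by move=> k x xab; exact: is_derive_sub (Gf k x xab) (zf k x xab).
  move=> k s; rewrite shift_opsB -(shift_ops_perm z P) shift_ops_cat zh z1h.
  by rewrite subrr.
move=> k s kJ sab; rewrite opprB addrC subrK.
apply: le_trans (zb k s kJ sab) _.
by rewrite -(mulrA C) /stage_const -big_cat (perm_big _ P).
Qed.

(** * Sign changes of quasipolynomials *)

Definition sgn_const u a b :=
  (forall x, a <= x <= b -> 0 <= u x) \/ (forall x, a <= x <= b -> u x <= 0).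

(** [m] counts cut points, so there are [m.+1] pieces. Signs are weak and cut points may coincide or
    be end points: [m] is only an upper bound, and intervals of zeros need no special care. *)
Fixpoint sgn_pieces (m : nat) u a b : Prop :=
  if m is m'.+1 then exists c, [/\ a <= c <= b, sgn_const u a c & sgn_pieces m' u c b]
  else sgn_const u a b.

Lemma sgn_const_pt u a : sgn_const u a a.
Proof.
have E x : a <= x <= a -> x = a by move=> xa; apply/eqP; rewrite eq_le andbC.
by case: (leP 0 (u a)) => [|/ltW] H; [left|right] => x /E ->.
Qed.

(** The junction [c] is one more cut point. *)
Lemma sgn_pieces_cat m k u a c b : a <= c <= b ->
  sgn_pieces m u a c -> sgn_pieces k u c b -> sgn_pieces (m + k).+1 u a b.
Proof.
elim: m a => [|m IH] a acb; first by move=> H1 H2; exists c.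
move=> [d [adc H1 H2]] H3; rewrite addSn; exists d; split=> //.
  by case/andP: adc acb => -> /= dc /andP[_ cb]; exact: le_trans cb.
by apply: IH => //; case/andP: adc acb => _ -> /andP[_ ->].
Qed.

Lemma sgn_constN u a b : sgn_const (fun x => - u x) a b -> sgn_const u a b.
Proof.
by move=> [H|H]; [right|left] => x xab; have := H x xab; rewrite ?oppr_ge0 ?oppr_le0.
Qed.

(** Rolle's theorem in the form needed: [expR (- l * x) * u x] has derivative
    [expR (- l * x) * v x], hence is monotone and changes sign at most once. *)
Lemma sgn_pieces1 u v a b l : a <= b ->
  (forall x, a <= x <= b -> is_derive x 1 u (l * u x + v x)) ->
  sgn_const v a b -> sgn_pieces 1 u a b.
Proof.
move=> ab.
suff H (w y : R -> R) : (forall x, a <= x <= b -> is_derive x 1 w (l * w x + y x)) ->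
   (forall x, a <= x <= b -> 0 <= y x) -> sgn_pieces 1 w a b.
  move=> Hu [Hv|Hv]; first exact: H Hu Hv.
  have [||c [cab H1 H2]] := H (fun x => - u x) (fun x => - v x).
  - move=> x xab; have D := is_derive_sub (is_derive_cst 0 x 1) (Hu x xab).
    have -> : l * - u x + - v x = 0 - (l * u x + v x) by ring.
    by under eq_fun do rewrite -sub0r.
  - by move=> x xab; rewrite oppr_ge0 Hv.
  by exists c; split=> //; exact: sgn_constN.
move=> Hw Hy.
pose g x := expR (- l * x) * w x.
have gd x : a <= x <= b -> is_derive x 1 g (expR (- l * x) * y x).
  move=> xab; apply: (is_derive_eq (is_derive_mul (is_derive_expR_scale (- l) x) (Hw x xab))).
  ring.
have gm x t : a <= x -> x <= t -> t <= b -> g x <= g t.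
  move=> ax xt tb.
  apply: (@derive_ge0_le R g (fun x => expR (- l * x) * y x) x t xt) => r rxt.
    by apply: gd; lra.
  by apply: mulr_ge0; [exact: expR_ge0|apply: Hy; lra].
have gw0 x : (0 <= g x) = (0 <= w x) by rewrite /g pmulr_rge0 // expR_gt0.
have wg0 x : (g x <= 0) = (w x <= 0) by rewrite /g pmulr_rle0 // expR_gt0.
have [ga|ga] := leP 0 (g a).
  exists a; split; [by rewrite lexx|exact: sgn_const_pt|].
  by left=> x /andP[ax xb]; rewrite -gw0; apply: le_trans ga (gm _ _ _ _ _).
have [gb|gb] := leP (g b) 0.
  exists b; split; [by rewrite lexx ab| |exact: sgn_const_pt].
  by right=> x /andP[ax xb]; rewrite -wg0; apply: le_trans (gm _ _ _ _ _) gb.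
have [|c cab gc] := @IVT R g a b 0 ab (is_derive_within gd).
  by rewrite min_l ?max_r ?ltW //; exact: lt_trans gb.
move: cab; rewrite in_itv /= => /andP[ac cb].
exists c; split; first by rewrite ac cb.
  by right=> x /andP[ax xc]; rewrite -wg0 -gc; exact: gm.
by left=> x /andP[cx xb]; rewrite -gw0 -gc; exact: gm.
Qed.

(** Each of the [m.+1] pieces of [v] contributes one cut point, and the [m] junctions remain. *)
Lemma sgn_pieces_primitive m u v a b l : a <= b ->
  (forall x, a <= x <= b -> is_derive x 1 u (l * u x + v x)) ->
  sgn_pieces m v a b -> sgn_pieces (m.*2.+1) u a b.
Proof.
elim: m a => [|m IH] a ab Hu; first exact: sgn_pieces1.
move=> [c [/andP[ac cb] H1 H2]]; rewrite doubleS.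
apply: (@sgn_pieces_cat 1 m.*2.+1 u a c b); first by rewrite ac cb.
  by apply: (@sgn_pieces1 u v a c l) => // x xac; apply: Hu; lra.
by apply: IH => // x xac; apply: Hu; lra.
Qed.

Lemma quasipolynomial_pieces a b ls q m : a <= b -> family_on a b q ->
  (forall k, sgn_pieces m (shift_ops ls q k) a b) ->
  forall k, sgn_pieces (iter (size ls) (fun m => m.*2.+1) m) (q k) a b.
Proof.
move=> ab qf; elim: ls m => [//|l ls IH] m H k.
rewrite [size _]/= iterSr; apply: IH => {}k.
have D x : a <= x <= b ->
    is_derive x 1 (shift_ops ls q k) (l * shift_ops ls q k x + shift_ops (l :: ls) q k x).
  move=> xab; have D0 := family_shift_ops ls qf; apply: is_derive_eq (D0 k x xab) _.
  by rewrite [shift_ops (l :: ls) q k x]/(shift_ops ls q k.+1 x - l * shift_ops ls q k x) addrC subrK.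
exact: (sgn_pieces_primitive ab D (H k)).
Qed.

(** In the form of finite lists, the cut points of several functions can be concatenated. *)
Lemma sgn_pieces_breakpoints m u a b : sgn_pieces m u a b ->
  exists2 T : seq R, (size T <= m)%N &
    forall x y, a <= x -> x <= y -> y <= b -> (forall t, t \in T -> ~ (x <= t <= y)) ->
      sgn_const u x y.
Proof.
elim: m a => [|m IH] a.
  move=> H; exists [::] => // x y ax xy yb _.
  by case: H => H; [left|right] => r rxy; apply: H; lra.
move=> [c [acb H /IH[T Tm HT]]]; exists (c :: T) => // x y ax xy yb Hc.
have [yc|cy] := leP y c.
  by case: H => H; [left|right] => r rxy; apply: H; lra.
have [cx|xc] := leP c x.
  by apply: HT => // t tT; apply: Hc; rewrite in_cons tT orbT.
by exfalso; apply: (Hc c (mem_head _ _)); lra.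
Qed.

(** * Landau's inequality: smallness passes to derivatives *)

Lemma mean_value_bound f (df : R -> R) a b K : a <= b ->
  (forall x, a <= x <= b -> is_derive x 1 f (df x)) ->
  (forall x, a <= x <= b -> `|df x| <= K) -> `|f b - f a| <= K * (b - a).
Proof.
move=> ab fd dfK.
have D1 x : a <= x <= b -> is_derive x 1 (fun y => K * y) K.
  move=> _; apply: (is_derive_eq (is_derive_mul (is_derive_cst K x 1) (is_derive_id x (1 : R)))).
  by rewrite /cst; ring.
have H1 := @derive_ge0_le R (fun y => K * y + f y) (fun x => K + df x) a b ab
  (fun x xab => is_derive_add (D1 x xab) (fd x xab)).
have H2 := @derive_ge0_le R (fun y => K * y - f y) (fun x => K - df x) a b ab
  (fun x xab => is_derive_sub (D1 x xab) (fd x xab)).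
have {}H1 : K * a + f a <= K * b + f b.
  by apply: H1 => x /dfK; rewrite ler_norml => /andP[]; lra.
have {}H2 : K * a - f a <= K * b - f b.
  by apply: H2 => x /dfK; rewrite ler_norml => /andP[]; lra.
by rewrite ler_norml; apply/andP; split; lra.
Qed.

(* Landau's inequality: were [u1 s] large, [u] would change sign near [s]. *)
Lemma landau_step (L La e : R) : 0 < L -> 0 <= La -> 0 < e ->
  exists2 k : R, 0 < k & forall (u u1 u2 : R -> R) s (N : R), 0 <= N ->
   (forall x, s - L <= x <= s + L -> is_derive x 1 u (u1 x)) ->
   (forall x, s - L <= x <= s + L -> is_derive x 1 u1 (u2 x)) ->
   (forall x, s - L <= x <= s + L -> `|u2 x| <= La * N) ->
   sgn_const u (s - L) (s + L) -> `|u s| <= k * N -> `|u1 s| <= e * N.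
Proof.
move=> L0 La0 e0.
(* Over a step [h] the variation of [u1] is at most [La * N * h <= e / 2 * N]; the other half of
   [e * N * h] is left to [u s]. *)
pose h := Num.min L (e / (2 * (La + 1))).
have h0 : 0 < h by rewrite lt_min L0 /= divr_gt0 //; lra.
have hL : h <= L by rewrite /h ge_min lexx.
have hLa : La * h <= e / 2.
  have : h <= e / (2 * (La + 1)) by rewrite /h ge_min lexx orbT.
  rewrite ler_pdivlMr; last lra.
  have := mulr_ge0 (ltW h0) La0; lra.
exists (e * h / 2); first by rewrite divr_gt0 // mulr_gt0.
suff W u u1 u2 s N : 0 <= N ->
   (forall x, s - L <= x <= s + L -> is_derive x 1 u (u1 x)) ->
   (forall x, s - L <= x <= s + L -> is_derive x 1 u1 (u2 x)) ->
   (forall x, s - L <= x <= s + L -> `|u2 x| <= La * N) ->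
   (forall x, s - L <= x <= s + L -> 0 <= u x) ->
   `|u s| <= (e * h / 2) * N -> `|u1 s| <= e * N.
  move=> u u1 u2 s N N0 D1 D2 B2 [H|H]; first exact: W N0 D1 D2 B2 H.
  move=> us; rewrite -normrN.
  have DN f df : (forall x, s - L <= x <= s + L -> is_derive x 1 f (df x)) ->
      forall x, s - L <= x <= s + L -> is_derive x 1 (fun y => - f y) (- df x).
    move=> Df x xs; have D := is_derive_sub (is_derive_cst 0 x 1) (Df x xs).
    by rewrite -sub0r; under eq_fun do rewrite -sub0r.
  apply: (W _ _ _ s N N0 (DN _ _ D1) (DN _ _ D2)).
  - by move=> x xs; rewrite normrN B2.
  - by move=> x xs; rewrite oppr_ge0 H.
  - by rewrite normrN.
move=> N0 D1 D2 B2 u0 us.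
have near x : s - h <= x <= s + h -> `|u1 x - u1 s| <= La * N * h.
  have LN : 0 <= La * N by rewrite mulr_ge0.
  move=> xs; have [sx|xs'] := leP s x.
    have := @mean_value_bound u1 u2 s x (La * N) sx.
    move=> H; apply: le_trans (H _ _) _; last by apply: ler_wpM2l => //; lra.
      by move=> y yx; apply: D2; lra.
    by move=> y yx; apply: B2; lra.
  rewrite distrC; have := @mean_value_bound u1 u2 x s (La * N) (ltW xs').
  move=> H; apply: le_trans (H _ _) _; last by apply: ler_wpM2l => //; lra.
    by move=> y yx; apply: D2; lra.
  by move=> y yx; apply: B2; lra.
have lin x : s - h <= x <= s + h -> is_derive x 1 (fun y => u y - u1 s * y) (u1 x - u1 s).
  move=> xs; have := is_derive_mul (is_derive_cst (u1 s) x 1) (is_derive_id x (1 : R)).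
  have D1x : is_derive x 1 u (u1 x) by apply: D1; lra.
  move=> D; apply: (is_derive_eq (is_derive_sub D1x D)).
  by rewrite /cst; ring.
have Q1 : `|u (s + h) - u1 s * (s + h) - (u s - u1 s * s)| <= La * N * h * (s + h - s).
  apply: (@mean_value_bound (fun y => u y - u1 s * y) (fun x => u1 x - u1 s) s (s + h)); first lra.
    by move=> x xs; apply: lin; lra.
  by move=> x xs; apply: near; lra.
have Q2 : `|u s - u1 s * s - (u (s - h) - u1 s * (s - h))| <= La * N * h * (s - (s - h)).
  apply: (@mean_value_bound (fun y => u y - u1 s * y) (fun x => u1 x - u1 s) (s - h) s); first lra.
    by move=> x xs; apply: lin; lra.
  by move=> x xs; apply: near; lra.
(* Given the linear approximation of [u] at [s], nonnegativity at [s + h] bounds [u1 s] from below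
   and nonnegativity at [s - h] bounds it from above. *)
have P1 : 0 <= u (s + h) by apply: u0; lra.
have P2 : 0 <= u (s - h) by apply: u0; lra.
have E : La * N * h * h <= e / 2 * N * h.
  have := ler_wpM2r (mulr_ge0 N0 (ltW h0)) hLa; lra.
move: us Q1 Q2; rewrite !ler_norml => /andP[us1 us2] /andP[q1 q2] /andP[q3 q4].
apply/andP; split; rewrite -(ler_pM2r h0); lra.
Qed.

(** Landau's inequality passes smallness from [q i] to [q i.+1]. Thresholds are chosen backwards:
    what is required of [q j] is the smaller of [e] and the threshold [k1] of the next step. *)
Lemma window_small (J : nat) (L La e : R) : 0 < L -> 0 <= La -> 0 < e ->
  exists2 k : R, 0 < k & forall q s (N : R), 0 <= N ->
   family_on (s - L) (s + L) q ->
   (forall i, (i < J)%N -> sgn_const (q i) (s - L) (s + L)) ->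
   (forall i x, (i <= J)%N -> s - L <= x <= s + L -> `|q i x| <= La * N) ->
   `|q 0%N s| <= k * N -> forall i, (i < J)%N -> `|q i s| <= e * N.
Proof.
move=> L0 La0 e0.
suff H j : exists2 k : R, 0 < k & forall q s (N : R), 0 <= N ->
   family_on (s - L) (s + L) q ->
   (forall i, (i < J)%N -> sgn_const (q i) (s - L) (s + L)) ->
   (forall i x, (i <= J)%N -> s - L <= x <= s + L -> `|q i x| <= La * N) ->
   `|q 0%N s| <= k * N -> forall i, (i <= j)%N -> (i < J)%N -> `|q i s| <= e * N.
  have [k k0 Hk] := H J; exists k => // q s N N0 qf qc qb q0 i iJ.
  by apply: (Hk q s N) => //; exact: ltnW.
elim: j e e0 => [|j IH] e e0.
  by exists e => // q s N N0 _ _ _ q0 [|//].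
have [k1 k10 H1] := landau_step L0 La0 e0.
have [|k k0 Hk] := IH (Num.min e k1); first by rewrite lt_min e0.
exists k => // q s N N0 qf qc qb q0 i ij iJ.
have Hk' r : (r <= j)%N -> (r < J)%N -> `|q r s| <= e * N /\ `|q r s| <= k1 * N.
  move=> rj rJ; have H := Hk q s N N0 qf qc qb q0 r rj rJ.
  by split; apply: le_trans H _; apply: ler_wpM2r => //; rewrite ge_min lexx ?orbT.
case: i ij iJ => [|i] ij iJ; first by have [] := Hk' 0%N isT iJ.
apply: (H1 (q i) (q i.+1) (q i.+2) s N N0).
- exact: qf.
- exact: qf.
- by move=> x xs; exact: qb.
- by apply: qc; exact: ltnW.
- by have [] := Hk' i ij (ltnW iJ).
Qed.

(** [T] collects the sign changes of the derivatives of an approximating quasipolynomial [q].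
    Farther than [L] from them these derivatives keep their signs on a window, so smallness of [G 0]
    passes to the whole jet. The condition [2 * K + 3 <= beta] makes the error of approximation
    decay at least like [expR s]. *)
Lemma real_window ls (J : nat) K C beta La e L : 0 <= K -> 0 <= C -> 0 <= La -> 0 < e -> 0 < L ->
  2 * K + 3 <= beta ->
  exists (k M : R) (m : nat), [/\ 0 < k, 0 <= M & forall a b nu G, a <= b -> b <= - M ->
  (forall s, a <= s <= b -> 0 <= nu s) ->
  (forall s t, a <= s <= b -> a <= t <= b -> nu t <= nu s * expR (K * `|s - t|)) ->
  family_on a b G ->
  (forall i s, (i <= J)%N -> a <= s <= b -> `|G i s| <= La * nu s) ->
  (forall i s, (i <= J)%N -> a <= s <= b -> `|shift_ops ls G i s| <= C * expR (beta * s) * nu s) ->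
  exists2 T : seq R, (size T <= m)%N &
   forall s, a + L <= s <= b - L -> (forall t, t \in T -> L < `|t - s|) ->
    `|G 0%N s| <= k * nu s -> forall i, (i < J)%N -> `|G i s| <= e * nu s].
Proof.
move=> K0 C0 La0 e0 L0 Kb.
(* Bounds the derivatives of [q] on a window of radius [L] by [nu] at its centre: [La + 1] comes
   from [|q| <= |G| + nu], and [expR (K * L)] from the variation of [nu]. *)
pose La1 := (La + 1) * expR (K * L).
have La10 : 0 <= La1 by rewrite mulr_ge0 ?expR_ge0 //; lra.
have e20 : 0 < e / 2 by lra.
have [k k0 Hk] := window_small J L0 La10 e20.
pose d := Num.min 1 (Num.min (e / 2) (k / 2)).
have d0 : 0 < d by rewrite !lt_min ltr01 e20 /=; lra.
have [d1 de dk] : [/\ d <= 1, d <= e / 2 & d <= k / 2].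
  by rewrite /d !ge_min !lexx !orbT.
pose A := C * stage_const J ls.
have A0 : 0 <= A by rewrite mulr_ge0 // stage_const_ge0.
(* This is [2 ^ size ls - 1]: the count starts at 0 for the zero function. *)
pose m := iter (size ls) (fun m => m.*2.+1) 0%N.
(* For [s <= - (A / d)] the inequality [1 - s <= expR (- s)] gives [A * expR s <= d]. The halves of
   [k] and [e] pay for the difference between [G] and [q]. *)
exists (k / 2), (A / d), (J * m)%N; split; [by lra|by rewrite divr_ge0 // ltW|].
move=> a b nu G ab bM nu0 nuK Gf Gb Hb.
have M0 : 0 <= A / d by rewrite divr_ge0 // ltW.
have b0 : b <= 0 by lra.
have [q [qf q0] qb] := approx_quasipolynomial ab b0 K0 C0 nu0 nuK Gf Hb.
have qd i s : (i <= J)%N -> a <= s <= b -> `|G i s - q i s| <= d * nu s.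
  move=> iJ sab; apply: le_trans (qb i s iJ sab) _; apply: ler_wpM2r; first exact: nu0.
  rewrite -/A.
  have s0 : 0 <= - s - A / d by lra.
  have H1 : A / d <= expR (- s).
    by have := expR_ge1Dx (- s); lra.
  have H2 : expR ((beta - (2 * K + 2)) * s) <= expR s.
    rewrite ler_expR; have : 0 <= (beta - (2 * K + 2) - 1) * - s by apply: mulr_ge0; lra.
    lra.
  apply: le_trans (ler_wpM2l A0 H2) _.
  move: H1; rewrite ler_pdivrMr // => H1.
  have := ler_wpM2r (expR_ge0 s) H1.
  have E : expR (- s) * expR s = 1 by rewrite -expRD addNr expR0.
  by rewrite [X in _ <= X]mulrAC E mul1r.
have [T Tm HT] : exists2 T : seq R, (size T <= J * m)%N & forall i, (i < J)%N ->
    forall x y, a <= x -> x <= y -> y <= b -> (forall t, t \in T -> ~ (x <= t <= y)) ->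
      sgn_const (q i) x y.
  have P i : sgn_pieces m (q i) a b.
    apply: (quasipolynomial_pieces ab qf (ls := ls)) => r /=.
    by left=> x _; rewrite q0.
  elim: J {Hk A A0 M0 bM Gb Hb qb qd} => [|J [T Tm HT]]; first by exists [::].
  have [T' Tm' HT'] := sgn_pieces_breakpoints (P J).
  exists (T' ++ T); first by rewrite size_cat mulSn leq_add.
  move=> i; rewrite ltnS leq_eqVlt => /orP[/eqP ->|iJ] x y ax xy yb H.
    by apply: HT' => // t tT; apply: H; rewrite mem_cat tT.
  by apply: (HT i iJ) => // t tT; apply: H; rewrite mem_cat tT orbT.
exists T => // s sab sT G0 i iJ.
have sab' : a <= s <= b by lra.
have N0 := nu0 s sab'.
have := qd i s (ltnW iJ) sab'.
have /= := Hk q s (nu s) N0 _ _ _ _ i iJ.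
set w := nu s in N0 G0 *.
have dw : d * w <= e / 2 * w by exact: ler_wpM2r.
move=> H1 H2.
have {}H1 : `|q i s| <= e / 2 * w.
  apply: H1.
  - by move=> r x xs; apply: qf; lra.
  - move=> r rJ; apply: (HT r rJ); [lra|lra|lra|].
    move=> t tT ts; have := sT t tT; rewrite ltNge => /negP; apply.
    by rewrite ler_norml; apply/andP; split; lra.
  - move=> r x rJ xs; have xab : a <= x <= b by lra.
    have Q : `|q r x| <= (La + 1) * nu x.
      have -> : q r x = G r x - (G r x - q r x) by ring.
      apply: le_trans (ler_normB _ _) _.
      have := qd r x rJ xab; have := Gb r x rJ xab.
      have : d * nu x <= 1 * nu x by apply: ler_wpM2r => //; exact: nu0.
      lra.
    apply: le_trans Q _; rewrite /La1 -mulrA; apply: ler_wpM2l; first lra.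
    apply: le_trans (nuK s x sab' xab) _; rewrite mulrC; apply: ler_wpM2r => //.
    rewrite ler_expR; apply: ler_wpM2l => //.
    by rewrite ler_norml; apply/andP; split; lra.
  - have -> : q 0%N s = G 0%N s - (G 0%N s - q 0%N s) by ring.
    apply: le_trans (ler_normB _ _) _.
    have := qd 0%N s isT sab'; rewrite -/w.
    have : d * w <= k / 2 * w by exact: ler_wpM2r.
    lra.
have -> : G i s = q i s + (G i s - q i s) by ring.
apply: le_trans (ler_normD _ _) _; lra.
Qed.

End RealWindow.

(** * Epsilon form of differentiability, for the real and complex fields alike *)

Section DeriveEps.
Variable K : numFieldType.
Implicit Types (f g : K -> K) (x l : K).

Lemma is_derive_epsP f x l : is_derive x 1 f l <->
  (forall e : K, 0 < e -> exists2 d : K, 0 < d & forall h, `|h| < d ->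
     `|f (x + h) - f x - l * h| <= e * `|h|).
Proof.
pose q h : K := h^-1 *: (f (h *: 1 + x) - f x).
have E h : h != 0 -> `|f (x + h) - f x - l * h| = `|l - q h| * `|h|.
  move=> h0; rewrite -normrM distrC; congr `| _ |.
  by rewrite /q /GRing.scale /= mulr1 [h + x]addrC mulrBl mulrAC mulVf // mul1r opprB addrA addrAC [in LHS]addrC; ring.
split=> [[fd fl] e e0|H].
  have : q h @[h --> 0^'] --> l by rewrite -fl; exact: fd.
  move=> /cvgrPdist_le /(_ e e0).
  rewrite /dnbhs /within /= => /nbhs_ballP[d /= d0 Hd].
  exists d => // h hd; have [->|h0] := eqVneq h 0.
    by rewrite addr0 subrr mulr0 subrr normr0 mulr0.
  rewrite E //; apply: ler_wpM2r => //; apply: (Hd h) => //.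
  by rewrite /ball /= sub0r normrN.
have Q : q h @[h --> 0^'] --> l.
  apply/cvgrPdist_le => e e0; have [d d0 Hd] := H e e0.
  rewrite /dnbhs /within /=; apply/nbhs_ballP; exists d => //= h hd h0.
  rewrite /ball /= sub0r normrN in hd.
  by have := Hd h hd; rewrite E // ler_pM2r // normr_gt0.
by split; [apply/cvg_ex; exists l|exact: cvg_lim].
Qed.

(** [K] may be only partially ordered, as the complex numbers are, but positive elements are
    comparable. *)
Lemma exists_pos_min (d1 d2 : K) : 0 < d1 -> 0 < d2 -> exists2 d : K, 0 < d & d <= d1 /\ d <= d2.
Proof.
move=> d10 d20; have /orP[H|H] := real_leVge (gtr0_real d10) (gtr0_real d20).
  by exists d1.
by exists d2.
Qed.

Lemma is_derive_chain f g x (a b : K) :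
  is_derive (g x) 1 f a -> is_derive x 1 g b -> is_derive x 1 (fun y => f (g y)) (a * b).
Proof.
move=> /is_derive_epsP Hf /is_derive_epsP Hg; apply/is_derive_epsP => e e0.
have b1 : 0 < `|b| + 1 by rewrite ltr_wpDl.
have a1 : 0 < `|a| + 1 by rewrite ltr_wpDl.
have e20 : 0 < e / 2 by rewrite divr_gt0.
have [d1 d10 H1] := Hf (e / 2 / (`|b| + 1)) (divr_gt0 e20 b1).
have [d2 d20 H2] := Hg (e / 2 / (`|a| + 1)) (divr_gt0 e20 a1).
have [d3 d30 H3] := Hg 1 ltr01.
have [d4 d40 [d42 d43]] := exists_pos_min d20 d30.
have [d d0 [dd1 dd4]] := exists_pos_min (divr_gt0 d10 b1) d40.
exists d => // h hd.
have hd2 : `|h| < d2 by apply: lt_le_trans hd (le_trans dd4 d42).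
have hd3 : `|h| < d3 by apply: lt_le_trans hd (le_trans dd4 d43).
pose k := g (x + h) - g x.
have kb : `|k| <= (`|b| + 1) * `|h|.
  have -> : k = (k - b * h) + b * h by rewrite subrK.
  rewrite mulrDl mul1r addrC; apply: le_trans (ler_normD _ _) _.
  by rewrite normrM lerD2l -[leRHS]mul1r; exact: H3.
have kd : `|k| < d1.
  by apply: le_lt_trans kb _; rewrite mulrC -ltr_pdivlMr //; exact: lt_le_trans hd dd1.
have -> : f (g (x + h)) - f (g x) - a * b * h =
    (f (g x + k) - f (g x) - a * k) + a * (k - b * h).
  have -> : g x + k = g (x + h) by rewrite /k addrC subrK.
  ring.
apply: le_trans (ler_normD _ _) _.
have -> : e * `|h| = e / 2 / (`|b| + 1) * ((`|b| + 1) * `|h|) + e / 2 * `|h|.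
  by rewrite mulrA divfK ?gt_eqF // -mulrDl -splitr.
apply: lerD.
  by apply: le_trans (H1 k kd) _; apply: ler_wpM2l => //; rewrite ltW // divr_gt0.
rewrite normrM; apply: le_trans (ler_wpM2l (normr_ge0 _) (H2 h hd2)) _.
rewrite mulrA; apply: ler_wpM2r => //.
rewrite mulrCA -[leRHS]mulr1; apply: ler_wpM2l; first exact: ltW.
by rewrite ler_pdivrMr // mul1r lerDl.
Qed.

Lemma is_derive_horner (p : {poly K}) x : is_derive x 1 (horner p) p^`().[x].
Proof.
elim/poly_ind: p => [|p c IH].
  rewrite deriv0 horner0; have -> : horner (0 : {poly K}) = cst 0.
    by apply/funext => y; rewrite horner0.
  exact: is_derive_cst.
have -> : horner (p * 'X + c%:P) = (fun y => p.[y] * y + cst c y).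
  by apply/funext => y; rewrite !hornerE.
have D := is_derive_add (is_derive_mul IH (is_derive_id x (1 : K))) (is_derive_cst c x (1 : K)).
apply: (is_derive_eq D).
by rewrite derivD derivM derivC derivX !hornerE addrC.
Qed.

Lemma is_derive_exprn f x l n : is_derive x 1 f l ->
  is_derive x 1 (fun y => f y ^+ n) (n%:R * f x ^+ n.-1 * l).
Proof.
move=> H; have D := is_deriveX n H; rewrite exprfctE in D.
by apply: (is_derive_eq D).
Qed.

Lemma is_derive_inv x : x != 0 -> is_derive x 1 (fun y : K => y^-1) (- (x ^+ 2)^-1).
Proof.
move=> x0; have D := is_derive_id x (1 : K).
split; first by apply: derivableV => //; case: D.
by rewrite deriveV //; case: D => _ ->; rewrite /GRing.scale /= mulr1.
Qed.

Lemma is_derive_near f g x l (d : K) : 0 < d -> (forall h, `|h| < d -> f (x + h) = g (x + h)) ->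
  is_derive x 1 f l -> is_derive x 1 g l.
Proof.
move=> d0 E /is_derive_epsP H; apply/is_derive_epsP => e e0.
have [d1 d10 H1] := H e e0; have [d2 d20 [d2d d2d1]] := exists_pos_min d0 d10.
exists d2 => // h hd; rewrite -E ?(lt_le_trans hd) //.
have := E 0; rewrite normr0 addr0 => <- //.
by apply: H1; exact: lt_le_trans hd d2d1.
Qed.
End DeriveEps.

(** * Complex differentiation along segments *)

Section Modulus.
Variable R : realType.
Local Notation C := (cplx R).
Local Notation Re := (@complex.Re R).
Local Notation Im := (@complex.Im R).
Implicit Types (z w : C) (a b : R).

Definition ofR (a : R) : C := real_complex R a.

#[local] Arguments ofR : simpl never.

Lemma ofR_inj : injective ofR. Proof. exact: complexI. Qed.
Lemma ofRD a b : ofR (a + b) = ofR a + ofR b. Proof. exact: rmorphD. Qed.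
Lemma ofRM a b : ofR (a * b) = ofR a * ofR b. Proof. exact: rmorphM. Qed.
Lemma ofRB a b : ofR (a - b) = ofR a - ofR b. Proof. exact: rmorphB. Qed.
Lemma ofRV a : ofR a^-1 = (ofR a)^-1. Proof. exact: fmorphV. Qed.
Lemma ofRX a n : ofR (a ^+ n) = ofR a ^+ n. Proof. exact: rmorphXn. Qed.
Lemma ofR_nat n : ofR n%:R = n%:R. Proof. exact: rmorph_nat. Qed.
Lemma ofR0 : ofR 0 = 0. Proof. exact: rmorph0. Qed.
Lemma ofR1 : ofR 1 = 1. Proof. exact: rmorph1. Qed.
Lemma le_ofR a b : (ofR a <= ofR b) = (a <= b). Proof. exact: lecR. Qed.
Lemma lt_ofR a b : (ofR a < ofR b) = (a < b). Proof. exact: ltcR. Qed.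

(* The library's modulus takes its values in [C]. *)
Definition cabs z : R := Num.sqrt (Re z ^+ 2 + Im z ^+ 2).

Lemma cabsE z : `|z| = ofR (cabs z).
Proof. exact: normc_def. Qed.

Lemma cabs_ge0 z : 0 <= cabs z. Proof. exact: sqrtr_ge0. Qed.

Lemma cabsM z w : cabs (z * w) = cabs z * cabs w.
Proof. by apply: ofR_inj; rewrite ofRM -!cabsE normrM. Qed.

Lemma cabsD z w : cabs (z + w) <= cabs z + cabs w.
Proof. by rewrite -le_ofR ofRD -!cabsE; exact: ler_normD. Qed.

Lemma cabsN z : cabs (- z) = cabs z.
Proof. by apply: ofR_inj; rewrite -!cabsE normrN. Qed.

Lemma cabsB z w : cabs (z - w) <= cabs z + cabs w.
Proof. by rewrite -(cabsN w) cabsD. Qed.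

Lemma cabs_distC z w : cabs (z - w) = cabs (w - z).
Proof. by rewrite -cabsN opprB. Qed.

Lemma cabs0 : cabs (0 : C) = 0.
Proof. by apply: ofR_inj; rewrite -cabsE normr0 ofR0. Qed.

Lemma cabs_eq0 z : (cabs z == 0) = (z == 0).
Proof.
rewrite -(normr_eq0 z) cabsE.
by rewrite -ofR0; apply/eqP/eqP => [->|/ofR_inj].
Qed.

Lemma cabs_gt0 z : (0 < cabs z) = (z != 0).
Proof. by rewrite lt_def cabs_ge0 andbT cabs_eq0. Qed.

Lemma cabsV z : cabs z^-1 = (cabs z)^-1.
Proof. by apply: ofR_inj; rewrite -cabsE normfV cabsE ofRV. Qed.

Lemma cabsX z n : cabs (z ^+ n) = cabs z ^+ n.
Proof. by apply: ofR_inj; rewrite -cabsE normrX cabsE ofRX. Qed.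

Lemma cabs_real a : cabs (ofR a) = `|a|.
Proof. by rewrite /cabs /= expr0n addr0 sqrtr_sqr. Qed.

Lemma cabs_nat n : cabs (n%:R : C) = n%:R.
Proof. by apply: ofR_inj; rewrite -cabsE normr_nat ofR_nat. Qed.

Lemma cabs_sqr z : cabs z ^+ 2 = Re z ^+ 2 + Im z ^+ 2.
Proof. by rewrite sqr_sqrtr // addr_ge0 ?sqr_ge0. Qed.

Lemma Re_le_cabs z : `|Re z| <= cabs z.
Proof. by rewrite -ler_sqr ?nnegrE ?cabs_ge0 // cabs_sqr real_normK ?num_real // lerDl sqr_ge0. Qed.

Lemma Im_le_cabs z : `|Im z| <= cabs z.
Proof. by rewrite -ler_sqr ?nnegrE ?cabs_ge0 // cabs_sqr real_normK ?num_real // lerDr sqr_ge0. Qed.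

Lemma cabs_le_ReIm z : cabs z <= `|Re z| + `|Im z|.
Proof.
rewrite -ler_sqr ?nnegrE ?cabs_ge0 ?addr_ge0 // cabs_sqr sqrrD !real_normK ?num_real //.
by rewrite addrAC lerDl mulrn_wge0 // mulr_ge0.
Qed.

Lemma cReD z w : Re (z + w) = Re z + Re w. Proof. by case: z => ? ?; case: w. Qed.
Lemma cImD z w : Im (z + w) = Im z + Im w. Proof. by case: z => ? ?; case: w. Qed.
Lemma cReN z : Re (- z) = - Re z. Proof. by case: z. Qed.
Lemma cImN z : Im (- z) = - Im z. Proof. by case: z. Qed.
Lemma cReB z w : Re (z - w) = Re z - Re w. Proof. by rewrite cReD cReN. Qed.
Lemma cImB z w : Im (z - w) = Im z - Im w. Proof. by rewrite cImD cImN. Qed.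
Lemma cReM z w : Re (z * w) = Re z * Re w - Im z * Im w. Proof. by case: z => ? ?; case: w. Qed.
Lemma cImM z w : Im (z * w) = Re z * Im w + Im z * Re w. Proof. by case: z => ? ?; case: w. Qed.

Lemma Re_real_mul a z : Re (ofR a * z) = a * Re z.
Proof. by rewrite cReM /= mul0r subr0. Qed.

Lemma Im_real_mul a z : Im (ofR a * z) = a * Im z.
Proof. by rewrite cImM /= mul0r addr0. Qed.

Lemma ofR_Re z : z \is Num.real -> ofR (Re z) = z. Proof. exact: RRe_real. Qed.

(** A positive element of [C] is real, so real tolerances and radii suffice. *)
Lemma is_derive_cabsP (F : C -> C) z l : is_derive z 1 F l <->
  (forall e : R, 0 < e -> exists2 d : R, 0 < d & forall h, cabs h < d ->
     cabs (F (z + h) - F z - l * h) <= e * cabs h).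
Proof.
rewrite is_derive_epsP; split=> H e e0.
  have [|d d0 Hd] := H (ofR e); first by rewrite -ofR0 lt_ofR.
  have dr : d \is Num.real by exact: gtr0_real.
  exists (Re d).
    by rewrite -lt_ofR ofR0 ofR_Re.
  move=> h hd; have := Hd h; rewrite !cabsE -ofRM le_ofR; apply.
  by rewrite -(ofR_Re dr) lt_ofR.
have er : e \is Num.real by exact: gtr0_real.
have [|d d0 Hd] := H (Re e); first by rewrite -lt_ofR ofR0 ofR_Re.
exists (ofR d); first by rewrite -ofR0 lt_ofR.
by move=> h; rewrite !cabsE lt_ofR -(ofR_Re er) -ofRM le_ofR; exact: Hd.
Qed.

Lemma is_derive_line (F : C -> C) z w t l : is_derive (z + ofR t * w) 1 F l ->
  is_derive t 1 (fun s : R => Re (F (z + ofR s * w))) (Re (l * w)) /\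
  is_derive t 1 (fun s : R => Im (F (z + ofR s * w))) (Im (l * w)).
Proof.
move=> /is_derive_cabsP H.
have Q (e : R) : 0 < e -> exists2 d : R, 0 < d & forall h : R, `|h| < d ->
    cabs (F (z + ofR (t + h) * w) - F (z + ofR t * w) - ofR h * (l * w)) <= e * `|h|.
  move=> e0; have w1 : 0 < cabs w + 1 by rewrite ltr_wpDl // cabs_ge0.
  have [d d0 Hd] := H (e / (cabs w + 1)) (divr_gt0 e0 w1).
  exists (d / (cabs w + 1)); first by rewrite divr_gt0.
  move=> h; rewrite ltr_pdivlMr // => hd.
  have hw : cabs (ofR h * w) <= `|h| * (cabs w + 1).
    by rewrite cabsM cabs_real ler_wpM2l // lerDl.
  have := Hd _ (le_lt_trans hw hd).
  have -> : z + ofR t * w + ofR h * w = z + ofR (t + h) * w by rewrite ofRD; ring.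
  have -> : l * (ofR h * w) = ofR h * (l * w) by ring.
  move=> H1; apply: le_trans H1 _.
  apply: le_trans (ler_wpM2l _ hw) _; first by rewrite divr_ge0 ?ltW.
  by rewrite mulrA mulrAC divfK ?gt_eqF.
split; apply/is_derive_epsP => e e0; have [d d0 Hd] := Q e e0; exists d => // h /Hd Hh.
  by apply: le_trans Hh; apply: le_trans (Re_le_cabs _); rewrite !cReB Re_real_mul [h * _]mulrC.
by apply: le_trans Hh; apply: le_trans (Im_le_cabs _); rewrite !cImB Im_real_mul [h * _]mulrC.
Qed.

(** Projecting [g] on the direction of [w = g b - g a] gives a real function; by Cauchy-Schwarz,
    [cabs w * phi] minus this projection is nondecreasing. *)
Lemma mean_value_cabs (g dg : R -> C) (phi dphi : R -> R) a b : a <= b ->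
  (forall x, a <= x <= b -> is_derive x 1 (fun s => Re (g s)) (Re (dg x)) /\
                            is_derive x 1 (fun s => Im (g s)) (Im (dg x))) ->
  (forall x, a <= x <= b -> is_derive x 1 phi (dphi x)) ->
  (forall x, a <= x <= b -> cabs (dg x) <= dphi x) ->
  cabs (g b - g a) <= phi b - phi a.
Proof.
move=> ab Hg Hphi H.
set w := g b - g a; set p := Re w; set q := Im w.
have [w0|w0] := leP (cabs w) 0.
  apply: le_trans w0 _; rewrite subr_ge0.
  by apply: (derive_ge0_le ab Hphi) => x xab; apply: le_trans (H x xab); exact: cabs_ge0.
have CS x : p * Re (dg x) + q * Im (dg x) <= cabs w * cabs (dg x).
  have -> : p * Re (dg x) + q * Im (dg x) = Re ((Complex p (- q) : C) * dg x).
    by rewrite cReM /= mulNr opprK.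
  apply: le_trans (ler_norm _) _; apply: le_trans (Re_le_cabs _) _.
  by rewrite cabsM /cabs /= sqrrN.
have := @derive_ge0_le R (fun x => cabs w * phi x - (p * Re (g x) + q * Im (g x)))
  (fun x => cabs w * dphi x - (p * Re (dg x) + q * Im (dg x))) a b ab _ _.
have D (c : R) (f : R -> R) (df x : R) : is_derive x 1 f df -> is_derive x 1 (fun y : R => c * f y) (c * df).
  move=> Hf; apply: (is_derive_eq (is_derive_mul (is_derive_cst c x 1) Hf)).
  by rewrite /cst mul0r addr0.
move=> Q; have {}Q : cabs w * phi a - (p * Re (g a) + q * Im (g a)) <=
    cabs w * phi b - (p * Re (g b) + q * Im (g b)).
  apply: Q => x xab.
    have [H1 H2] := Hg x xab.
    exact: is_derive_sub (D _ _ _ _ (Hphi x xab)) (is_derive_add (D _ _ _ _ H1) (D _ _ _ _ H2)).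
  rewrite subr_ge0; apply: le_trans (CS x) _; apply: ler_wpM2l; [exact: ltW|exact: H].
rewrite -(ler_pM2l w0); have := cabs_sqr w; rewrite -/p -/q expr2 => ->.
have -> : p ^+ 2 + q ^+ 2 = p * (Re (g b) - Re (g a)) + q * (Im (g b) - Im (g a)).
  by rewrite -cReB -cImB -/w -/p -/q; ring.
lra.
Qed.

End Modulus.
Arguments ofR : simpl never.
Arguments cabs : simpl never.

(** * Division by z - z0, and zeros of functions with a nearly constant derivative *)

Section ComplexFamilies.
Variable R : realType.
Local Notation C := (cplx R).
Local Notation Re := (@complex.Re R).
Local Notation Im := (@complex.Im R).
Implicit Types (K : set C) (F G : nat -> C -> C).

Definition convex_region K := forall z w (t : R), K z -> K w -> 0 <= t <= 1 -> K (z + ofR t * (w - z)).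

Definition open_region K := forall z, K z -> exists2 d : R, 0 < d & forall h, cabs h < d -> K (z + h).

Definition cfamily K F := forall k z, K z -> is_derive z 1 (F k) (F k.+1 z).

(* Taylor polynomial of order [k] at [z], evaluated at [z0]. *)
Fixpoint taylor_eval F (z0 : C) (k : nat) (z : C) : C :=
  if k is k'.+1 then taylor_eval F z0 k' z + F k z * ((z0 - z) ^+ k / k`!%:R) else F 0%N z.

Lemma natC_neq0 n : n.+1%:R != 0 :> C. Proof. by rewrite pnatr_eq0. Qed.

Lemma factC_neq0 n : n`!%:R != 0 :> C. Proof. by rewrite pnatr_eq0 -lt0n fact_gt0. Qed.

Lemma is_derive_pow_sub (z0 z : C) k :
  is_derive z 1 (fun y => (z0 - y) ^+ k.+1) (- (k.+1%:R * (z0 - z) ^+ k)).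
Proof.
have D := @is_derive_exprn _ _ _ _ k.+1 (is_derive_sub (is_derive_cst z0 z (1 : C)) (is_derive_id z (1 : C))).
by apply: (is_derive_eq D); rewrite /= /cst; ring.
Qed.

(** Differentiation in the centre [z] makes consecutive terms telescope; only the top one
    remains. *)
Lemma taylor_eval_derive K F z0 k z : cfamily K F -> K z ->
  is_derive z 1 (taylor_eval F z0 k) (F k.+1 z * ((z0 - z) ^+ k / k`!%:R)).
Proof.
move=> HF Kz; elim: k => [|k IH].
  by apply: (is_derive_eq (HF 0%N z Kz)); rewrite expr0 fact0 divr1 mulr1.
have D := is_derive_mul (is_derive_pow_sub z0 z k) (is_derive_cst (k.+1`!%:R^-1 : C) z (1 : C)).
apply: (is_derive_eq (is_derive_add IH (is_derive_mul (HF k.+1 z Kz) D))).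
rewrite /cst factS natrM; field.
by rewrite factC_neq0 nat1r natC_neq0.
Qed.

Lemma taylor_eval_self F z0 k : taylor_eval F z0 k z0 = F 0%N z0.
Proof. by elim: k => [//|k IH] /=; rewrite IH subrr expr0n mul0r mulr0 addr0. Qed.

(** When [F 0 z0 = 0] this is the [k]-th derivative of [F 0 z / (z - z0)], by Leibniz' rule, with
    its limit as the value at [z0]. *)
Definition quotient_family F z0 (k : nat) (z : C) : C :=
  if z == z0 then F k.+1 z0 / k.+1%:R
  else (-1) ^+ k * k`!%:R * taylor_eval F z0 k z / (z - z0) ^+ k.+1.

Lemma is_derive_ofR_line (f : C -> C) z w (t : R) l : is_derive (z + ofR t * w) 1 f l ->
  is_derive t 1 (fun s : R => Re (f (z + ofR s * w))) (Re (l * w)) /\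
  is_derive t 1 (fun s : R => Im (f (z + ofR s * w))) (Im (l * w)).
Proof. exact: is_derive_line. Qed.

Lemma is_derive_ofR (c : C) (p dp : R -> R) (t : R) : is_derive t 1 p (dp t) ->
  is_derive t 1 (fun s : R => Re (ofR (p s) * c)) (Re (ofR (dp t) * c)) /\
  is_derive t 1 (fun s : R => Im (ofR (p s) * c)) (Im (ofR (dp t) * c)).
Proof.
have D (a b : R) (f : R -> R) : is_derive t 1 f b -> is_derive t 1 (fun y : R => f y * a) (b * a).
  move=> Hf; apply: (is_derive_eq (is_derive_mul Hf (is_derive_cst a t 1))).
  by rewrite /cst mulr0 add0r.
move=> H; rewrite Re_real_mul Im_real_mul.
split; [under eq_fun do rewrite Re_real_mul|under eq_fun do rewrite Im_real_mul]; exact: D.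
Qed.

Lemma is_derive_expn n (t : R) : is_derive t 1 (fun s : R => s ^+ n.+1 / n.+1%:R) (t ^+ n).
Proof.
have n0 : n.+1%:R != 0 :> R by rewrite pnatr_eq0.
have D := is_derive_mul (@is_derive_exprn _ _ _ _ n.+1 (is_derive_id t (1 : R))) (is_derive_cst (n.+1%:R^-1 : R) t 1).
apply: (is_derive_eq D); rewrite /cst /=; field.
by rewrite nat1r.
Qed.

(* The Taylor remainder divided by [(z - z0)^(k+1)] averages [F k.+1] over the segment from
   [z0] to [z], with weight [s^k]. *)
Lemma quotient_family_bound K F z0 w k (a c : C) (e0 e1 : R) :
  cfamily K F -> (forall s : R, 0 <= s <= 1 -> K (z0 + ofR s * w)) -> F 0%N z0 = 0 -> w != 0 ->
  (forall s : R, 0 <= s <= 1 ->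
     cabs (F k.+1 (z0 + ofR s * w) - a - ofR s * c) <= e0 + e1 * s) ->
  cabs (quotient_family F z0 k (z0 + w) - a / k.+1%:R - c / k.+2%:R)
    <= e0 / k.+1%:R + e1 / k.+2%:R.
Proof.
move=> HF Kw F0 w0 Hb.
(* [m] normalises [g], which is 0 at 0 and the quantity to bound at 1. The affine model [a + s * c]
   serves twice: with [c = 0] to count zeros, and with [c = F k.+2 z0 * w] for the derivative at
   [z0]. *)
pose m := (-1) ^+ k * k`!%:R / w ^+ k.+1 : C.
pose g s := m * taylor_eval F z0 k (z0 + ofR s * w) - ofR (s ^+ k.+1 / k.+1%:R) * a
   - ofR (s ^+ k.+2 / k.+2%:R) * c.
pose dg s := ofR (s ^+ k) * (F k.+1 (z0 + ofR s * w) - a - ofR s * c).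
pose phi s : R := e0 * (s ^+ k.+1 / k.+1%:R) + e1 * (s ^+ k.+2 / k.+2%:R).
pose dphi s : R := e0 * s ^+ k + e1 * s ^+ k.+1.
have Dscale (b : R) (f : R -> R) (df t : R) : is_derive t 1 f df -> is_derive t 1 (fun y : R => b * f y) (b * df).
  move=> Hf; apply: (is_derive_eq (is_derive_mul (is_derive_cst b t 1) Hf)).
  by rewrite /cst mul0r addr0.
have Hdg (t : R) : 0 <= t <= 1 -> is_derive t 1 (fun s => Re (g s)) (Re (dg t)) /\
                            is_derive t 1 (fun s => Im (g s)) (Im (dg t)).
  move=> t01.
  have D0 : is_derive (z0 + ofR t * w) 1 (fun y => m * taylor_eval F z0 k y)
     (m * (F k.+1 (z0 + ofR t * w) * ((z0 - (z0 + ofR t * w)) ^+ k / k`!%:R))).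
    have D := is_derive_mul (is_derive_cst m (z0 + ofR t * w) (1 : C)) (taylor_eval_derive z0 k HF (Kw t t01)).
    by apply: (is_derive_eq D); rewrite /cst mul0r addr0.
  have [D1 D2] := is_derive_ofR_line D0.
  have [D3 D4] := @is_derive_ofR a _ (fun s => s ^+ k) t (is_derive_expn k t).
  have [D5 D6] := @is_derive_ofR c _ (fun s => s ^+ k.+1) t (is_derive_expn k.+1 t).
  have E : dg t = (m * (F k.+1 (z0 + ofR t * w) * ((z0 - (z0 + ofR t * w)) ^+ k / k`!%:R))) * w
      - ofR (t ^+ k) * a - ofR (t ^+ k.+1) * c.
    have -> : z0 - (z0 + ofR t * w) = - 1 * (ofR t * w) by ring.
    have S1 : (-1) ^+ k * (-1) ^+ k = 1 :> C by rewrite -exprMn mulrNN mulr1 expr1n.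
    rewrite /dg /m !exprMn !ofRX !exprS.
    set u := F _ _; set v := ofR t; set f := k`!%:R.
    have -> : (-1) ^+ k * f / (w * w ^+ k) * (u * ((-1) ^+ k * (v ^+ k * w ^+ k) / f)) * w =
       ((-1) ^+ k * (-1) ^+ k) * (u * v ^+ k).
      by field; rewrite expf_neq0 // w0 factC_neq0.
    rewrite S1; ring.
  rewrite E !cReB !cImB; split.
    under eq_fun do rewrite /g !cReB; exact: is_derive_sub (is_derive_sub D1 D3) D5.
  under eq_fun do rewrite /g !cImB; exact: is_derive_sub (is_derive_sub D2 D4) D6.
have := @mean_value_cabs R g dg phi dphi 0 1 ler01 Hdg.
have -> : phi 1 - phi 0 = e0 / k.+1%:R + e1 / k.+2%:R.
  by rewrite /phi !expr1n !expr0n /= !mul0r !mulr0 !mul1r addr0 subr0.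
have -> : g 1 - g 0 = quotient_family F z0 k (z0 + w) - a / k.+1%:R - c / k.+2%:R.
  have Ew : (z0 + w == z0) = false.
    by rewrite -[X in _ == X]addr0 (inj_eq (addrI z0)) (negPf w0).
  rewrite /g /quotient_family Ew !expr1n !expr0n /= !mul0r addr0 taylor_eval_self F0 mulr0 !subr0.
  by rewrite ofR1 !mul1r !ofRV !ofR_nat [z0 + w]addrC addrK /m; ring.
apply.
- move=> t _; apply: is_derive_add; apply: Dscale; exact: is_derive_expn.
- move=> t t01; have /andP[t0 _] := t01.
  rewrite /dg cabsM cabs_real ger0_norm ?exprn_ge0 //.
  have -> : dphi t = t ^+ k * (e0 + e1 * t) by rewrite /dphi exprS; ring.
  by apply: ler_wpM2l; [exact: exprn_ge0|exact: Hb].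
Qed.

(** Away from [z0] this is a computation with the quotient rule. At [z0] the preceding bound
    applies, with an error of the form [e * cabs h * s] in the affine model. *)
Lemma cfamily_quotient K F z0 : convex_region K -> open_region K -> cfamily K F -> K z0 -> F 0%N z0 = 0 ->
  cfamily K (quotient_family F z0).
Proof.
move=> Kc Ko HF Kz0 F0 k z Kz.
have [->|zz0] := eqVneq z z0.
  apply/is_derive_cabsP => e e0.
  have [d1 d10 Hd1] := Ko z0 Kz0.
  have [d2 d20 Hd2] := (is_derive_cabsP _ _ _).1 (HF k.+1 z0 Kz0) e e0.
  exists (Num.min d1 d2); first by rewrite lt_min d10.
  move=> h; rewrite lt_min => /andP[h1 h2].
  have [->|h0] := eqVneq h 0; first by rewrite addr0 subrr mulr0 subrr cabs0 mulr0.
  have sh (s : R) : 0 <= s <= 1 -> cabs (ofR s * h) <= cabs h.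
    move=> /andP[s0 s1]; rewrite cabsM cabs_real ger0_norm //.
    by rewrite -[leRHS]mul1r ler_wpM2r // cabs_ge0.
  have := @quotient_family_bound K F z0 h k (F k.+1 z0) (F k.+2 z0 * h) 0 (e * cabs h) HF _ F0 h0 _.
  have E0 r : quotient_family F z0 r z0 = F r.+1 z0 / r.+1%:R by rewrite /quotient_family eqxx.
  rewrite mul0r add0r !E0.
  have -> : F k.+2 z0 / k.+2%:R * h = F k.+2 z0 * h / k.+2%:R by rewrite mulrAC.
  move=> H; apply: le_trans (H _ _) _.
  - by move=> s s01; apply: Hd1; apply: le_lt_trans h1; exact: sh.
  - move=> s s01; have := Hd2 _ (le_lt_trans (sh s s01) h2).
    have -> : F k.+2 z0 * (ofR s * h) = ofR s * (F k.+2 z0 * h) by ring.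
    move=> H1; apply: le_trans H1 _; rewrite add0r -mulrA; apply: ler_wpM2l; first exact: ltW.
    rewrite cabsM cabs_real ger0_norm ?[cabs h * s]mulrC //; by case/andP: s01.
  - rewrite ler_pdivrMr ?ltr0n // ler_peMr ?ler1n //.
    by rewrite mulr_ge0 ?cabs_ge0 // ltW.
have D0 : is_derive z 1 (fun y => (y - z0) ^+ k.+1) (k.+1%:R * (z - z0) ^+ k).
  have D := @is_derive_exprn _ _ _ _ k.+1 (is_derive_sub (is_derive_id z (1 : C)) (is_derive_cst z0 z (1 : C))).
  by apply: (is_derive_eq D); rewrite /= /cst subr0 mulr1.
have zz : z - z0 != 0 by rewrite subr_eq0.
have D1 := @is_derive_chain C (fun y => y^-1) (fun y => (y - z0) ^+ k.+1) z _ _ (is_derive_inv (expf_neq0 k.+1 zz)) D0.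
have D2 := is_derive_mul (is_derive_mul (is_derive_cst ((-1) ^+ k * k`!%:R : C) z (1 : C))
   (taylor_eval_derive z0 k HF Kz)) D1.
have d0 : 0 < ofR (cabs (z - z0)) by rewrite -ofR0 lt_ofR cabs_gt0.
apply: (is_derive_near d0 _ (is_derive_eq D2 _)).
  move=> h; rewrite cabsE lt_ofR => hz; rewrite /quotient_family ifN //.
  apply/eqP => E; move: hz; rewrite -E opprD addrA subrr sub0r cabsN ltxx //.
rewrite /quotient_family (negPf zz0) /= /cst factS natrM -[z0 - z]opprB -[- (z - z0)]mulN1r !exprMn.
set u := z - z0 in zz *.
have S1 : (-1) ^+ k * (-1) ^+ k = 1 :> C by rewrite -exprMn mulrNN mulr1 expr1n.
rewrite !exprS mul0r addr0.
set f := k`!%:R; set e := (-1) ^+ k in S1 *; set T := taylor_eval _ _ _ _.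
transitivity (- (e * f * (1 + k%:R) * T) / (u * (u * u ^+ k)) + (e * e) * F k.+1 z / u).
  by field; rewrite expf_neq0 // zz factC_neq0.
transitivity (- (e * f * (1 + k%:R) * T) / (u * (u * u ^+ k)) + (e * e) * (F k.+1 z * (k.+1%:R * f) / (k.+1%:R * f)) / u).
  by congr (_ + _ * _ / _); rewrite mulfK // mulf_neq0 ?natC_neq0 // factC_neq0.
rewrite -natr1.
by field; rewrite expf_neq0 // zz factC_neq0 natr1 natC_neq0.
Qed.

(* Dividing the family by [z - z0] at a zero [z0] replaces [mu] by [mu - 1]: the top derivative
   of the quotient is an average of [F mu], hence still close to a nonzero constant. *)
Lemma few_zeros mu K F (a : C) (e : R) : convex_region K -> open_region K -> cfamily K F ->
  e < cabs a -> (forall z, K z -> cabs (F mu z - a) <= e) ->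
  forall zs : seq C, uniq zs -> (forall z, z \in zs -> K z /\ F 0%N z = 0) -> (size zs <= mu)%N.
Proof.
move=> Kc Ko; elim: mu F a e => [|mu IH] F a e HF ea Hb zs.
  case: zs => [//|z zs] _ H; have [Kz z0] := H z (mem_head _ _).
  by have := Hb z Kz; rewrite z0 sub0r cabsN leNgt ea.
case: zs => [//|z0 zs] /= /andP[z0zs uzs] H.
have [Kz0 F0] := H z0 (mem_head _ _).
have m0 : 0 < mu.+1%:R :> R by rewrite ltr0n.
apply: (IH (quotient_family F z0) (a / mu.+1%:R) (e / mu.+1%:R)) => //.
- exact: cfamily_quotient.
- by rewrite cabsM cabsV cabs_nat ltr_pM2r // invr_gt0.
- have S w : K (z0 + w) -> w != 0 ->
      cabs (quotient_family F z0 mu (z0 + w) - a / mu.+1%:R) <= e / mu.+1%:R.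
    move=> Kw w0; have := @quotient_family_bound K F z0 w mu a 0 e 0 HF _ F0 w0 _.
    rewrite !mul0r subr0 addr0; apply.
      move=> s s01; have := Kc z0 (z0 + w) s Kz0 Kw s01.
      by rewrite [z0 + w - z0]addrAC subrr add0r.
    move=> s s01; rewrite mulr0 subr0 mul0r addr0; apply: Hb.
    by have := Kc z0 (z0 + w) s Kz0 Kw s01; rewrite [z0 + w - z0]addrAC subrr add0r.
  move=> z Kz; have [->|zz0] := eqVneq z z0.
    rewrite /quotient_family eqxx -mulrBl cabsM cabsV cabs_nat.
    by apply: ler_wpM2r; [rewrite invr_ge0 ltW|exact: Hb].
  have -> : z = z0 + (z - z0) by rewrite addrC subrK.
  by apply: S; [rewrite addrC subrK|rewrite subr_eq0].
- move=> z zzs; have [Kz Fz] : K z /\ F 0%N z = 0 by apply: H; rewrite in_cons zzs orbT.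
  split=> //; rewrite /quotient_family; case: eqVneq => [E|_].
    by move: z0zs; rewrite -E zzs.
  by rewrite /= Fz mulr0 mul0r.
Qed.

End ComplexFamilies.

(** * Zeros in a half strip *)

Section Strip.
Variable R : realType.
Local Notation C := (cplx R).
Local Notation Re := (@complex.Re R).
Local Notation Im := (@complex.Im R).
Implicit Types (F G : nat -> C -> C) (z w : C) (J : nat).

Definition half_strip (A M : R) : set C := [set z | Re z < - M /\ `|Im z| < A].

Lemma open_half_strip A M : open_region (half_strip A M).
Proof.
move=> z [z1 z2]; exists (Num.min (- M - Re z) (A - `|Im z|)).
  by rewrite lt_min !subr_gt0 z1.
move=> h; rewrite lt_min => /andP[h1 h2]; split.
  by rewrite cReD; have := le_lt_trans (ler_norm _) (le_lt_trans (Re_le_cabs h) h1); lra.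
rewrite cImD; apply: le_lt_trans (ler_normD _ _) _.
by have := le_lt_trans (Im_le_cabs h) h2; lra.
Qed.

Lemma convex_half_strip A M : convex_region (half_strip A M).
Proof.
move=> z w t [z1 z2] [w1 w2] /andP[t0 t1]; split.
  rewrite cReD Re_real_mul cReB.
  have : (1 - t) * (- M - Re z) >= 0 by apply: mulr_ge0; lra.
  have : t * (- M - Re w) >= 0 by apply: mulr_ge0; lra.
  have [->|tn0] := eqVneq t 0; first lra.
  have : t * (- M - Re w) > 0 by apply: mulr_gt0; [rewrite lt_def tn0|lra].
  lra.
rewrite cImD Im_real_mul cImB.
move: z2 w2; rewrite !ltr_norml => /andP[z2 z3] /andP[w2 w3].
have [->|tn0] := eqVneq t 0; first by apply/andP; split; lra.
have tp : 0 < t by rewrite lt_def tn0.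
have : t * (A - Im w) > 0 by apply: mulr_gt0; lra.
have : t * (Im w + A) > 0 by apply: mulr_gt0; lra.
have : (1 - t) * (A - Im z) >= 0 by apply: mulr_ge0; lra.
have : (1 - t) * (Im z + A) >= 0 by apply: mulr_ge0; lra.
by move=> *; apply/andP; split; lra.
Qed.

Lemma open_convex_ball (K : set C) z0 (r : R) : convex_region K -> open_region K ->
  convex_region (K `&` [set z | cabs (z - z0) < r]) /\
  open_region (K `&` [set z | cabs (z - z0) < r]).
Proof.
move=> Kc Ko; split.
  move=> z w t [Kz zr] [Kw wr] t01; split; first exact: Kc.
  have /andP[t0 t1] := t01.
  rewrite /=; have -> : z + ofR t * (w - z) - z0 = ofR (1 - t) * (z - z0) + ofR t * (w - z0).
    by rewrite ofRB ofR1; ring.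
  apply: le_lt_trans (cabsD _ _) _; rewrite !cabsM !cabs_real !ger0_norm ?subr_ge0 //.
  rewrite /= in zr wr.
  have [->|tn0] := eqVneq t 0; first lra.
  have : t * (r - cabs (w - z0)) > 0 by apply: mulr_gt0; [rewrite lt_def tn0|lra].
  have : (1 - t) * (r - cabs (z - z0)) >= 0 by apply: mulr_ge0; lra.
  lra.
move=> z [Kz zr]; have [d d0 Hd] := Ko z Kz; rewrite /= in zr.
exists (Num.min d (r - cabs (z - z0))); first by rewrite lt_min d0 subr_gt0.
move=> h; rewrite lt_min => /andP[h1 h2]; split; first exact: Hd.
by rewrite /= addrAC; apply: le_lt_trans (cabsD _ _) _; lra.
Qed.

(** * Jets and their growth *)

Definition jet2 J F z : R := \sum_(k < J) cabs (F k z) ^+ 2.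
(** The Euclidean norm is used because its square is differentiable along segments. *)
Definition jet J F z : R := Num.sqrt (jet2 J F z).

Lemma jet2_ge0 J F z : 0 <= jet2 J F z.
Proof. by apply: sumr_ge0 => k _; exact: sqr_ge0. Qed.

Lemma jet_ge0 J F z : 0 <= jet J F z. Proof. exact: sqrtr_ge0. Qed.

Lemma jet_sqr J F z : jet J F z ^+ 2 = jet2 J F z.
Proof. by rewrite sqr_sqrtr // jet2_ge0. Qed.

Lemma cabs_le_jet J F z k : (k < J)%N -> cabs (F k z) <= jet J F z.
Proof.
move=> kJ; rewrite -ler_sqr ?nnegrE ?cabs_ge0 ?jet_ge0 // jet_sqr.
rewrite /jet2 (bigD1 (Ordinal kJ)) //= lerDl.
by apply: sumr_ge0 => i _; exact: sqr_ge0.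
Qed.

Lemma is_derive_bigsum J (f df : nat -> R -> R) (t : R) :
  (forall k, (k < J)%N -> is_derive t 1 (f k) (df k t)) ->
  is_derive t 1 (fun s => \sum_(k < J) f k s) (\sum_(k < J) df k t).
Proof.
elim: J => [|J IH] H.
  rewrite big_ord0; under eq_fun do rewrite big_ord0; exact: is_derive_cst.
rewrite big_ord_recr; under eq_fun do rewrite big_ord_recr.
by apply: is_derive_add; [apply: IH => k kJ; apply: H; exact: ltnW|exact: H].
Qed.

(** Gronwall's inequality for [jet2] along the segment: [2 |a b| <= |a|^2 + |b|^2] bounds its
    derivative by [(2 + K0^2) * cabs (w - z)] times itself, and the square root halves the
    exponent. *)
Lemma jet_growth K J F (K0 : R) z w : convex_region K -> cfamily K F -> 0 <= K0 ->
  (forall y, K y -> cabs (F J y) <= K0 * jet J F y) -> K z -> K w ->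
  jet J F w <= jet J F z * expR ((1 + K0 ^+ 2 / 2) * cabs (z - w)).
Proof.
move=> Kc HF K00 HJ Kz Kw.
pose c := (2 + K0 ^+ 2) * cabs (w - z).
pose l (s : R) := z + ofR s * (w - z).
pose f k (s : R) := Re (F k (l s)) * Re (F k (l s)) + Im (F k (l s)) * Im (F k (l s)).
pose df k (s : R) := 2 * (Re (F k (l s)) * Re (F k.+1 (l s) * (w - z)) + Im (F k (l s)) * Im (F k.+1 (l s) * (w - z))).
have Kl (s : R) : 0 <= s <= 1 -> K (l s) by exact: Kc.
have fE s : jet2 J F (l s) = \sum_(k < J) f k s.
  by apply: eq_bigr => k _; rewrite cabs_sqr /f !expr2.
have fd k (s : R) : 0 <= s <= 1 -> is_derive s 1 (f k) (df k s).
  move=> s01; have [D1 D2] := is_derive_line (HF k (l s) (Kl s s01)).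
  have := is_derive_add (is_derive_mul D1 D1) (is_derive_mul D2 D2).
  by move=> D; apply: (is_derive_eq D); rewrite /df; ring.
have dfb (s : R) : 0 <= s <= 1 -> `|\sum_(k < J) df k s| <= c * jet2 J F (l s).
  move=> s01.
  have P (a b x y : C) : `|2 * (Re a * Re (b * x) + Im a * Im (b * x))| <=
       cabs x * (cabs a ^+ 2 + cabs b ^+ 2).
    pose a' : C := Complex (Re a) (- Im a).
    have -> : Re a * Re (b * x) + Im a * Im (b * x) = Re (a' * (b * x)).
      by rewrite (cReM a') /= mulNr opprK.
    have E : cabs a' = cabs a by rewrite /cabs /= sqrrN.
    have H := Re_le_cabs (a' * (b * x)).
    rewrite cabsM E cabsM in H.
    rewrite normrM ger0_norm //.
    have : 0 <= cabs x * (cabs a - cabs b) ^+ 2 by rewrite mulr_ge0 ?cabs_ge0 ?sqr_ge0.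
    rewrite sqrrB; lra.
  have -> : c * jet2 J F (l s) = \sum_(k < J) (c * cabs (F k (l s)) ^+ 2) by rewrite mulr_sumr.
  apply: le_trans (ler_norm_sum _ _ _) _.
  apply: le_trans (ler_sum _ (fun (k : 'I_J) _ => P (F k (l s)) (F k.+1 (l s)) (w - z) 0)) _.
  rewrite -!mulr_sumr big_split /= /c -mulrA [cabs _ * _]mulrC mulrCA mulrC.
  have : \sum_(i < J) cabs (F i.+1 (l s)) ^+ 2 <= (1 + K0 ^+ 2) * jet2 J F (l s).
    have -> : \sum_(i < J) cabs (F i.+1 (l s)) ^+ 2 =
        jet2 J F (l s) + cabs (F J (l s)) ^+ 2 - cabs (F 0%N (l s)) ^+ 2.
      rewrite /jet2 -(@big_ord_recr _ _ _ J (fun i => cabs (F i (l s)) ^+ 2)) big_ord_recl /=.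
      by rewrite addrAC subrr add0r.
    have := sqr_ge0 (cabs (F 0%N (l s))).
    have : cabs (F J (l s)) ^+ 2 <= (K0 * jet J F (l s)) ^+ 2.
      by rewrite ler_sqr ?nnegrE ?cabs_ge0 ?mulr_ge0 ?jet_ge0 //; exact: HJ (Kl s s01).
    rewrite exprMn jet_sqr.
    lra.
  rewrite -/(jet2 J F (l s)) => H.
  have := ler_wpM2l (cabs_ge0 (w - z)) H.
  rewrite -/(jet2 J F (l s)); lra.
have l0 : l 0 = z by rewrite /l ofR0 mul0r addr0.
have l1 : l 1 = w by rewrite /l ofR1 mul1r addrC subrK.
have E2 : jet2 J F w <= jet2 J F z * expR c.
  have := @derive_ge0_le R (fun s => - (expR (- c * s) * \sum_(k < J) f k s))
     (fun s => - (expR (- c * s) * (\sum_(k < J) df k s - c * \sum_(k < J) f k s))) 0 1 ler01.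
  rewrite mulr0 expR0 mul1r mulr1 lerN2 -!fE l0 l1 => H.
  have {}H : expR (- c) * jet2 J F w <= jet2 J F z.
    apply: H => s s01.
      have D := is_derive_mul (is_derive_expR_scale (- c) s) (is_derive_bigsum (fun k _ => fd k s s01)).
      have := is_derive_sub (is_derive_cst 0 s 1) (D J).
      under eq_fun do rewrite /cst sub0r.
      by move=> D'; apply: (is_derive_eq D'); ring.
    rewrite oppr_ge0; rewrite pmulr_rle0 ?expR_gt0 // -fE subr_le0.
    exact: le_trans (ler_norm _) (dfb s s01).
  have := ler_wpM2r (expR_ge0 c) H.
  by rewrite mulrAC -expRD addNr expR0 mul1r.
rewrite -ler_sqr ?nnegrE ?mulr_ge0 ?jet_ge0 ?expR_ge0 //.
rewrite exprMn !jet_sqr -expRM_natl.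
have -> : 2%:R * ((1 + K0 ^+ 2 / 2) * cabs (z - w)) = c.
  by rewrite /c cabs_distC; field.
exact: E2.
Qed.

Lemma family_lipschitz K F k z w (B : R) : convex_region K -> cfamily K F -> K z -> K w ->
  (forall s : R, 0 <= s <= 1 -> cabs (F k.+1 (z + ofR s * (w - z))) <= B) ->
  cabs (F k w - F k z) <= B * cabs (w - z).
Proof.
move=> Kc HF Kz Kw HB.
pose l (s : R) := z + ofR s * (w - z).
have := @mean_value_cabs R (fun s => F k (l s)) (fun s => F k.+1 (l s) * (w - z))
  (fun s => B * cabs (w - z) * s) (fun=> B * cabs (w - z)) 0 1 ler01.
have -> : l 0 = z by rewrite /l ofR0 mul0r addr0.
have -> : l 1 = w by rewrite /l ofR1 mul1r addrC subrK.
rewrite mulr1 mulr0 subr0; apply.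
- by move=> s s01; exact: is_derive_line (HF k _ (Kc z w s Kz Kw s01)).
- move=> s _; have := is_derive_mul (is_derive_cst (B * cabs (w - z)) s 1) (is_derive_id s (1 : R)).
  by move=> D; apply: (is_derive_eq D); rewrite /cst mul0r addr0 mulr1.
- by move=> s s01; rewrite cabsM; apply: ler_wpM2r; [exact: cabs_ge0|exact: HB].
Qed.

(** Real roots are what lets the operator act separately on real and imaginary parts. *)
Lemma Re_shift_ops (ls : seq R) F k z :
  Re (shift_ops (map (@ofR R) ls) F k z) = shift_ops ls (fun k y => Re (F k y)) k z.
Proof.
elim: ls k z => [//|l ls IH] k z; rewrite /= -!/(shift_ops _ _) /shift_op cReB Re_real_mul.
by rewrite !IH.
Qed.

Lemma Im_shift_ops (ls : seq R) F k z :
  Im (shift_ops (map (@ofR R) ls) F k z) = shift_ops ls (fun k y => Im (F k y)) k z.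
Proof.
elim: ls k z => [//|l ls IH] k z; rewrite /= -!/(shift_ops _ _) /shift_op cImB Im_real_mul.
by rewrite !IH.
Qed.

Lemma shift_ops_comp (K : pzRingType) (S T : Type) (ls : seq K) (G : nat -> T -> K) (p : S -> T) k s :
  shift_ops ls (fun k s => G k (p s)) k s = shift_ops ls G k (p s).
Proof. by elim: ls k s => [//|l ls IH] k s; rewrite /= -!/(shift_ops _ _) /shift_op !IH. Qed.

Lemma size_le_cells (T : eqType) (U : Type) (c : U -> pred T) (cells : seq U) (zs : seq T) (J : nat) :
  (forall x, x \in zs -> has (fun u => c u x) cells) ->
  (forall u, (size [seq x <- zs | c u x] <= J)%N) -> (size zs <= size cells * J)%N.
Proof.
elim: cells zs => [|u cells IH] zs H HJ.
  by case: zs H {HJ} => [//|x zs] /(_ x (mem_head _ _)).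
rewrite -(count_predC (c u)) -!size_filter mulSn; apply: leq_add; first exact: HJ.
apply: IH => [x|v].
  by rewrite mem_filter => /andP[/= nz xzs]; have := H x xzs; rewrite /= (negPf nz).
by apply: leq_trans (HJ v); rewrite -filter_predI !size_filter; apply: sub_count => x /= /andP[].
Qed.

(** The net lies inside the open interval, so that horizontal lines at these heights stay in the
    strip. It takes one point per cell of length [e] that meets the interval. *)
Lemma finite_net (A e : R) : 0 < e -> exists2 H : seq R, (forall y, y \in H -> `|y| < A) &
  forall y, `|y| < A -> exists2 y', y' \in H & `|y - y'| <= e.
Proof.
move=> e0.
have P n : exists2 H : seq R, (forall y, y \in H -> `|y| < A) &
  forall y, `|y| < A -> y < - A + e * n%:R -> exists2 y', y' \in H & `|y - y'| <= e.
  elim: n => [|n [H H1 H2]].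
    by exists [::] => // y; rewrite mulr0 addr0 ltr_norml => /andP[? ?] ?; lra.
  have [[y0 [y0A y0n y0n']]|no] := pselect (exists y0, [/\ `|y0| < A, - A + e * n%:R <= y0 & y0 < - A + e * n.+1%:R]).
    exists (y0 :: H); first by move=> y; rewrite in_cons => /orP[/eqP -> //|]; exact: H1.
    move=> y yA yn; have [lt|ge] := ltP y (- A + e * n%:R).
      by have [y' y'H yy'] := H2 y yA lt; exists y' => //; rewrite in_cons y'H orbT.
    exists y0; first exact: mem_head.
    by rewrite ler_norml; move: y0n' yn; rewrite -natr1 => *; apply/andP; split; lra.
  exists H => // y yA yn; apply: H2 => //; rewrite ltNge; apply/negP => ge.
  by apply: no; exists y.
have [n Hn] : exists n : nat, 2 * A <= e * n%:R.
  exists (Num.trunc (2 * `|A| / e)).+1.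
  have := truncnS_gt (2 * `|A| / e); rewrite ltr_pdivrMr // [X in _ < X]mulrC => /ltW H.
  by have := ler_norm A; lra.
have [H H1 H2] := P n; exists H => // y yA; apply: H2 => //.
by move: yA; rewrite ltr_norml => /andP[]; lra.
Qed.

End Strip.

Section StripZeros.
Variable R : realType.
Local Notation C := (cplx R).
Local Notation Re := (@complex.Re R).
Local Notation Im := (@complex.Im R).
Implicit Types (F G : nat -> C -> C) (z w : C) (J : nat).

Definition jet_bounded (K : set C) J (K0 : R) F :=
  cfamily K F /\ forall y, K y -> cabs (F J y) <= K0 * jet J F y.

Lemma cabs_le_jetS K J K0 F z i : 0 <= K0 -> jet_bounded K J K0 F -> K z -> (i <= J)%N ->
  cabs (F i z) <= (1 + K0) * jet J F z.
Proof.
move=> K00 [_ HJ] Kz; rewrite leq_eqVlt => /orP[/eqP ->|iJ].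
  by apply: le_trans (HJ z Kz) _; apply: ler_wpM2r; [exact: jet_ge0|lra].
apply: le_trans (cabs_le_jet F z iJ) _; rewrite -[leLHS]mul1r.
by apply: ler_wpM2r; [exact: jet_ge0|lra].
Qed.

Definition growth_rate (K0 : R) : R := 1 + K0 ^+ 2 / 2.

Lemma growth_rate_ge0 K0 : 0 <= growth_rate K0.
Proof. by rewrite addr_ge0 // divr_ge0 ?sqr_ge0. Qed.

(** Otherwise [J] squares, each at most [(jet / (J + 1))^2], would sum up to [jet^2]. *)
Lemma jet_dominant J F z : 0 < jet J F z ->
  exists2 k, (k < J)%N & (J.+1%:R)^-1 * jet J F z < cabs (F k z).
Proof.
move=> j0; apply: contrapT => H.
have Hk k : (k < J)%N -> cabs (F k z) <= (J.+1%:R)^-1 * jet J F z.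
  by move=> kJ; rewrite leNgt; apply/negP => lt; apply: H; exists k.
have n0 : 0 < J.+1%:R :> R by rewrite ltr0n.
have : jet2 J F z <= J%:R * ((J.+1%:R)^-1 * jet J F z) ^+ 2.
  have -> : J%:R * ((J.+1%:R)^-1 * jet J F z) ^+ 2 = \sum_(k < J) ((J.+1%:R)^-1 * jet J F z) ^+ 2.
    by rewrite sumr_const card_ord mulr_natl.
  apply: ler_sum => k _; rewrite ler_sqr ?nnegrE ?cabs_ge0 ?Hk //.
  by rewrite mulr_ge0 ?jet_ge0 // invr_ge0 ltW.
rewrite -jet_sqr exprMn mulrA -[leLHS]mul1r ler_pM2r ?exprn_gt0 //.
rewrite exprVn ler_pdivlMr ?exprn_gt0 // mul1r -!natrX ler_nat.
by rewrite leqNgt => /negP; apply; rewrite expnS expn1 leq_pmulr.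
Qed.

Lemma jet_lipschitz K J K0 F z w i (r : R) : convex_region K -> 0 <= K0 -> jet_bounded K J K0 F ->
  K z -> K w -> (i < J)%N -> cabs (w - z) <= r -> r <= 1 ->
  cabs (F i w - F i z) <= r * ((1 + K0) * expR (growth_rate K0)) * jet J F z.
Proof.
move=> Kc K00 HF Kz Kw iJ wr r1; have [HF1 HJ] := HF.
have w0 := cabs_ge0 (w - z).
have E0 := expR_ge0 (growth_rate K0).
have := @family_lipschitz R K F i z w ((1 + K0) * expR (growth_rate K0) * jet J F z) Kc HF1 Kz Kw.
move=> H; apply: le_trans (H _) _.
  move=> s s01; have Ks := Kc z w s Kz Kw s01.
  apply: le_trans (cabs_le_jetS K00 HF Ks iJ) _.
  rewrite -mulrA; apply: ler_wpM2l; first lra.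
  apply: le_trans (jet_growth Kc HF1 K00 HJ Kz Ks) _.
  rewrite mulrC; apply: ler_wpM2r; first exact: jet_ge0.
  rewrite ler_expR -[leRHS]mulr1; apply: ler_wpM2l; first exact: growth_rate_ge0.
  have -> : z - (z + ofR s * (w - z)) = - (ofR s * (w - z)) by ring.
  rewrite cabsN cabsM cabs_real; have /andP[s0 s1] := s01; rewrite ger0_norm //.
  have := ler_wpM2r w0 s1; lra.
rewrite -[leRHS]mulrA [leRHS]mulrC; apply: ler_wpM2l => //.
by rewrite !mulr_ge0 ?jet_ge0 //; lra.
Qed.

(** On the disc of radius [rho] the derivative dominant at [z0] moves by less than its size at [z0],
    so [few_zeros] applies with the order of that derivative. *)
Lemma near_zeros K J K0 F (rho : R) z0 (zs : seq C) : convex_region K -> open_region K -> 0 <= K0 ->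
  jet_bounded K J K0 F -> 0 < jet J F z0 -> rho <= 1 ->
  rho * ((1 + K0) * expR (growth_rate K0)) <= (J.+1%:R)^-1 -> K z0 ->
  uniq zs -> (forall z, z \in zs -> [/\ K z, cabs (z - z0) < rho & F 0%N z = 0]) ->
  (size zs <= J)%N.
Proof.
move=> Kc Ko K00 HF j0 rho1 Hrho Kz0 uzs Hzs; have [HF1 HJ] := HF.
have [mu muJ Hmu] := jet_dominant j0.
have [Bc Bo] := open_convex_ball z0 rho Kc Ko.
apply: leq_trans (ltnW muJ).
have HFB : cfamily (K `&` [set z | cabs (z - z0) < rho]) F by move=> k z [Kz _]; exact: HF1.
apply: (few_zeros Bc Bo HFB Hmu _ uzs); last first.
  by move=> z /Hzs[].
move=> z [Kz zr]; apply: le_trans (jet_lipschitz Kc K00 HF Kz0 Kz muJ (ltW zr) rho1) _.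
by apply: ler_wpM2r => //; exact: jet_ge0.
Qed.

(** Zeros are located in cells of half-sizes [L] and [eps] centred on finitely many horizontal
    lines, and [near_zeros] counts them in each cell. The number [K0 ^+ 2 + 5] is [2 * Kg + 3] for
    the growth rate [Kg = 1 + K0^2 / 2] of the jet. *)
Theorem half_strip_zeros (A K0 C0 beta : R) J (ls : seq R) : 0 <= K0 -> 0 <= C0 ->
  K0 ^+ 2 + 5 <= beta ->
  exists (M0 : R) (B : nat), forall (M : R) F, M0 <= M -> jet_bounded (half_strip A M) J K0 F ->
   (forall i z, (i <= J)%N -> half_strip A M z ->
      cabs (shift_ops (map (@ofR R) ls) F i z) <= C0 * expR (beta * Re z) * jet J F z) ->
   (forall z, half_strip A M z -> F 0%N z = 0) \/
   (forall zs : seq C, uniq zs -> (forall z, z \in zs -> half_strip A M z /\ F 0%N z = 0) ->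
      (size zs <= B)%N).
Proof.
move=> K00 C00 Hbeta.
pose Kg := growth_rate K0; have Kg0 : 0 <= Kg by exact: growth_rate_ge0.
pose D := (1 + K0) * expR Kg.
have D1 : 1 <= D.
  have := expR_ge1Dx Kg => H; apply: (@le_trans _ _ (1 * 1)); first by rewrite mulr1.
  by apply: ler_pM => //; lra.
pose e : R := (J.+1%:R)^-1.
have e0 : 0 < e by rewrite invr_gt0 ltr0n.
pose rho := Num.min 1 (e / D).
have Dp : 0 < D by lra.
have rho0 : 0 < rho by rewrite lt_min ltr01 divr_gt0.
have rho1 : rho <= 1 by rewrite /rho ge_min lexx.
have rhoD : rho * D <= e by rewrite -ler_pdivlMr // /rho ge_min lexx orbT.
(* Two points of a cell are at distance at most [2 * L + 2 * eps <= 4 * L < rho]. *)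
pose L := rho / 8.
have L0 : 0 < L by rewrite /L; lra.
have La0 : 0 <= 1 + K0 by lra.
have e20 : 0 < e / 2 by lra.
have Hb : 2 * Kg + 3 <= beta by rewrite /Kg /growth_rate; lra.
have [k [M0 [m [k0 M00 HW]]]] := real_window ls J Kg0 C00 La0 e20 L0 Hb.
(* Going vertically by [eps], from a zero of [F 0] to a line of the net, leaves [F 0] at most
   [eps * D <= k] times the jet. *)
pose eps := Num.min L (k / D).
have eps0 : 0 < eps by rewrite lt_min L0 divr_gt0.
have epsL : eps <= L by rewrite /eps ge_min lexx.
have epsD : eps * D <= k by rewrite -ler_pdivlMr // /eps ge_min lexx orbT.
have [H H1 H2] := finite_net A eps0.
exists M0, (size H * (2 * m).+1 * J)%N => M F MM0 HF Hh.
set S := half_strip A M in HF Hh *.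
have [HF1 HJ] := HF.
have Sc : convex_region S by exact: convex_half_strip.
have So : open_region S by exact: open_half_strip.
(* If the jet vanishes at one point it vanishes everywhere, by [jet_growth]. *)
have [[z0 [Sz0 j0]]|jpos] := pselect (exists z0, S z0 /\ jet J F z0 <= 0).
  left=> z Sz; apply/eqP; rewrite -cabs_eq0 eq_le cabs_ge0 andbT.
  apply: le_trans (cabs_le_jetS K00 HF Sz (leq0n J)) _.
  have J0 : jet J F z0 = 0 by apply/eqP; rewrite eq_le j0 jet_ge0.
  have := jet_growth Sc HF1 K00 HJ Sz0 Sz; rewrite J0 mul0r => /(ler_wpM2l La0).
  by rewrite mulr0.
have {}jpos z : S z -> 0 < jet J F z.
  by move=> Sz; rewrite ltNge; apply/negP => j0; apply: jpos; exists z.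
right=> zs uzs Hzs.
pose b := - M - L.
(* [a] depends on the given zeros, which is harmless: the number of breakpoints does not depend on
   [a]. *)
have [a [ab Ha]] : exists a, a <= b /\ forall z, z \in zs -> a + L <= Re z.
  elim: zs {uzs Hzs} => [|z zs [a [ab Ha]]]; first by exists b.
  exists (Num.min a (Re z - L)); split; first by rewrite ge_min ab.
  move=> y; rewrite in_cons => /orP[/eqP ->|yzs].
    have : Num.min a (Re z - L) <= Re z - L by rewrite ge_min lexx orbT.
    lra.
  have := Ha y yzs; have : Num.min a (Re z - L) <= a by rewrite ge_min lexx.
  lra.
pose near_cell (u : R * R) z := (`|Re z - u.1| <= L) && (`|Im z - u.2| <= eps).
have line eta : `|eta| < A -> exists2 T : seq R, (size T <= (2 * m).+1)%N &
    forall z, z \in zs -> `|Im z - eta| <= eps -> has (fun t => near_cell (t, eta) z) T.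
  move=> etaA; pose l (s : R) : C := (Complex 0 eta : C) + ofR s * 1.
  have lRe s : Re (l s) = s by rewrite cReD Re_real_mul /= add0r mulr1.
  have lIm s : Im (l s) = eta by rewrite cImD Im_real_mul /= mulr0 addr0.
  have Sl s : s <= b -> S (l s) by move=> sb; split; rewrite ?lRe ?lIm //= /b in sb *; lra.
  have lsub s t : cabs (l s - l t) = `|s - t|.
    have -> : l s - l t = ofR (s - t) by rewrite /l ofRB; ring.
    exact: cabs_real.
  pose nu s := jet J F (l s).
  have nu0 s : a <= s <= b -> 0 <= nu s by move=> _; exact: jet_ge0.
  have nuK s t : a <= s <= b -> a <= t <= b -> nu t <= nu s * expR (Kg * `|s - t|).
    move=> /andP[_ sb] /andP[_ tb]; rewrite -lsub.
    exact: jet_growth Sc HF1 K00 HJ (Sl s sb) (Sl t tb).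
  have bM : b <= - M0 by rewrite /b; lra.
  have fam : family_on a b (fun i s => Re (F i (l s))) /\ family_on a b (fun i s => Im (F i (l s))).
    suff P i s : a <= s <= b -> is_derive s 1 (fun s => Re (F i (l s))) (Re (F i.+1 (l s))) /\
        is_derive s 1 (fun s => Im (F i (l s))) (Im (F i.+1 (l s))).
      by split=> i s sab; have [] := P i s sab.
    move=> /andP[_ sb]; have := is_derive_line (HF1 i (l s) (Sl s sb)).
    by rewrite mulr1.
  have bnd (p : C -> R) i s : (forall z, `|p z| <= cabs z) -> (i <= J)%N -> a <= s <= b ->
      `|p (F i (l s))| <= (1 + K0) * nu s.
    move=> Hp iJ /andP[_ sb]; apply: le_trans (Hp _) _.
    exact: cabs_le_jetS K00 HF (Sl s sb) iJ.
  have bndR i s : (i <= J)%N -> a <= s <= b -> `|Re (F i (l s))| <= (1 + K0) * nu s.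
    exact: bnd (@Re_le_cabs R).
  have bndI i s : (i <= J)%N -> a <= s <= b -> `|Im (F i (l s))| <= (1 + K0) * nu s.
    exact: bnd (@Im_le_cabs R).
  have hR i s : (i <= J)%N -> a <= s <= b ->
      `|shift_ops ls (fun i s => Re (F i (l s))) i s| <= C0 * expR (beta * s) * nu s.
    move=> iJ /andP[_ sb]; have := Hh i (l s) iJ (Sl s sb); rewrite lRe.
    rewrite (@shift_ops_comp _ _ _ ls (fun k y => Re (F k y)) l) -Re_shift_ops.
    by move=> H0; apply: le_trans (Re_le_cabs _) H0.
  have hI i s : (i <= J)%N -> a <= s <= b ->
      `|shift_ops ls (fun i s => Im (F i (l s))) i s| <= C0 * expR (beta * s) * nu s.
    move=> iJ /andP[_ sb]; have := Hh i (l s) iJ (Sl s sb); rewrite lRe.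
    rewrite (@shift_ops_comp _ _ _ ls (fun k y => Im (F k y)) l) -Im_shift_ops.
    by move=> H0; apply: le_trans (Im_le_cabs _) H0.
  have [T1 T1m HT1] := HW a b nu _ ab bM nu0 nuK fam.1 bndR hR.
  have [T2 T2m HT2] := HW a b nu _ ab bM nu0 nuK fam.2 bndI hI.
  (* [b] takes care of the zeros within [L] of [b = - M - L], which the estimate on [[a + L, b - L]]
     does not reach. *)
  exists (b :: T1 ++ T2).
    by rewrite /= ltnS size_cat mul2n -addnn leq_add.
  move=> z zzs zeta; apply: contrapT => /negP /hasPn Hno.
  have [[zM zA] Fz] := Hzs z zzs.
  have far t : t \in b :: T1 ++ T2 -> L < `|t - Re z|.
    move=> tT; have := Hno t tT; rewrite /near_cell /= zeta andbT -ltNge distrC //.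
  have zbL : a + L <= Re z <= b - L.
    rewrite Ha //=; have := far b (mem_head _ _); rewrite /b ltr_normr => /orP[]; lra.
  have sab : a <= Re z <= b by lra.
  have Slz : S (l (Re z)) by apply: Sl; lra.
  have F0 : cabs (F 0%N (l (Re z))) <= k * nu (Re z).
    have J0 : (0 < J)%N.
      have [i iJ _] := jet_dominant (jpos _ Slz); exact: leq_ltn_trans iJ.
    rewrite -cabsN -[- _]add0r -Fz.
    have zl : cabs (z - l (Re z)) <= eps.
      apply: le_trans (cabs_le_ReIm _) _.
      by rewrite cReB cImB lRe lIm subrr normr0 add0r.
    have Sz : S z by split.
    apply: le_trans (jet_lipschitz Sc K00 HF Slz Sz J0 zl _) _; first by rewrite /L in epsL; lra.
    by apply: ler_wpM2r => //; exact: jet_ge0.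
  have GR := HT1 (Re z) zbL _ (le_trans (Re_le_cabs _) F0).
  have GI := HT2 (Re z) zbL _ (le_trans (Im_le_cabs _) F0).
  (* Real and imaginary parts of at most [e / 2] times the jet contradict the existence of a
     derivative exceeding [e] times the jet. *)
  have [i iJ Hi] := jet_dominant (jpos _ Slz).
  have : cabs (F i (l (Re z))) <= e * nu (Re z).
    apply: le_trans (cabs_le_ReIm _) _.
    have -> : e * nu (Re z) = e / 2 * nu (Re z) + e / 2 * nu (Re z) by rewrite -mulrDl -splitr.
    apply: lerD; [apply: GR|apply: GI] => // t tT; apply: far; rewrite in_cons mem_cat tT ?orbT //.
  by rewrite leNgt Hi.
have [cells Hsize Hcells] : exists2 cells : seq (R * R), (size cells <= size H * (2 * m).+1)%N &
    forall z, z \in zs -> has (fun u => near_cell u z) cells.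
  have : forall eta, eta \in H -> `|eta| < A by exact: H1.
  have [cells Hs Hc] : exists2 cells : seq (R * R), (size cells <= size H * (2 * m).+1)%N &
     forall z eta, z \in zs -> eta \in H -> `|Im z - eta| <= eps -> has (fun u => near_cell u z) cells.
    elim: H H1 {H2} => [|eta H IH] H1; first by exists [::].
    have [|cells Hs Hc] := IH; first by move=> y yH; apply: H1; rewrite in_cons yH orbT.
    have [T Tm HT] := line eta (H1 _ (mem_head _ _)).
    exists ([seq (t, eta) | t <- T] ++ cells).
      by rewrite size_cat size_map /= mulSn leq_add.
    move=> z eta' zzs; rewrite in_cons has_cat => /orP[/eqP ->|eH] Hz.
      by rewrite has_map (HT z zzs Hz).
    by rewrite (Hc z eta' zzs eH Hz) orbT.
  move=> _; exists cells => // z zzs; have [[_ zA] _] := Hzs z zzs.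
  by have [eta etaH Heta] := H2 _ zA; apply: Hc etaH Heta.
apply: leq_trans (@size_le_cells _ _ near_cell cells zs J Hcells _) _; last by rewrite leq_mul2r Hsize orbT.
move=> u; case E : [seq z <- zs | near_cell u z] => [//|z0 zs'].
have : z0 \in [seq z <- zs | near_cell u z] by rewrite E mem_head.
rewrite mem_filter => /andP[c0 z0zs]; have [Sz0 Fz0] := Hzs z0 z0zs.
rewrite -E; apply: (near_zeros (rho := rho) Sc So K00 HF (jpos _ Sz0)) => //.
  exact: filter_uniq.
move=> z; rewrite mem_filter => /andP[cz zzs]; have [Sz Fz] := Hzs z zzs; split=> //.
apply: le_lt_trans (cabs_le_ReIm _) _; rewrite cReB cImB.
move: c0 cz; rewrite /near_cell => /andP[p1 p2] /andP[p3 p4].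
have q1 : `|Re z - Re z0| <= L + L.
  by apply: le_trans (ler_distD u.1 _ _) _; rewrite [`|u.1 - _|]distrC lerD.
have q2 : `|Im z - Im z0| <= eps + eps.
  by apply: le_trans (ler_distD u.2 _ _) _; rewrite [`|u.2 - _|]distrC lerD.
rewrite /L in q1 epsL; lra.
Qed.

End StripZeros.

(** * The module generated by the derivatives of a solution *)

Section FractionField.
Variable F : fieldType.

Lemma frac_reprE (x : {fraction {poly F}}) :
  tofrac (frac (repr x)).2 * x = tofrac (frac (repr x)).1.
Proof.
set r := repr x; have -> : x = \pi_{fraction {poly F}}%qT r by rewrite reprK.
unlock FracField.tofrac; rewrite -[LHS]FracField.pi_mul /FracField.mulf /=.
apply/eqmodP; rewrite /= FracField.equivfE !numden_Ratio ?oner_neq0 ?mul1r ?denom_ratioP //.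
by rewrite mulr1.
Qed.

Lemma common_denominator_seq (T : eqType) (s : seq T) (f : T -> {fraction {poly F}}) :
  exists2 g : {poly F}, g != 0 & forall x, x \in s -> exists a, tofrac g * f x = tofrac a.
Proof.
elim: s => [|x s [g g0 Hg]]; first by exists 1; rewrite ?oner_neq0.
exists (g * (frac (repr (f x))).2); first by rewrite mulf_neq0 // denom_ratioP.
move=> y; rewrite in_cons => /orP[/eqP ->|ys]; rewrite tofracM.
  by exists (g * (frac (repr (f x))).1); rewrite -mulrA frac_reprE tofracM.
have [a Ha] := Hg y ys; exists (a * (frac (repr (f x))).2).
by rewrite mulrAC Ha tofracM.
Qed.

Lemma common_denominator_mx (m k : nat) (M : 'M[{fraction {poly F}}]_(m, k)) :
  exists2 g : {poly F}, g != 0 &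
    exists M' : 'M[{poly F}]_(m, k), tofrac g *: M = map_mx (@tofrac _) M'.
Proof.
have [g g0 Hg] := common_denominator_seq (enum {: 'I_m * 'I_k}) (fun p => M p.1 p.2).
exists g => //.
have H i j : exists a, tofrac g * M i j == tofrac a.
  by have [|a /eqP] := Hg (i, j); rewrite ?mem_enum //; exists a.
exists (\matrix_(i, j) xchoose (H i j)); apply/matrixP => i j; rewrite !mxE.
exact/eqP/(xchooseP (H i j)).
Qed.

End FractionField.

Section ConnectionAlgebra.
Variables (F : fieldType) (n : nat) (P : 'M[{poly F}]_n) (d : {poly F}).
Implicit Types (S T : 'M[{poly F}]_n) (m k b e : nat) (l : F) (ls : seq F).

(* [nabla m S / d^(m+1)] represents the derivative [t d/dt] of [(S / d^m) y] along the
   solutions of [t y' = (P / d) y]. *)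
Definition nabla m S : 'M[{poly F}]_n :=
  (d * 'X) *: map_mx (@deriv F) S - (m%:R * 'X * d^`()) *: S + S *m P.

Fixpoint nablas m k S := if k is k'.+1 then nabla (m + k') (nablas m k' S) else S.

(** Represents [t d/dt - l]. The level rises from [m] to [m.+1], whence the factor [d] in the term
    with [l]. *)
Definition nabla_sub l m S := nabla m S - (l%:P * d) *: S.

Fixpoint nabla_subs m ls S :=
  if ls is l :: ls' then nabla_sub l (m + size ls') (nabla_subs m ls' S) else S.

Lemma map_derivD S T : map_mx (@deriv F) (S + T) = map_mx (@deriv F) S + map_mx (@deriv F) T.
Proof. by apply/matrixP => i j; rewrite !mxE derivD. Qed.

Lemma map_derivZ p S : map_mx (@deriv F) (p *: S) = p^`() *: S + p *: map_mx (@deriv F) S.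
Proof. by apply/matrixP => i j; rewrite !mxE derivM. Qed.

Lemma nablaD m S T : nabla m (S + T) = nabla m S + nabla m T.
Proof. by rewrite /nabla map_derivD mulmxDl !scalerDr opprD; apply/matrixP => i j; rewrite !mxE; ring. Qed.

Lemma nablaZ m p S : nabla m (p *: S) = p *: nabla m S + (d * 'X * p^`()) *: S.
Proof.
rewrite /nabla map_derivZ -scalemxAl; apply/matrixP => i j; rewrite !mxE.
by set s := \sum_(_ < _) _; ring.
Qed.

(** A change of level adds only a multiple of [S], so spans of jets are insensitive to the level. *)
Lemma nabla_level m k S : nabla m S = nabla k S + ((k%:R - m%:R) * 'X * d^`()) *: S.
Proof. by rewrite /nabla; apply/matrixP => i j; rewrite !mxE; set s := \sum_(_ < _) _; ring. Qed.

(** Cancellation of [d] in the fraction [d S / d^(m+1)]. *)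
Lemma nablaZd m S : nabla m.+1 (d *: S) = d *: nabla m S.
Proof.
rewrite nablaZ (nabla_level m.+1 m) scalerDr -addrA -[RHS]addr0; congr (_ + _).
by apply/matrixP => i j; rewrite !mxE -natr1; ring.
Qed.

Lemma nablasS m k S : nablas m k.+1 S = nablas m.+1 k (nabla m S).
Proof.
elim: k => [|k IH]; first by rewrite /= addn0.
by rewrite -[LHS]/(nabla (m + k.+1) (nablas m k.+1 S)) IH /= addSnnS.
Qed.

Lemma nablasB m k p S T : nablas m k (S - p%:P *: T) = nablas m k S - p%:P *: nablas m k T.
Proof.
elim: k => [//|k IH]; rewrite /= IH -scaleNr nablaD nablaZ -polyCN derivC mulr0 scale0r addr0.
by rewrite polyCN scaleNr.
Qed.

Lemma nablasZd m k S : nablas m.+1 k (d *: S) = d *: nablas m k S.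
Proof. by elim: k => [//|k IH]; rewrite /= IH addSn nablaZd. Qed.

Lemma nablas_sub l m k S :
  nablas m.+1 k (nabla_sub l m S) = nablas m k.+1 S - (l%:P * d) *: nablas m k S.
Proof. by rewrite /nabla_sub -scalerA nablasB nablasZd -nablasS scalerA. Qed.

Definition jet_mx k := nablas 0 k 1%:M.

(** The levels of the jets are ignored here; powers of [d] are accounted for only upon
    evaluation. *)
Definition in_jet_span S := exists s : seq (nat * {poly F}), S = \sum_(p <- s) p.2 *: jet_mx p.1.

Lemma jet_spanD S T : in_jet_span S -> in_jet_span T -> in_jet_span (S + T).
Proof. by move=> [s ->] [t ->]; exists (s ++ t); rewrite big_cat. Qed.

Lemma jet_spanZ p S : in_jet_span S -> in_jet_span (p *: S).
Proof.
move=> [s ->]; exists [seq (q.1, p * q.2) | q <- s].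
by rewrite big_map scaler_sumr; apply: eq_bigr => q _; rewrite scalerA.
Qed.

Lemma jet_span_mx k : in_jet_span (jet_mx k).
Proof. by exists [:: (k, 1)]; rewrite big_seq1 scale1r. Qed.

Lemma jet_span_nabla m S : in_jet_span S -> in_jet_span (nabla m S).
Proof.
move=> [s ->]; elim: s => [|[k p] s IH].
  rewrite big_nil; exists [::]; rewrite big_nil /nabla mul0mx.
  by apply/matrixP => i j; rewrite !mxE deriv0; ring.
rewrite big_cons nablaD; apply: jet_spanD => //=.
rewrite nablaZ (nabla_level m k).
apply: jet_spanD; last by apply: jet_spanZ; exact: jet_span_mx.
apply/jet_spanZ/jet_spanD; last by apply: jet_spanZ; exact: jet_span_mx.
exact: (jet_span_mx k.+1).
Qed.

Lemma jet_span_nablas m k S : in_jet_span S -> in_jet_span (nablas m k S).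
Proof. by move=> HS; elim: k => [//|k IH]; exact: jet_span_nabla. Qed.

Lemma jet_span_nabla_subs m ls S : in_jet_span S -> in_jet_span (nabla_subs m ls S).
Proof.
move=> HS; elim: ls => [//|l ls IH]; rewrite /= /nabla_sub -scaleNr.
by apply: jet_spanD; [exact: jet_span_nabla|exact: jet_spanZ].
Qed.

Local Notation frac := (map_mx (@FracField.tofrac {poly F})).

(* Over the field of rational functions the derivatives of the identity span a space of
   dimension at most [n^2]; clearing denominators gives [g] and [L]. *)
Lemma jet_span_finite : exists N (g : {poly F}) (L : 'M[{poly F}]_(n * n, N)), g != 0 /\
  forall S, in_jet_span S -> g *: S = \sum_(j < N) (mxvec S *m L) 0 j *: jet_mx j.
Proof.
pose v k := frac (mxvec (jet_mx k)).
pose V N : 'M[{fraction {poly F}}]_(N, n * n) := \matrix_(j < N) v j.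
have exr : exists r, `[<exists N, \rank (V N) = r>] by exists (\rank (V 0%N)); apply/asboolP; exists 0%N.
have bdr r : `[<exists N, \rank (V N) = r>] -> (r <= n * n)%N.
  by move=> /asboolP[N <-]; exact: rank_leq_col.
(* [N] realises the maximal rank among initial segments of the jets, so the first [N] of them span
   all the others. *)
have [r /asboolP[N Nr] rmax] := ex_maxnP exr bdr.
have vV k : (v k <= V N)%MS.
  have [kN|Nk] := ltnP k N.
    have -> : v k = row (Ordinal kN) (V N) by rewrite rowK.
    exact: row_sub.
  have sub : (V N <= V k.+1)%MS.
    apply/row_subP => i; rewrite rowK.
    have ik : (i < k.+1)%N by rewrite ltnS (leq_trans _ Nk) // ltnW.
    have -> : v i = row (Ordinal ik) (V k.+1) by rewrite rowK.
    exact: row_sub.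
  have := mxrank_leqif_sup sub.
  have /rmax : `[<exists N, \rank (V N) = \rank (V k.+1)>] by apply/asboolP; exists k.+1.
  rewrite -Nr => le1 [le2 /esym E].
  have sub2 : (V k.+1 <= V N)%MS by rewrite E eqn_leq le2 le1.
  apply: submx_trans sub2.
  have -> : v k = row ord_max (V k.+1) by rewrite rowK.
    exact: row_sub.
(* The pseudo-inverse gives coordinates in the rows of [V N], and clearing its denominators gives
   [g] and [L], uniformly in [S]. *)
have [g g0 [L HL]] := common_denominator_mx (pinvmx (V N)).
exists N, g, L; split=> // S [s SE].
have SV : (frac (mxvec S) <= V N)%MS.
  rewrite SE; elim: s {SE} => [|p s IH]; first by rewrite big_nil linear0 map_mx0 sub0mx.
  rewrite big_cons linearD map_mxD; apply: addmx_sub => //.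
  by rewrite linearZ /= map_mxZ; apply: scalemx_sub; exact: vV.
have H := mulmxKpV SV.
apply: (can_inj (@mxvecK _ n n)).
suff E : frac (mxvec (g *: S)) = frac (mxvec (\sum_(j < N) (mxvec S *m L) 0 j *: jet_mx j)).
  apply/matrixP => i j; apply/eqP; rewrite -tofrac_eq; apply/eqP.
  by move/matrixP/(_ i j): E; rewrite !mxE.
rewrite linearZ /= map_mxZ -{1}H scalemxAl scalemxAr HL -map_mxM.
rewrite mulmx_sum_row linear_sum raddf_sum /=; apply: eq_bigr => j _.
by rewrite linearZ /= map_mxZ rowK mxE.
Qed.

(** Extract from the previous [g] its exact power [X^e]. Coordinates are linear in [S], so a factor
    [X^b] of [S] passes to them, while the loss [X^e] is the same for all [b]. *)
Lemma jet_span_divisible : exists N e (g : {poly F}) (L : 'M[{poly F}]_(n * n, N)), g.[0] != 0 /\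
  forall b S, in_jet_span ('X^b *: S) ->
    ('X^e * g) *: ('X^b *: S) = 'X^b *: \sum_(j < N) (mxvec S *m L) 0 j *: jet_mx j.
Proof.
have [N [g [L [g0 HL]]]] := jet_span_finite.
have [e [q qr gE]] := multiplicity_XsubC g 0.
exists N, e, q, L; split; first by rewrite g0 in qr.
move=> b S /HL; rewrite gE subr0 mulrC => ->.
rewrite scaler_sumr; apply: eq_bigr => j _.
by rewrite linearZ /= -scalemxAl mxE scalerA.
Qed.

End ConnectionAlgebra.

Lemma foldr_char_poly_roots (F : fieldType) (n : nat) (c : F) (B M : 'M[F]_n) (ls : seq F) :
  c != 0 -> char_poly (c^-1 *: B) = \prod_(l <- ls) ('X - l%:P) ->
  foldr (fun l N => N *m (B - (l * c)%:M)) M ls = 0.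
Proof.
move=> c0; case: n B M => [|n] B M HC; first by rewrite [LHS]flatmx0.
set A := _ *: B in HC.
have BA l : B - (l * c)%:M = c *: horner_mx A ('X - l%:P).
  rewrite rmorphB /= horner_mx_X horner_mx_C scalerBr /A scalerA mulfV // scale1r.
  by rewrite scale_scalar_mx mulrC.
have H (rs : seq F) : foldr (fun l M => M *m (B - (l * c)%:M)) M rs =
    c ^+ size rs *: (M *m horner_mx A (\prod_(l <- rs) ('X - l%:P))).
  elim: rs => [|l rs IH]; first by rewrite big_nil rmorph1 mulmx1 scale1r.
  rewrite /= IH BA big_cons mulrC rmorphM /= -scalemxAl -scalemxAr scalerA -exprSr mulmxA.
  by rewrite mulmxE.
by rewrite H -HC Cayley_Hamilton mulmx0 scaler0.
Qed.

(** * Cayley-Hamilton and divisibility by powers of the coordinate *)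

Section CayleyHamilton.
Variables (F : fieldType) (n : nat) (P : 'M[{poly F}]_n) (d : {poly F}).
Implicit Types (S T : 'M[{poly F}]_n) (m k b e : nat) (l : F) (ls : seq F).
Local Notation ev := (map_mx (horner^~ (0 : F))).

(** Conjugation by [t^k] turns [t d/dt - (l + k)] into [t d/dt - l]. *)
Lemma nabla_sub_shift k l m S :
  nabla_sub P d (l + k%:R) m ('X^k *: S) = 'X^k *: nabla_sub P d l m S.
Proof.
rewrite /nabla_sub nablaZ derivXn !scalerDr scalerA.
apply/matrixP => i j; rewrite !mxE polyCD polyC_natr.
case: k => [|k]; first by rewrite !mulr0n; ring.
by rewrite /= exprS -mulr_natr; ring.
Qed.

Lemma nabla_subs_shift k ls m S :
  nabla_subs P d m [seq l + k%:R | l <- ls] ('X^k *: S) = 'X^k *: nabla_subs P d m ls S.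
Proof. by elim: ls => [//|l ls IH]; rewrite /= IH size_map nabla_sub_shift. Qed.

Lemma nabla_subs_cat m ls ls' S :
  nabla_subs P d m (ls ++ ls') S = nabla_subs P d (m + size ls') ls (nabla_subs P d m ls' S).
Proof. by elim: ls => [//|l ls IH]; rewrite /= IH size_cat addnAC addnA. Qed.

(** At 0 the derivative terms of [nabla] drop out, each having a factor [X]. *)
Lemma nabla_sub_ev l m S : ev (nabla_sub P d l m S) = ev S *m (ev P - (l * d.[0])%:M).
Proof.
have HM : ev (S *m P) = ev S *m ev P by rewrite (map_mxM (horner_eval 0)).
rewrite mulmxBr -HM mul_mx_scalar; apply/matrixP => i j; rewrite !mxE !hornerE.
by rewrite oppr0 add0r.
Qed.

Lemma nabla_subs_ev ls m S :
  ev (nabla_subs P d m ls S) =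
  foldr (fun l M => M *m (ev P - (l * d.[0])%:M)) (ev S) ls.
Proof. by elim: ls => [//|l ls IH]; rewrite /= nabla_sub_ev IH. Qed.

Lemma nabla_subs_vanish ls m S : d.[0] != 0 ->
  char_poly (d.[0]^-1 *: ev P) = \prod_(l <- ls) ('X - l%:P) -> ev (nabla_subs P d m ls S) = 0.
Proof. by move=> d0 HC; rewrite nabla_subs_ev; exact: foldr_char_poly_roots. Qed.

Fixpoint shifted_roots (ls : seq F) (b : nat) : seq F :=
  if b is b'.+1 then [seq l + b'%:R | l <- ls] ++ shifted_roots ls b' else [::].

Lemma size_shifted_roots ls b : size (shifted_roots ls b) = (b * size ls)%N.
Proof. by elim: b => [//|b IH]; rewrite /= size_cat size_map IH. Qed.

(** Each block of shifted eigenvalues gains one factor [X]: on [X^b T] the operators for [l + b] act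
    as those for [l] act on [T], and the composition of the latter vanishes at 0 by
    Cayley-Hamilton. *)
Lemma nabla_subs_divisible ls b S : d.[0] != 0 ->
  char_poly (d.[0]^-1 *: ev P) = \prod_(l <- ls) ('X - l%:P) ->
  exists T, nabla_subs P d 0 (shifted_roots ls b) S = 'X^b *: T.
Proof.
move=> d0 HC; elim: b => [|b [T HT]]; first by exists S; rewrite expr0 scale1r.
rewrite /= nabla_subs_cat HT nabla_subs_shift.
set U := nabla_subs _ _ _ _ _.
have U0 : ev U = 0 by exact: nabla_subs_vanish.
exists (map_mx (fun p => p %/ 'X) U); rewrite exprSr -scalerA; congr (_ *: _).
apply/matrixP => i j; rewrite !mxE mulrC divpK //.
have : root (U i j) 0 by move/matrixP/(_ i j): U0; rewrite !mxE /root => ->.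
by rewrite -dvdp_XsubCl polyC0 subr0.
Qed.

Lemma nablas_divisible m k b T : exists T', nablas P d m k ('X^b *: T) = 'X^b *: T'.
Proof.
elim: k => [|k [T' HT']]; first by exists T.
exists (nabla P d (m + k) T' + (d * b%:R) *: T').
rewrite /= HT' nablaZ derivXn [RHS]scalerDr; congr (_ + _); rewrite scalerA; congr (_ *: _).
case: b {HT'} => [|b]; first by rewrite mulr0n !mulr0.
rewrite exprS -mulr_natr; move: (b.+1%:R) ('X^b) => N Y /=.
by ring.
Qed.

End CayleyHamilton.

(** * Zeros in a half disc around a Fuchsian point *)

Section ComplexExp.
Variable R : realType.
Local Notation C := (cplx R).
Local Notation Re := (@complex.Re R).
Local Notation Im := (@complex.Im R).
Implicit Types (z w : C).

Definition cexp z : C := Complex (expR (Re z) * cos (Im z)) (expR (Re z) * sin (Im z)).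

Lemma cexpD z w : cexp (z + w) = cexp z * cexp w.
Proof.
rewrite /cexp cReD cImD expRD cosD sinD.
rewrite -[RHS]/(Complex ((expR (Re z) * cos (Im z)) * (expR (Re w) * cos (Im w)) - (expR (Re z) * sin (Im z)) * (expR (Re w) * sin (Im w)))
  ((expR (Re z) * cos (Im z)) * (expR (Re w) * sin (Im w)) + (expR (Re z) * sin (Im z)) * (expR (Re w) * cos (Im w)))).
by congr Complex; ring.
Qed.

Lemma cabs_cexp z : cabs (cexp z) = expR (Re z).
Proof.
by rewrite /cabs /= !exprMn -mulrDr cos2Dsin2 mulr1 sqrtr_sqr ger0_norm // expR_ge0.
Qed.

(** By [cexpD] it is enough to expand at 0. The errors in [exp], [cos] and [sin] are at most
    [e1 * c]; products of small terms are of the same order because [c <= e1], and nine such terms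
    bound the sum. *)
Lemma is_derive_cexp z : is_derive z 1 cexp (cexp z).
Proof.
apply/is_derive_cabsP => e e0.
pose D := cabs (cexp z) + 1; have D0 : 0 < D by rewrite ltr_wpDl // cabs_ge0.
have /is_derive_epsP Hexp := is_derive_expR (0 : R).
have /is_derive_epsP Hcos := is_derive_cos (0 : R).
have /is_derive_epsP Hsin := is_derive_sin (0 : R).
pose e1 := Num.min (e / (9 * D)) 1.
have e10 : 0 < e1 by rewrite lt_min ltr01 andbT divr_gt0 // mulr_gt0.
have e1e : e1 * (9 * D) <= e by rewrite -ler_pdivlMr ?mulr_gt0 // /e1 ge_min lexx.
have e11 : e1 <= 1 by rewrite /e1 ge_min lexx orbT.
have [d1 d10 H1] := Hexp e1 e10.
have [d2 d20 H2] := Hcos e1 e10.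
have [d3 d30 H3] := Hsin e1 e10.
pose d := Num.min e1 (Num.min d1 (Num.min d2 d3)).
exists d; first by rewrite lt_min e10 /= lt_min d10 /= lt_min d20.
move=> h; rewrite lt_min => /andP[h0]; rewrite lt_min => /andP[h1]; rewrite lt_min => /andP[h2 h3].
set a := Re h; set b := Im h; set c := cabs h.
have ha : `|a| <= c by exact: Re_le_cabs.
have hb : `|b| <= c by exact: Im_le_cabs.
have c0 : 0 <= c by exact: cabs_ge0.
have := H1 a (le_lt_trans ha h1); rewrite add0r expR0 mul1r => X1.
have := H2 b (le_lt_trans hb h2); rewrite add0r cos0 sin0 oppr0 mul0r subr0 => X2.
have := H3 b (le_lt_trans hb h3); rewrite add0r cos0 sin0 subr0 mul1r => X3.
have {}X1 : `|expR a - 1 - a| <= e1 * c by apply: le_trans X1 _; rewrite ler_pM2l.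
have {}X2 : `|cos b - 1| <= e1 * c by apply: le_trans X2 _; rewrite ler_pM2l.
have {}X3 : `|sin b - b| <= e1 * c by apply: le_trans X3 _; rewrite ler_pM2l.
have e1c : e1 * c <= c by rewrite -[leRHS]mul1r; exact: ler_wpM2r.
have Y1 : `|expR a - 1| <= 2 * c.
  have -> : expR a - 1 = (expR a - 1 - a) + a by ring.
  apply: le_trans (ler_normD _ _) _; lra.
have cc : c * c <= e1 * c by apply: ler_wpM2r => //; exact: ltW.
have -> : cexp (z + h) - cexp z - cexp z * h = cexp z * (cexp h - 1 - h) by rewrite cexpD; ring.
rewrite cabsM; apply: (@le_trans _ _ (D * (9 * (e1 * c)))); last first.
  have := ler_wpM2r c0 e1e; lra.
have bound : cabs (cexp h - 1 - h) <= 9 * (e1 * c).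
  apply: le_trans (cabs_le_ReIm _) _; rewrite !cReB !cImB /= -/a -/b subr0.
  have -> : expR a * cos b - 1 - a = (expR a - 1 - a) + (expR a - 1) * (cos b - 1) + (cos b - 1) by ring.
  have -> : expR a * sin b - b = (expR a - 1) * ((sin b - b) + b) + (sin b - b) by ring.
  have Z1 : `|(expR a - 1) * (cos b - 1)| <= 2 * c * (e1 * c).
    by rewrite normrM; apply: ler_pM.
  have Z2 : `|(expR a - 1) * (sin b - b + b)| <= 2 * c * (e1 * c + c).
    rewrite normrM; apply: ler_pM => //; apply: le_trans (ler_normD _ _) _; lra.
  have := ler_normD (expR a - 1 - a + (expR a - 1) * (cos b - 1)) (cos b - 1).
  have := ler_normD (expR a - 1 - a) ((expR a - 1) * (cos b - 1)).
  have := ler_normD ((expR a - 1) * (sin b - b + b)) (sin b - b).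
  have : c * (e1 * c) <= 1 * (e1 * c).
    by apply: ler_wpM2r; [rewrite mulr_ge0 // ltW|exact: le_trans (ltW h0) e11].
  lra.
apply: ler_pM; rewrite ?cabs_ge0 //; rewrite /D; lra.
Qed.

(** The principal logarithm through [atan]; this is where half planes and strips of width [pi]
    correspond. *)
Lemma cexp_surj w : 0 < Re w -> exists z, [/\ cexp z = w, Re z = ln (cabs w) & `|Im z| < pi / 2].
Proof.
move=> w0.
have wn : w != 0 by apply/eqP => E; rewrite E ltxx in w0.
have c0 : 0 < cabs w by rewrite cabs_gt0.
pose t := Im w / Re w.
have E : cabs w = Re w * Num.sqrt (1 + t ^+ 2).
  rewrite -[X in X * _](gtr0_norm w0) -sqrtr_sqr -sqrtrM ?sqr_ge0 // /cabs; congr Num.sqrt.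
  by rewrite /t; field; rewrite gt_eqF.
have s0 : 0 < Num.sqrt (1 + t ^+ 2) by rewrite sqrtr_gt0 ltr_wpDr // sqr_ge0.
have Hc : cos (atan t) = (Num.sqrt (1 + t ^+ 2))^-1 by rewrite cos_atan.
have Hs : sin (atan t) = t * cos (atan t).
  by rewrite -[X in X * _](atanK t) /tan divfK // Hc gt_eqF // invr_gt0.
exists (Complex (ln (cabs w)) (atan t)); split=> //=.
  rewrite /cexp /= lnK ?posrE // Hs Hc E.
  have w0' : Re w != 0 by rewrite gt_eqF.
  have s0' : Num.sqrt (1 + t ^+ 2) != 0 by rewrite gt_eqF.
  have -> : w = Complex (Re w) (Im w) by case: (w).
  rewrite -/t /=; move: (Num.sqrt _) s0' => r r0.
  congr Complex; first by field.
  by rewrite /t; field; rewrite r0.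
by rewrite ltr_norml atan_gtNpi2 atan_ltpi2.
Qed.

End ComplexExp.

(** * Solutions in the logarithmic coordinate *)

Section SolutionFamily.
Variables (R : realType) (n : nat).
Local Notation C := (cplx R).
Variables (P : 'M[{poly C}]_n) (d : {poly C}).
Implicit Types (z w u : C) (c : 'rV[C]_n) (v : 'cV[C]_n) (y : C -> 'cV[C]_n) (S T : 'M[{poly C}]_n).
Local Notation ev u := (map_mx (horner^~ u)).

Definition jet_value c v S m u : C := (c *m ev u S *m v) 0 0 / d.[u] ^+ m.

Definition local_solution (V : set C) y := forall u, V u -> [/\ u != 0, d.[u] != 0 &
  forall i, is_derive u 1 (fun s => y s i 0) ((u * d.[u])^-1 * (ev u P *m y u) i 0)].

Lemma ev_mulmx (p q r : nat) u (A : 'M[{poly C}]_(p, q)) (B : 'M[{poly C}]_(q, r)) :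
  ev u (A *m B) = ev u A *m ev u B.
Proof. exact: (map_mxM (horner_eval u)). Qed.

Lemma is_derive_csum m (f : 'I_m -> C -> C) (df : 'I_m -> C) u :
  (forall j, is_derive u 1 (f j) (df j)) ->
  is_derive u 1 (fun s => \sum_j f j s) (\sum_j df j).
Proof.
elim: m f df => [|m IH] f df H.
  rewrite big_ord0; under eq_fun do rewrite big_ord0; exact: is_derive_cst.
rewrite big_ord_recr; under eq_fun do rewrite big_ord_recr.
by apply: is_derive_add => //; apply: IH.
Qed.

(** With [u = io * cexp z] one has [d/dz = u d/du]; differentiating the denominator [d^m] produces
    the middle term of [nabla]. *)
Lemma jet_value_derive V y c S m (io z : C) : local_solution V y -> V (io * cexp z) ->
  is_derive z 1 (fun z => jet_value c (y (io * cexp z)) S m (io * cexp z))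
    (jet_value c (y (io * cexp z)) (nabla P d m S) m.+1 (io * cexp z)).
Proof.
move=> Hy /Hy; set u := io * cexp z => -[u0 du0 yd].
pose rho : 'rV[{poly C}]_n := map_mx polyC c *m S.
have evc s : ev s (map_mx polyC c) = c by apply/matrixP => i j; rewrite !mxE hornerC.
have vE T k s : jet_value c (y s) T k s = (\sum_j ((map_mx polyC c *m T) 0 j).[s] * y s j 0) / d.[s] ^+ k.
  rewrite /jet_value -{1}(evc s) -ev_mulmx mxE; congr (_ / _).
  by apply: eq_bigr => j _; rewrite mxE.
have Dnum : is_derive u 1 (fun s => \sum_j (rho 0 j).[s] * y s j 0)
   (\sum_j ((rho 0 j).[u] * ((u * d.[u])^-1 * (ev u P *m y u) j 0) + (rho 0 j)^`().[u] * y u j 0)).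
  by apply: is_derive_csum => j; exact: is_derive_mul (is_derive_horner (rho 0 j) u) (yd j).
have Dden : is_derive u 1 (fun s => (d.[s] ^+ m)^-1) (- ((d.[u] ^+ m) ^+ 2)^-1 * (m%:R * d.[u] ^+ m.-1 * d^`().[u])).
  exact: (@is_derive_chain C (fun s => s^-1) (fun s => d.[s] ^+ m) u _ _
    (is_derive_inv (expf_neq0 m du0)) (is_derive_exprn m (is_derive_horner d u))).
have Dw := is_derive_mul Dnum Dden.
have DU : is_derive z 1 (fun z => io * cexp z) u.
  apply: (is_derive_eq (is_derive_mul (is_derive_cst io z (1 : C)) (is_derive_cexp z))).
  by rewrite /cst mul0r addr0.
have := @is_derive_chain C (fun s => (\sum_j (rho 0 j).[s] * y s j 0) * (d.[s] ^+ m)^-1)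
   (fun z => io * cexp z) z _ _ Dw DU.
under eq_fun do rewrite -[_ * _ ^-1]vE.
move=> D; apply: (is_derive_eq D); rewrite vE.
set A := \sum_j (rho 0 j)^`().[u] * y u j 0.
set B := \sum_j (rho 0 j).[u] * y u j 0.
set G := \sum_j (rho 0 j).[u] * (ev u P *m y u) j 0.
have -> : \sum_j ((rho 0 j).[u] * ((u * d.[u])^-1 * (ev u P *m y u) j 0) + (rho 0 j)^`().[u] * y u j 0) =
   (u * d.[u])^-1 * G + A.
  by rewrite big_split /=; congr (_ + _); rewrite mulr_sumr; apply: eq_bigr => j _; rewrite mulrCA.
have -> : \sum_j ((map_mx polyC c *m nabla P d m S) 0 j).[u] * y u j 0 =
   d.[u] * u * A - m%:R * u * d^`().[u] * B + G.
  have -> : map_mx polyC c *m nabla P d m S =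
     (d * 'X) *: map_mx (@deriv _) rho - (m%:R * 'X * d^`()) *: rho + rho *m P.
    rewrite /nabla mulmxDr mulmxBr -!scalemxAr mulmxA; congr (_ *: _ - _ + _).
    apply/matrixP => i j; rewrite [RHS]mxE [rho i j]mxE raddf_sum [LHS]mxE; apply: eq_bigr => k _.
    by rewrite /= derivM [map_mx polyC c i k]mxE derivC mul0r add0r [map_mx _ S k j]mxE.
  have -> : G = \sum_j ((rho *m P) 0 j).[u] * y u j 0.
    have -> : G = (ev u rho *m (ev u P *m y u)) 0 0.
      by rewrite [RHS]mxE; apply: eq_bigr => j _; rewrite [ev u rho 0 j]mxE.
    by rewrite mulmxA -ev_mulmx mxE; apply: eq_bigr => j _; rewrite [ev u _ 0 j]mxE.
  rewrite /A /B !mulr_sumr -sumrB -big_split /=; apply: eq_bigr => j _.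
  have E (M1 M2 M3 : 'rV[{poly C}]_n) (a b : {poly C}) :
      ((a *: M1 - b *: M2 + M3) 0 j).[u] = a.[u] * (M1 0 j).[u] - b.[u] * (M2 0 j).[u] + (M3 0 j).[u].
    by rewrite !mxE !hornerE.
  rewrite E [map_mx _ rho 0 j]mxE !hornerM !hornerX -polyC_natr hornerC.
  by ring.
have um : d.[u] ^+ m != 0 by exact: expf_neq0.
case: m {vE Dden Dw D} um => [|m] um.
  by rewrite /= !expr0 expr1; field; rewrite du0 u0.
rewrite /= !exprS; move: um; rewrite exprS mulf_eq0 negb_or => /andP[_ um].
move: (m.+1%:R) (d.[u] ^+ m) um => M r r0.
by field; rewrite ?du0 ?u0 ?r0.
Qed.

Definition solution_family c y (io : C) (k : nat) (z : C) : C :=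
  jet_value c (y (io * cexp z)) (jet_mx P d k) k (io * cexp z).

Lemma jet_valueB c v S T p m u : jet_value c v (S - p *: T) m u =
  jet_value c v S m u - p.[u] * jet_value c v T m u.
Proof.
have E : ev u (S - p *: T) = ev u S - p.[u] *: ev u T.
  by apply/matrixP => i j; rewrite !mxE !hornerE.
by rewrite /jet_value E mulmxBr mulmxBl -scalemxAr -scalemxAl !mxE mulrBl -mulrA.
Qed.

Lemma jet_valueZd c v S m u : d.[u] != 0 -> jet_value c v (d *: S) m.+1 u = jet_value c v S m u.
Proof.
move=> du0; have E : ev u (d *: S) = d.[u] *: ev u S by apply/matrixP => i j; rewrite !mxE !hornerE.
rewrite /jet_value E -scalemxAr -scalemxAl mxE exprS; set q := (_ *m v) 0 0.
by field; rewrite du0 expf_neq0.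
Qed.

(** Translates the scalar operators [d/dz - l] into the matrix operators for which divisibility by
    [u^b] is known. *)
Lemma shift_ops_solution c y io (ls : seq C) k z : d.[io * cexp z] != 0 ->
  shift_ops ls (solution_family c y io) k z =
  jet_value c (y (io * cexp z)) (nablas P d (size ls) k (nabla_subs P d 0 ls 1%:M)) (size ls + k) (io * cexp z).
Proof.
move=> du0; elim: ls k => [|l ls IH] k; first by [].
rewrite [LHS]/= -/(shift_ops ls _) /shift_op !IH [size (l :: ls)]/= [nabla_subs P d 0 (l :: ls) 1%:M]/=.
by rewrite add0n nablas_sub -scalerA jet_valueB hornerC addSn jet_valueZd // addnS.
Qed.

End SolutionFamily.

(** * Bounds near the centre, uniform in the solution *)

Section LocalBound.
Variables (R : realType) (n : nat).
Local Notation C := (cplx R).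
Variables (P : 'M[{poly C}]_n) (d : {poly C}).
Hypothesis d0 : d.[0] != 0.
Implicit Types (z w u : C) (c : 'rV[C]_n) (v : 'cV[C]_n) (y : C -> 'cV[C]_n) (S T : 'M[{poly C}]_n).

Lemma uniform_bound (N : nat) (Q : nat -> R -> R -> Prop) :
  (forall j r r' a a', Q j r a -> r' <= r -> a <= a' -> Q j r' a') ->
  (forall j, exists r a, [/\ 0 < r, 0 <= a & Q j r a]) ->
  exists r a, [/\ 0 < r, 0 <= a & forall j, (j < N)%N -> Q j r a].
Proof.
move=> mono H; elim: N => [|N [r [a [r0 a0 Hr]]]]; first by exists 1, 0; split.
have [r' [a' [r0' a0' Hr']]] := H N.
exists (Num.min r r'), (Num.max a a'); split; [by rewrite lt_min r0|by rewrite le_max a0|].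
move=> j; rewrite ltnS leq_eqVlt => /orP[/eqP ->|jN].
  by apply: mono Hr' _ _; rewrite ?ge_min ?le_max lexx orbT.
by apply: mono (Hr j jN) _ _; rewrite ?ge_min ?le_max lexx.
Qed.

Lemma horner_near0 (p : {poly C}) : exists r a, [/\ 0 < r, 0 <= a &
  forall u, cabs u < r -> cabs (p.[u] - p.[0]) <= a * cabs u].
Proof.
have /is_derive_cabsP/(_ 1 ltr01)[r r0 H] := is_derive_horner p (0 : C).
exists r, (1 + cabs p^`().[0]); split=> //; first by rewrite addr_ge0 // cabs_ge0.
move=> u /H; rewrite add0r => Hu.
have -> : p.[u] - p.[0] = (p.[u] - p.[0] - p^`().[0] * u) + p^`().[0] * u by ring.
apply: le_trans (cabsD _ _) _; rewrite cabsM; lra.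
Qed.

Lemma poly_quotient_bounded (q h : {poly C}) : h.[0] != 0 -> exists r a, [/\ 0 < r, 0 <= a &
  forall u, cabs u < r -> h.[u] != 0 /\ cabs (q.[u] / h.[u]) <= a].
Proof.
move=> h0.
have [r1 [a1 [r10 a10 H1]]] := horner_near0 q.
have [r2 [a2 [r20 a20 H2]]] := horner_near0 h.
have hp : 0 < cabs h.[0] by rewrite cabs_gt0.
pose r := Num.min 1 (Num.min r1 (Num.min r2 (cabs h.[0] / (2 * (a2 + 1))))).
have a21 : 0 < 2 * (a2 + 1) by lra.
exists r, ((cabs q.[0] + a1) / (cabs h.[0] / 2)); split.
- by rewrite lt_min ltr01 /= lt_min r10 /= lt_min r20 divr_gt0.
- by rewrite divr_ge0 ?addr_ge0 ?cabs_ge0 //; lra.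
move=> u; rewrite lt_min => /andP[u1]; rewrite lt_min => /andP[ur1]; rewrite lt_min => /andP[ur2 uh].
have Q : cabs q.[u] <= cabs q.[0] + a1.
  have -> : q.[u] = q.[0] + (q.[u] - q.[0]) by ring.
  apply: le_trans (cabsD _ _) _; rewrite lerD2l; apply: le_trans (H1 u ur1) _.
  by rewrite -[leRHS]mulr1; apply: ler_wpM2l => //; exact: ltW.
have Hh : cabs h.[0] / 2 <= cabs h.[u].
  have : cabs h.[0] <= cabs h.[u] + cabs (h.[u] - h.[0]).
    have {1}-> : h.[0] = h.[u] - (h.[u] - h.[0]) by ring.
    exact: cabsB.
  have := H2 u ur2; move: uh; rewrite ltr_pdivlMr // => uh.
  have := cabs_ge0 u; lra.
have hu0 : 0 < cabs h.[u] by lra.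
split; first by rewrite -cabs_gt0.
rewrite cabsM cabsV; apply: ler_pM; rewrite ?invr_ge0 ?cabs_ge0 //.
by rewrite lef_pV2 ?posrE //; lra.
Qed.

Lemma jet_valueZ c v S p m u : jet_value d c v (p *: S) m u = p.[u] * jet_value d c v S m u.
Proof.
have E : map_mx (horner^~ u) (p *: S) = p.[u] *: map_mx (horner^~ u) S.
  by apply/matrixP => i j; rewrite !mxE !hornerE.
by rewrite /jet_value E -scalemxAr -scalemxAl !mxE -mulrA.
Qed.

Lemma jet_value_sum c v N (S : 'I_N -> 'M[{poly C}]_n) m u :
  jet_value d c v (\sum_(j < N) S j) m u = \sum_(j < N) jet_value d c v (S j) m u.
Proof.
have E : map_mx (horner^~ u) (\sum_(j < N) S j) = \sum_(j < N) map_mx (horner^~ u) (S j).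
  by apply/matrixP => i j; rewrite !mxE summxE horner_sum summxE; apply: eq_bigr => k _; rewrite mxE.
by rewrite /jet_value E mulmx_sumr mulmx_suml summxE mulr_suml.
Qed.

(** Dividing the relation by [u^e g(u)] leaves [u^(b-e)]. The levels [m] and [j] differ by powers of
    [d], bounded near 0 with their inverses. *)
Lemma jet_span_bound N e (g : {poly C}) (L : 'M[{poly C}]_(n * n, N)) b T m : g.[0] != 0 -> (e <= b)%N ->
  ('X^e * g) *: ('X^b *: T) = 'X^b *: \sum_(j < N) (mxvec T *m L) 0 j *: jet_mx P d j ->
  exists r a, [/\ 0 < r, 0 <= a & forall c v u, u != 0 -> cabs u < r -> d.[u] != 0 /\
    cabs (jet_value d c v ('X^b *: T) m u) <=
      a * cabs u ^+ (b - e) * \sum_(j < N) cabs (jet_value d c v (jet_mx P d j) j u)].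
Proof.
move=> g0 eb HT.
(* Extended by 0 beyond [N], since [uniform_bound] quantifies over all natural numbers. *)
pose q (j : nat) : {poly C} := if insub j is Some i then (mxvec T *m L) 0 (i : 'I_N) else 0.
have gd0 : (g * d ^+ m).[0] != 0 by rewrite hornerM horner_exp mulf_neq0 // expf_neq0.
have [r [a [r0 a0 Hr]]] : exists r a, [/\ 0 < r, 0 <= a & forall j, (j < N)%N ->
   forall u, cabs u < r -> (g * d ^+ m).[u] != 0 /\ cabs ((q j * d ^+ j).[u] / (g * d ^+ m).[u]) <= a].
  apply: (@uniform_bound N (fun j r a => forall u, cabs u < r -> (g * d ^+ m).[u] != 0 /\
     cabs ((q j * d ^+ j).[u] / (g * d ^+ m).[u]) <= a)).
    move=> j r r' a a' H rr aa u ur; have [H1 H2] := H u (lt_le_trans ur rr).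
    by split=> //; exact: le_trans H2 aa.
  by move=> j; exact: poly_quotient_bounded.
have gd1 : (g * d).[0] != 0 by rewrite hornerM mulf_neq0.
have [r2 [a2 [r20 _ Hr2]]] := poly_quotient_bounded 0 gd1.
exists (Num.min r r2), a; split; [by rewrite lt_min r0|by []|].
move=> c v u u0; rewrite lt_min => /andP[ur ur2].
have [gd _] := Hr2 u ur2; move: gd; rewrite hornerM mulf_eq0 negb_or => /andP[gu du]; split=> //.
have := congr1 (fun S => jet_value d c v S m u) HT.
rewrite /= jet_valueZ [RHS]jet_valueZ jet_value_sum hornerM !hornerXn => E.
have -> : jet_value d c v ('X^b *: T) m u =
   u ^+ (b - e) * \sum_(j < N) ((q j * d ^+ j).[u] / (g * d ^+ m).[u]) * jet_value d c v (jet_mx P d j) j u.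
  have ueg : u ^+ e * g.[u] != 0 by rewrite mulf_neq0 // expf_neq0.
  apply: (mulfI ueg); rewrite E.
  rewrite [RHS]mulrA [u ^+ e * _]mulrC -(mulrA g.[u]) -exprD subnKC // [g.[u] * _]mulrC -mulrA; congr (_ * _).
  rewrite mulr_sumr; apply: eq_bigr => j _; rewrite jet_valueZ /q insubT //= => jN.
  have -> : Sub (j : nat) jN = j :> 'I_N by apply: val_inj.
  rewrite !hornerM !horner_exp /jet_value; set A := (_ *m v) 0 0.
  by field; rewrite gu !expf_neq0.
rewrite cabsM cabsX [a * _]mulrC -mulrA; apply: ler_wpM2l; first by rewrite exprn_ge0 // cabs_ge0.
rewrite mulr_sumr.
have csum M (f : 'I_M -> C) : cabs (\sum_(j < M) f j) <= \sum_(j < M) cabs (f j).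
  elim: M f => [|M IH] f; first by rewrite !big_ord0 cabs0.
  by rewrite !big_ord_recr /=; apply: le_trans (cabsD _ _) _; rewrite lerD2r; exact: IH.
apply: le_trans (csum _ _) _; apply: ler_sum => j _; rewrite cabsM.
apply: ler_wpM2r; first exact: cabs_ge0.
by have [] := Hr j (ltn_ord j) u ur.
Qed.

Lemma shift_ops_upper (ls : seq C) : exists2 a : R, 0 <= a & forall (F : nat -> C -> C) k z,
  cabs (shift_ops ls F k z) <= a * \sum_(j < (size ls).+1) cabs (F (k + j)%N z).
Proof.
elim: ls => [|l ls [a a0 IH]].
  by exists 1 => // F k z; rewrite big_ord1 addn0 mul1r.
exists (a + cabs l * a); first by rewrite addr_ge0 ?mulr_ge0 ?cabs_ge0.
move=> F k z; rewrite /= -/(shift_ops ls F) /shift_op.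
apply: le_trans (cabsB _ _) _; rewrite cabsM mulrDl; apply: lerD.
  apply: le_trans (IH F k.+1 z) _; apply: ler_wpM2l => //.
  rewrite [leRHS]big_ord_recl /=; rewrite -[leLHS]add0r; apply: lerD; first exact: cabs_ge0.
  by apply: ler_sum => j _; rewrite addSnnS.
rewrite -mulrA; apply: ler_wpM2l; first exact: cabs_ge0.
apply: le_trans (IH F k z) _; apply: ler_wpM2l => //.
by rewrite [leRHS]big_ord_recr /= lerDl cabs_ge0.
Qed.

(** The operator is monic: its value determines the derivative of order [size ls] up to lower
    ones. *)
Lemma shift_ops_top (ls : seq C) : exists2 a : R, 0 <= a & forall (F : nat -> C -> C) k z,
  cabs (F (k + size ls)%N z) <= cabs (shift_ops ls F k z) + a * \sum_(j < size ls) cabs (F (k + j)%N z).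
Proof.
elim: ls => [|l ls [a a0 IH]].
  by exists 0 => // F k z; rewrite addn0 mul0r addr0.
have [a' a0' H] := shift_ops_upper ls.
exists (cabs l * a' + a); first by rewrite addr_ge0 ?mulr_ge0 ?cabs_ge0.
move=> F k z; rewrite /= -/(shift_ops ls F) /shift_op -addSnnS.
apply: le_trans (IH F k.+1 z) _.
set G := shift_ops ls F.
have G1 : cabs (G k.+1 z) <= cabs (G k.+1 z - l * G k z) + cabs l * cabs (G k z).
  have {1}-> : G k.+1 z = (G k.+1 z - l * G k z) + l * G k z by ring.
  by apply: le_trans (cabsD _ _) _; rewrite cabsM.
have G2 := ler_wpM2l (cabs_ge0 l) (H F k z).
have S : \sum_(j < size ls) cabs (F (k.+1 + j)%N z) <= \sum_(j < (size ls).+1) cabs (F (k + j)%N z).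
  rewrite [leRHS]big_ord_recl /=; rewrite -[leLHS]add0r; apply: lerD; first exact: cabs_ge0.
  by apply: ler_sum => j _; rewrite addSnnS.
have := ler_wpM2l a0 S.
rewrite -/G in G2 *; lra.
Qed.

End LocalBound.

Section LocalZeros.
Variables (R : realType) (n : nat).
Local Notation C := (cplx R).
Local Notation Re := (@complex.Re R).
Local Notation Im := (@complex.Im R).
Variables (P : 'M[{poly C}]_n) (d : {poly C}).
Implicit Types (z w u : C) (c : 'rV[C]_n) (v : 'cV[C]_n) (y : C -> 'cV[C]_n).

(** For a unit vector [io] this is the image under [z -> io * cexp z] of a half strip of width
    [pi]. *)
Definition half_disc (io : C) (r : R) : set C := [set u | cabs u < r /\ 0 < Re (u / io)].

Lemma sum_le_jet (F : nat -> C -> C) z N J : (N <= J)%N ->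
  \sum_(j < N) cabs (F j z) <= N%:R * jet J F z.
Proof.
move=> NJ; have -> : N%:R * jet J F z = \sum_(j < N) jet J F z.
  by rewrite sumr_const card_ord mulr_natl.
by apply: ler_sum => j _; apply: cabs_le_jet; exact: leq_trans NJ.
Qed.

Lemma shifted_roots_ofR (ls : seq R) b :
  shifted_roots (map (@ofR R) ls) b = map (@ofR R) (shifted_roots ls b).
Proof.
elim: b => [//|b IH]; rewrite /= map_cat IH -!map_comp; congr (_ ++ _).
by apply: eq_map => l /=; rewrite ofRD ofR_nat.
Qed.

Lemma real_char_poly_roots (A : 'M[C]_n) : (forall a, eigenvalue A a -> a \is Num.real) ->
  exists2 ls : seq R, size ls = n & char_poly A = \prod_(l <- map (@ofR R) ls) ('X - l%:P).
Proof.
move=> Hreal; have [rs Hrs] := closed_field_poly_normal (char_poly A).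
have {}Hrs : char_poly A = \prod_(l <- rs) ('X - l%:P).
  by rewrite Hrs (monicP (char_poly_monic A)) scale1r.
have E : map (@ofR R) (map Re rs) = rs.
  rewrite -map_comp -[RHS]map_id; apply/eq_in_map => a ars /=.
  by apply: ofR_Re; apply: Hreal; rewrite eigenvalue_root_char Hrs root_prod_XsubC.
exists (map Re rs); last by rewrite E.
have := size_char_poly A; rewrite Hrs size_prod_XsubC size_map => -[//].
Qed.

Theorem local_zeros : d.[0] != 0 ->
  (forall a, eigenvalue (d.[0]^-1 *: map_mx (horner^~ 0) P) a -> a \is Num.real) ->
  exists (r0 : R) (B : nat), 0 < r0 /\ forall (io : C) (r : R) c y, cabs io = 1 -> 0 < r -> r <= r0 ->
    local_solution P d (half_disc io r) y ->
    (forall u, half_disc io r u -> (c *m y u) 0 0 = 0) \/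
    (forall us : seq C, uniq us -> (forall u, u \in us -> half_disc io r u /\ (c *m y u) 0 0 = 0) ->
      (size us <= B)%N).
Proof.
move=> d0 /real_char_poly_roots[ls0 sls0 Hchar].
have [n0|n0] := posnP n.
  exists 1, 0%N; split=> // io r c y _ _ _ _; left=> u _.
  rewrite mxE big1 // => i; move: (ltn_ord i); rewrite {2}n0 //.
have [N [e [g [L [g0 HL]]]]] := jet_span_divisible P d.
pose rts b := shifted_roots (map (@ofR R) ls0) b.
pose T b k := nablas P d (size (rts b)) k (nabla_subs P d 0 (rts b) 1%:M).
have HT b k : (e <= b)%N -> exists r a, [/\ 0 < r, 0 <= a & forall c v u, u != 0 -> cabs u < r -> d.[u] != 0 /\
    cabs (jet_value d c v (T b k) (size (rts b) + k) u) <=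
      a * cabs u ^+ (b - e) * \sum_(j < N) cabs (jet_value d c v (jet_mx P d j) j u)].
  move=> eb; have [U HU] := nabla_subs_divisible b 1%:M d0 Hchar.
  have [U' HU'] := nablas_divisible P d (size (rts b)) k b U.
  have span : in_jet_span P d (T b k).
    by apply/jet_span_nablas/jet_span_nabla_subs; exact: (jet_span_mx P d 0).
  rewrite /T /rts HU HU' in span *.
  exact: (jet_span_bound d0 (size (rts b) + k) g0 eb (HL b U' span)).
(* The first value of [b]: at least [e], and such that [J = b0 * n] is at least [N], so that the jet
   contains the generators [jet_mx j] for [j < N]. *)
pose b0 := (N + e)%N.
pose J := size (rts b0).
have NJ : (N <= J)%N.
  rewrite /J /rts size_shifted_roots size_map sls0 /b0.
  by apply: leq_trans (leq_addr e N) _; rewrite leq_pmulr.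
have [r1 [a1 [r10 a10 H1]]] := HT b0 0%N (leq_addl N e).
have [a2 a20 H2] := shift_ops_top (rts b0).
(* The operator of order [J] applied to [F] is at most [a1 * N] times the jet, and its lower order
   terms at most [a2 * J] times the jet. *)
pose K0 := a1 * N%:R + a2 * J%:R.
have K00 : 0 <= K0 by rewrite addr_ge0 // mulr_ge0.
(* The second value of [b], chosen after [K0] so that the decay rate [b - e] beats the growth of the
   jet, whose order remains [J]. *)
pose b := (e + (Num.trunc (K0 ^+ 2 + 5)).+1)%N.
have eb : (e <= b)%N by exact: leq_addr.
have Hbeta : K0 ^+ 2 + 5 <= (b - e)%N%:R.
  by rewrite /b addKn; apply/ltW/truncnS_gt.
have [r2 [a3 [r20 a30 H3]]] : exists r a, [/\ 0 < r, 0 <= a & forall i, (i < J.+1)%N ->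
   forall c v u, u != 0 -> cabs u < r -> d.[u] != 0 /\
    cabs (jet_value d c v (T b i) (size (rts b) + i) u) <=
      a * cabs u ^+ (b - e) * \sum_(j < N) cabs (jet_value d c v (jet_mx P d j) j u)].
  apply: (@uniform_bound R J.+1 (fun i r a => forall c v u, u != 0 -> cabs u < r -> d.[u] != 0 /\
    cabs (jet_value d c v (T b i) (size (rts b) + i) u) <=
      a * cabs u ^+ (b - e) * \sum_(j < N) cabs (jet_value d c v (jet_mx P d j) j u))).
    move=> i r r' a a' H rr aa c v u u0 ur; have [Hd Hi] := H c v u u0 (lt_le_trans ur rr).
    split=> //; apply: le_trans Hi _; apply: ler_wpM2r.
      by apply: sumr_ge0 => j _; exact: cabs_ge0.
    by apply: ler_wpM2r => //; rewrite exprn_ge0 // cabs_ge0.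
  by move=> i; exact: HT.
have C00 : 0 <= a3 * N%:R by rewrite mulr_ge0.
have [M0 [B HB]] := half_strip_zeros (pi / 2) J (shifted_roots ls0 b) K00 C00 Hbeta.
pose r0 := Num.min 1 (Num.min r1 (Num.min r2 (expR (- M0)))).
exists r0, B; split.
  by rewrite /r0 lt_min ltr01 /= lt_min r10 /= lt_min r20 expR_gt0.
move=> io r c y io1 rp; rewrite /r0 !le_min => /and4P[rr1 rr2 rr3 rr4] Hy.
have io0 : io != 0 by rewrite -cabs_gt0 io1.
(* As [io] has modulus 1, [cabs (io * cexp z) < r] means [Re z < - M]. *)
pose M := - ln r.
have MM0 : M0 <= M by rewrite /M lerNr -[X in _ <= X]expRK ler_ln ?posrE ?expR_gt0.
have inV z : half_strip (pi / 2) M z -> half_disc io r (io * cexp z).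
  rewrite /half_strip /half_disc /M /= opprK => -[z1 z2]; split.
    by rewrite cabsM io1 mul1r cabs_cexp -(lnK rp) ltr_expR.
  rewrite mulrAC mulfV // mul1r /=; apply: mulr_gt0; first exact: expR_gt0.
  by apply: cos_gt0_pihalf; rewrite -ltr_norml.
pose F := solution_family P d c y io.
have usmall z : half_strip (pi / 2) M z -> [/\ io * cexp z != 0, cabs (io * cexp z) < r, cabs (io * cexp z) = expR (Re z) & cabs (io * cexp z) <= 1].
  move=> /inV[ur up]; split=> //.
  - by apply/eqP => E; rewrite E mul0r ltxx in up.
  - by rewrite cabsM io1 mul1r cabs_cexp.
  - exact: le_trans (ltW ur) rr1.
have HF : jet_bounded (half_strip (pi / 2) M) J K0 F.
  split.
    move=> k z /inV Vz.
    exact: (@jet_value_derive R n P d _ y c (jet_mx P d k) k io z Hy Vz).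
  move=> z Sz; have [u0 ur uE u1] := usmall z Sz.
  have := H2 F 0%N z; rewrite add0n => HJ; apply: le_trans HJ _.
  have [du H1z] := H1 c (y (io * cexp z)) _ u0 (lt_le_trans ur rr2).
  rewrite (shift_ops_solution P c y (rts b0) 0 du).
  have S1 := sum_le_jet F z NJ.
  have S2 := sum_le_jet F z (leqnn J).
  rewrite /K0 mulrDl; apply: lerD; last first.
    by rewrite -mulrA; apply: ler_wpM2l.
  apply: le_trans H1z _; rewrite -[leRHS]mulrA; apply: ler_pM => //.
  - by rewrite mulr_ge0 // exprn_ge0 // cabs_ge0.
  - by apply: sumr_ge0 => j _; exact: cabs_ge0.
  - by rewrite -[leRHS]mulr1; apply: ler_wpM2l => //; rewrite exprn_ile1 // cabs_ge0.
have Hh i z : (i <= J)%N -> half_strip (pi / 2) M z ->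
    cabs (shift_ops [seq ofR l | l <- shifted_roots ls0 b] F i z) <=
    a3 * N%:R * expR ((b - e)%N%:R * Re z) * jet J F z.
  move=> iJ Sz; have [u0 ur uE u1] := usmall z Sz.
  have [du H3z] := H3 i iJ c (y (io * cexp z)) _ u0 (lt_le_trans ur rr3).
  rewrite -shifted_roots_ofR (shift_ops_solution P c y (rts b) i du).
  apply: le_trans H3z _; rewrite uE -expRM_natl.
  set q := expR _.
  have -> : a3 * N%:R * q * jet J F z = a3 * q * (N%:R * jet J F z) by ring.
  by apply: ler_wpM2l; [rewrite mulr_ge0 // expR_ge0|exact: sum_le_jet].
have F0 z : F 0%N z = (c *m y (io * cexp z)) 0 0.
  rewrite /F /solution_family /jet_value expr0 divr1 /jet_mx /=.
  by rewrite (_ : map_mx _ 1%:M = 1%:M) ?mulmx1 //; apply/matrixP => i j; rewrite !mxE hornerMn hornerC.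
have /choice[lg Hlg] : forall u, exists z, 0 < Re (u / io) ->
    [/\ cexp z = u / io, Re z = ln (cabs (u / io)) & `|Im z| < pi / 2].
  move=> u; have [up|] := pselect (0 < Re (u / io)).
    by have [z Hz] := cexp_surj up; exists z.
  by move=> np; exists 0.
have lgV u : half_disc io r u -> half_strip (pi / 2) M (lg u) /\ io * cexp (lg u) = u.
  move=> [ur up]; have [E1 E2 E3] := Hlg u up; split; last by rewrite E1 mulrCA mulfV // mulr1.
  split=> //; rewrite E2 cabsM cabsV io1 invr1 mulr1 /M opprK ltr_ln ?posrE //.
  by rewrite cabs_gt0; apply/eqP => E; rewrite E mul0r ltxx in up.
have [Hzero|Hcount] := HB M F MM0 HF Hh.
  by left=> u /lgV[Su Eu]; rewrite -{1}Eu -F0 Hzero.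
right=> us uus Hus.
rewrite -(size_map lg); apply: Hcount.
  rewrite map_inj_in_uniq // => u1 u2 /Hus[/lgV[_ E1] _] /Hus[/lgV[_ E2] _] E.
  by rewrite -E1 -E2 E.
move=> z /mapP[u /Hus[/lgV[Su Eu] cu] ->]; split=> //.
by rewrite F0 Eu.
Qed.

End LocalZeros.

Lemma expr_inv_sub (K : fieldType) (x : K) k i : x != 0 -> (i <= k)%N -> x ^+ k * x^-1 ^+ i = x ^+ (k - i).
Proof.
by move=> x0 ik; rewrite -[in LHS](subnK ik) exprD -mulrA exprVn mulfV ?mulr1 // expf_neq0.
Qed.

(** * Rational forms in local coordinates *)

Section RationalInterface.
Variable R : realType.
Local Notation C := (cplx R).
Implicit Types (f : {fraction {poly C}}) (a b p q : {poly C}) (s t u : C).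

Lemma rat_numE f : (frac (repr f)).1 = rat_num f * gcdp (frac (repr f)).1 (frac (repr f)).2.
Proof. by rewrite /rat_num divpK // dvdp_gcdl. Qed.

Lemma rat_denE f : (frac (repr f)).2 = rat_den f * gcdp (frac (repr f)).1 (frac (repr f)).2.
Proof. by rewrite /rat_den divpK // dvdp_gcdr. Qed.

Lemma rat_den_neq0 f : rat_den f != 0.
Proof.
have := denom_ratioP (repr f); apply: contraNneq => E.
by rewrite rat_denE E mul0r.
Qed.

Lemma rat_coprime f : coprimep (rat_num f) (rat_den f).
Proof. by apply: coprimep_div_gcd; rewrite denom_ratioP orbT. Qed.

Lemma tofrac_rat_den f : tofrac (rat_den f) * f = tofrac (rat_num f).
Proof.
have g0 : tofrac (gcdp (frac (repr f)).1 (frac (repr f)).2) != 0.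
  by rewrite tofrac_eq0 gcdp_eq0 negb_and denom_ratioP orbT.
apply: (mulfI g0); rewrite mulrA -!tofracM mulrC.
by rewrite [_ * rat_den f]mulrC -rat_denE [_ * rat_num f]mulrC -rat_numE mulrC frac_reprE.
Qed.

(** Any representation with a denominator not vanishing at [s] may replace the reduced one: by
    coprimality [rat_den f] does not vanish there either. *)
Lemma rat_evalE f a b s : b.[s] != 0 -> tofrac b * f = tofrac a -> rat_eval f s = a.[s] / b.[s].
Proof.
move=> bs E.
have /(congr1 (horner^~ s)) : b * rat_num f = a * rat_den f.
  apply/eqP; rewrite -tofrac_eq !tofracM -tofrac_rat_den -E; apply/eqP; ring.
rewrite !hornerM => H.
have ds : (rat_den f).[s] != 0.
  apply/eqP => d0; move: H; rewrite d0 mulr0 => /eqP; rewrite mulf_eq0 (negPf bs) /= => n0.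
  by have := coprimep_root (rat_coprime f) n0; rewrite d0 eqxx.
by rewrite /rat_eval; apply/eqP; rewrite eqr_div // mulrC H.
Qed.

Lemma simple_pole_denominator f s : (rat_pole_order f s <= 1)%N ->
  exists a b, b.[s] != 0 /\ tofrac (b * ('X - s%:P)) * f = tofrac a.
Proof.
rewrite /rat_pole_order => m1.
have [m [q]] := multiplicity_XsubC (rat_den f) s; rewrite rat_den_neq0 /= => qs E.
have m1' : (m <= 1)%N.
  apply: leq_trans m1; by rewrite (mup_geq s m (rat_den_neq0 f)) E dvdp_mull.
exists (rat_num f * ('X - s%:P) ^+ (1 - m)), q; split=> //.
rewrite [RHS]tofracM -tofrac_rat_den [RHS]mulrAC -[in RHS]tofracM; congr (tofrac _ * _).
by rewrite E -mulrA -exprD subnKC // expr1.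
Qed.

Lemma simple_pole_common (T : eqType) (l : seq T) (f : T -> {fraction {poly C}}) s :
  (forall x, x \in l -> (rat_pole_order (f x) s <= 1)%N) ->
  exists b, b.[s] != 0 /\ forall x, x \in l -> exists a, tofrac (b * ('X - s%:P)) * f x = tofrac a.
Proof.
elim: l => [|x l IH] H; first by exists 1; rewrite hornerC oner_neq0.
have [|b [bs Hb]] := IH; first by move=> y yl; apply: H; rewrite in_cons yl orbT.
have [a0 [b0 [b0s E0]]] := simple_pole_denominator (H x (mem_head _ _)).
exists (b * b0); split; first by rewrite hornerM mulf_neq0.
move=> y; rewrite in_cons => /orP[/eqP ->|/Hb[a E]].
  by exists (b * a0); rewrite -mulrA tofracM -mulrA E0 tofracM.
by exists (b0 * a); rewrite [b * b0]mulrC -mulrA tofracM -mulrA E tofracM.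
Qed.

Definition reverse_poly (k : nat) p : {poly C} := \sum_(i < size p) p`_i *: 'X^(k - i).

Lemma reverse_poly_eval k p u : (size p <= k.+1)%N -> u != 0 -> (reverse_poly k p).[u] = u ^+ k * p.[u^-1].
Proof.
move=> pk u0; rewrite /reverse_poly horner_sum (horner_coef p) mulr_sumr; apply: eq_bigr => i _.
rewrite hornerZ hornerXn mulrCA; congr (_ * _).
have ik : (i <= k)%N by rewrite -ltnS; exact: leq_trans (ltn_ord i) pk.
by rewrite expr_inv_sub.
Qed.

Lemma reverse_poly_neq0 k p : (size p <= k.+1)%N -> p != 0 -> reverse_poly k p != 0.
Proof.
move=> pk p0; apply/eqP => /(congr1 (fun q : {poly C} => q`_(k - (size p).-1))).
rewrite coef0 /reverse_poly coef_sum; case E : (size p) pk => [|m] pk.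
  by move/eqP: E; rewrite size_poly_eq0 (negPf p0).
rewrite big_ord_recr /= coefZ coefXn eqxx mulr1 big1 => [|i _].
  by rewrite add0r; apply/eqP; rewrite -[m]/(m.+1.-1) -E -lead_coefE lead_coef_eq0.
rewrite coefZ coefXn; case: eqP => [H|]; last by rewrite mulr0.
by have := ltn_ord i; lia.
Qed.

Lemma horner_inv_reverse k p : (size p <= k.+1)%N ->
  tofrac 'X^k * horner_inv p = tofrac (reverse_poly k p).
Proof.
move=> pk; have X0 : tofrac 'X != 0 :> {fraction {poly C}} by rewrite tofrac_eq0 polyX_eq0.
rewrite /horner_inv /reverse_poly rmorph_sum /=.
have inj0 : injective (fun c : C => tofrac c%:P).
  by move=> c1 c2 /eqP; rewrite tofrac_eq => /eqP/polyC_inj.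
rewrite (@horner_coef_wide _ (size p)); last by rewrite size_map_inj_poly ?polyC0 ?tofrac0.
rewrite mulr_sumr; apply: eq_bigr => i _.
rewrite coef_map_id0 ?polyC0 ?tofrac0 // -mul_polyC tofracM mulrCA; congr (_ * _).
have ik : (i <= k)%N by rewrite -ltnS; exact: leq_trans (ltn_ord i) pk.
by rewrite !tofracXn; exact: expr_inv_sub.
Qed.

(** [h] is a reversed denominator; off its zeros and off 0, no division by 0 enters either value. *)
Lemma rat_eval_pullback f : exists2 h : {poly C}, h != 0 & forall u, u != 0 -> h.[u] != 0 ->
  rat_eval (pullback_inv f) u = - (u ^+ 2)^-1 * rat_eval f u^-1.
Proof.
pose a := (frac (repr f)).1; pose b := (frac (repr f)).2.
have b0 : b != 0 by exact: denom_ratioP.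
pose k := (size a + size b)%N.
have ak : (size a <= k.+1)%N by rewrite /k; lia.
have bk : (size b <= k.+1)%N by rewrite /k; lia.
exists (reverse_poly k b); first exact: reverse_poly_neq0.
move=> u u0 hu.
have ib : b.[u^-1] != 0.
  by apply: contraNneq hu => E; rewrite reverse_poly_eval // E mulr0.
have X0 : tofrac 'X != 0 :> {fraction {poly C}} by rewrite tofrac_eq0 polyX_eq0.
have Hb := horner_inv_reverse bk; have Ha := horner_inv_reverse ak.
have hb0 : horner_inv b != 0.
  apply/eqP => E; move/eqP: Hb; rewrite E mulr0 eq_sym tofrac_eq0.
  exact/negP/reverse_poly_neq0.
have fE : rat_eval f u^-1 = a.[u^-1] / b.[u^-1] by apply: rat_evalE => //; exact: frac_reprE.
have E : tofrac (reverse_poly k b * 'X^2) * pullback_inv f = tofrac (- reverse_poly k a).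
  rewrite tofracM -Hb tofracN -Ha /pullback_inv -/a -/b (tofracXn 2 'X).
  rewrite mulNr mulrN -mulrA; congr (- _).
  rewrite -[in LHS]mulrA; congr (_ * _).
  have y0 : tofrac 'X ^+ 2 != 0 :> {fraction {poly C}} by rewrite expf_eq0 (negPf X0).
  rewrite -mulrA [X in _ * X]mulrC (divfK y0) mulrC.
  exact: divfK hb0 _.
rewrite (rat_evalE (_ : (reverse_poly k b * 'X^2).[u] != 0) E).
  rewrite fE hornerM hornerN hornerXn (reverse_poly_eval ak u0) (reverse_poly_eval bk u0).
  move: (a.[_]) (b.[_]) (u ^+ k) ib (expf_neq0 k u0) => a' b' u' b'0 u'0.
  by field; rewrite u0 b'0 u'0.
by rewrite hornerM hornerXn mulf_neq0 // expf_neq0.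
Qed.

End RationalInterface.

(** * The system in a coordinate centred at a point of the sphere *)

Section LocalSystem.
Variables (R : realType) (n : nat).
Local Notation C := (cplx R).
Local Notation P1 := (CP1 R).
Implicit Types (Omega : rat_form R n) (p : P1) (U : set P1) (x : P1 -> 'cV[C]_n) (s t u : C).

Definition chart_at p u : P1 := chart p (local_coord p + u).

Lemma entry_pole_order Omega p i j :
  (rat_pole_order (coef Omega p i j) (local_coord p) <= pole_order Omega p)%N.
Proof.
rewrite /pole_order; apply: leq_trans (leq_bigmax i).
exact: (leq_bigmax (F := fun j => rat_pole_order (coef Omega p i j) (local_coord p)) j).
Qed.

Lemma coef_at_simple_pole Omega p : (pole_order Omega p <= 1)%N ->
  exists (P : 'M[{poly C}]_n) (d : {poly C}), [/\ d.[0] != 0,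
    residue Omega p = d.[0]^-1 *: map_mx (horner^~ 0) P &
    forall i j u, u != 0 -> d.[u] != 0 ->
      rat_eval (coef Omega p i j) (local_coord p + u) = (u * d.[u])^-1 * (P i j).[u]].
Proof.
move=> pole1; set s0 := local_coord p.
have [|b [bs Hb]] := @simple_pole_common R _ (enum {: 'I_n * 'I_n}) (fun q => coef Omega p q.1 q.2) s0.
  by move=> q _; apply: leq_trans pole1; exact: entry_pole_order.
have H (i j : 'I_n) : exists a, tofrac (b * ('X - s0%:P)) * coef Omega p i j == tofrac a.
  by have [|a /eqP] := Hb (i, j); rewrite ?mem_enum //; exists a.
pose Q i j : {poly C} := xchoose (H i j).
have HQ i j : tofrac (b * ('X - s0%:P)) * coef Omega p i j = tofrac (Q i j).
  exact/eqP/(xchooseP (H i j)).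
pose tr (q : {poly C}) : {poly C} := q \Po ('X + s0%:P).
have trE q u : (tr q).[u] = q.[s0 + u] by rewrite horner_comp !hornerE addrC.
exists (\matrix_(i, j) tr (Q i j)), (tr b); split.
- by rewrite trE addr0.
- apply/matrixP => i j; rewrite !mxE !trE addr0 [RHS]mulrC.
  apply: (@rat_evalE R (coef Omega p i j * tofrac ('X - s0%:P)) (Q i j) b s0 bs).
  by rewrite -HQ tofracM mulrA mulrAC.
- move=> i j u u0; rewrite trE => bu.
  have E : (b * ('X - s0%:P)).[s0 + u] = u * b.[s0 + u] by rewrite !hornerE; ring.
  rewrite (rat_evalE (_ : (b * ('X - s0%:P)).[s0 + u] != 0) (HQ i j)); last by rewrite E mulf_neq0.
  by rewrite E mxE trE mulrC.
Qed.

(** The product of the finitely many exceptional polynomials has, near 0, no zero except possibly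
    0. *)
Lemma pullback_coef Omega : exists2 r : R, 0 < r & forall i j u, u != 0 -> cabs u < r ->
  rat_eval (pullback_inv (Omega i j)) u = - (u ^+ 2)^-1 * rat_eval (Omega i j) u^-1.
Proof.
have /choice[h Hh] : forall q : 'I_n * 'I_n, exists h : {poly C}, h != 0 /\ forall u, u != 0 -> h.[u] != 0 ->
    rat_eval (pullback_inv (Omega q.1 q.2)) u = - (u ^+ 2)^-1 * rat_eval (Omega q.1 q.2) u^-1.
  by move=> q; have [h h0 Hh] := rat_eval_pullback (Omega q.1 q.2); exists h.
pose g := \prod_q h q.
have g0 : g != 0 by rewrite prodf_seq_neq0; apply/allP => q _; have [] := Hh q.
have [m [q qr gE]] := multiplicity_XsubC g 0; rewrite g0 /= in qr.
have [r [a [r0 _ Hr]]] := poly_quotient_bounded 0 qr.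
exists r => // i j u u0 ur; have [qu _] := Hr u ur.
have [_ Hij] := Hh (i, j); apply: Hij => //.
have : g.[u] != 0 by rewrite gE subr0 hornerM hornerXn mulf_neq0 // expf_neq0.
by apply: contraNneq => E; rewrite /g horner_prod (bigD1 (i, j)) //= E mul0r.
Qed.

(** [solution] uses the coordinate [t] at all finite points, also near infinity. There the chain
    rule for [1 / u] produces the factor [- u^-2] carried by [pullback_inv]. *)
Lemma local_system Omega p : (pole_order Omega p <= 1)%N ->
  exists (P : 'M[{poly C}]_n) (d : {poly C}) (r : R), [/\ d.[0] != 0, 0 < r,
    residue Omega p = d.[0]^-1 *: map_mx (horner^~ 0) P &
    forall U x (V : set C), solution Omega U x ->
      (forall u, V u -> [/\ u != 0, cabs u < r & U (chart_at p u)]) ->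
      local_solution P d V (fun u => x (chart_at p u))].
Proof.
move=> pole1; have [P [d [d0 resE HE]]] := coef_at_simple_pole pole1.
have [r1 [_a [r10 _ Hr1]]] := poly_quotient_bounded 0 d0.
have [r2 r20 Hr2] := pullback_coef Omega.
exists P, d, (Num.min r1 r2); split=> //; first by rewrite lt_min r10.
move=> U x V sol HV u /HV[u0]; rewrite lt_min => /andP[ur1 ur2] Uu.
have [du _] := Hr1 u ur1; split=> // i.
have rhsE : (u * d.[u])^-1 * (map_mx (horner^~ u) P *m x (chart_at p u)) i 0 =
    (map_mx (@rat_eval R ^~ (local_coord p + u)) (coef Omega p) *m x (chart_at p u)) i 0.
  rewrite !mxE mulr_sumr; apply: eq_bigr => j _.
  by rewrite mulrA [in RHS]mxE HE // mxE.
rewrite rhsE; case: p pole1 resE HE HV Uu rhsE => [t|] pole1 resE HE HV Uu rhsE.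
  have D1 : is_derive u 1 (fun s : C => t + s) 1.
    apply: (is_derive_eq (is_derive_add (is_derive_cst t u (1 : C)) (is_derive_id u (1 : C)))).
    by rewrite add0r.
  have := @is_derive_chain C (fun s => x (Some s) i 0) (fun s => t + s) u _ _ (sol (Some (t + u)) Uu i) D1.
  by rewrite mulr1.
have chE s : s != 0 -> chart_at None s = Some s^-1 by move=> s0; rewrite /chart_at /= add0r (negPf s0).
rewrite (chE u u0) in Uu rhsE *.
have D := @is_derive_chain C (fun s => x (Some s) i 0) (fun s => s^-1) u _ _
  (sol (Some u^-1) Uu i) (is_derive_inv u0).
have e0 : 0 < ofR (cabs u) by rewrite -ofR0 lt_ofR cabs_gt0.
apply: (is_derive_near e0 _ (is_derive_eq D _)).
  move=> h; rewrite cabsE lt_ofR => hu; rewrite chE //.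
  apply/eqP => E; move: hu; have -> : h = - u by rewrite -[h](addKr u) E addr0.
  by rewrite cabsN ltxx.
rewrite /= !mxE mulr_suml; apply: eq_bigr => j _.
by rewrite !mxE add0r Hr2 // mulrAC; ring.
Qed.

Theorem zeros_near_point Omega p : (pole_order Omega p <= 1)%N ->
  (forall a : C, eigenvalue (residue Omega p) a -> a \is Num.real) ->
  exists (r0 : R) (B : nat), 0 < r0 /\ forall (io : C) (r : R) U x (c : 'rV[C]_n), cabs io = 1 -> 0 < r -> r <= r0 ->
    solution Omega U x -> (forall u, half_disc io r u -> U (chart_at p u)) ->
    (forall u, half_disc io r u -> \sum_(j < n) c 0 j * x (chart_at p u) j 0 = 0) \/
    (forall us : seq C, uniq us ->
      (forall u, u \in us -> half_disc io r u /\ \sum_(j < n) c 0 j * x (chart_at p u) j 0 = 0) ->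
      (size us <= B)%N).
Proof.
move=> pole1 Hreal; have [P [d [r1 [d0 r10 resE HP]]]] := local_system pole1.
have Hreal' a : eigenvalue (d.[0]^-1 *: map_mx (horner^~ 0) P) a -> a \is Num.real.
  by rewrite -resE; exact: Hreal.
have [r2 [B [r20 HB]]] := local_zeros d0 Hreal'.
exists (Num.min r1 r2), B; split; first by rewrite lt_min r10.
move=> io r U x c io1 r0; rewrite le_min => /andP[rr1 rr2] sol HU.
have [|H|H] := HB io r c (fun u => x (chart_at p u)) io1 r0 rr2.
- apply: (HP U x _ sol) => u Hu; have [ur up] := Hu; split; last exact: HU.
    by apply/eqP => E; rewrite E mul0r ltxx in up.
  exact: lt_le_trans rr1.
- by left=> u /H; rewrite mxE.
- by right=> us uus Hus; apply: H => // u /Hus[? E]; split=> //; rewrite mxE.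
Qed.

End LocalSystem.

(** * Discs and half discs on the sphere *)

Section PlaneTopology.
Variable R : realType.
Local Notation C := (cplx R).
Local Notation P1 := (CP1 R).
Local Notation Re := (@complex.Re R).
Local Notation Im := (@complex.Im R).
Implicit Types (z w u : C) (p : P1) (K V : set C).

Lemma nbhs_cabsP z (N : set C) : nbhs z N <-> exists2 r : R, 0 < r & forall w, cabs (w - z) < r -> N w.
Proof.
split=> [/nbhs_ballP[e /= e0 He]|[r r0 Hr]].
  have er : e \is Num.real by exact: gtr0_real.
  exists (Re e); first by rewrite -lt_ofR ofR0 ofR_Re.
  move=> w wz; apply: He; rewrite /ball /= distrC cabsE -(ofR_Re er) lt_ofR //.
apply/nbhs_ballP; exists (ofR r); first by rewrite /= -ofR0 lt_ofR.
by move=> w; rewrite /ball /= distrC cabsE lt_ofR => /Hr.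
Qed.

Lemma cvg_cabsP (T : Type) (F : set_system T) (f : T -> C) z : Filter F ->
  (forall e : R, 0 < e -> \forall x \near F, cabs (f x - z) < e) -> f @ F --> z.
Proof.
move=> FF H N /nbhs_cabsP[r r0 Hr].
by apply: filterS (H r r0) => x Hx; exact: Hr.
Qed.

Lemma cvg_near_dist (f : C -> R) z :
  (forall e, 0 < e -> exists2 d : R, 0 < d & forall w, cabs (w - z) < d -> `|f z - f w| < e) ->
  f @ z --> f z.
Proof.
move=> H N /nbhs_ballP[e /= e0 He]; have [d d0 Hd] := H e e0.
by apply/nbhs_cabsP; exists d => // w wz; apply: He; exact: Hd.
Qed.

Lemma continuous_cabs : continuous (@cabs R : C -> R).
Proof.
move=> z; apply: cvg_near_dist => e e0; exists e => // w H.
apply: le_lt_trans H; rewrite ler_norml; apply/andP; split.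
  have := cabsD (w - z) z; rewrite subrK; lra.
have := cabsD (z - w) w; rewrite subrK cabs_distC; lra.
Qed.

Lemma continuous_Re_mul w : continuous (fun z => Re (z * w)).
Proof.
move=> z; apply: cvg_near_dist => e e0.
have w0 : 0 < cabs w + 1 by rewrite ltr_wpDl // cabs_ge0.
exists (e / (cabs w + 1)) => [|y H]; first by rewrite divr_gt0.
rewrite distrC -cReB -mulrBl; apply: le_lt_trans (Re_le_cabs _) _; rewrite cabsM.
move: H; rewrite ltr_pdivlMr // => H.
by apply: le_lt_trans H; apply: ler_wpM2l; [exact: cabs_ge0|rewrite lerDl].
Qed.

Lemma closed_disc_compact (r : R) : compact [set z : C | cabs z <= r].
Proof.
pose f (q : R * R) : C := Complex q.1 q.2.
have cf : continuous f.
  move=> q; apply: cvg_cabsP => e e0; near=> y.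
  have H1 : `|q.1 - y.1| < e / 2.
    near: y; have /cvgrPdist_lt H : (fun y : R * R => y.1) @ q --> q.1 by exact: cvg_fst.
    by apply: H; lra.
  have H2 : `|q.2 - y.2| < e / 2.
    near: y; have /cvgrPdist_lt H : (fun y : R * R => y.2) @ q --> q.2 by exact: cvg_snd.
    by apply: H; lra.
  apply: le_lt_trans (cabs_le_ReIm _) _; rewrite cReB cImB /=.
  by rewrite [`|y.1 - _|]distrC [`|y.2 - _|]distrC; lra.
have cs : compact (f @` (`[- r, r] `*` `[- r, r])).
  apply: continuous_compact; first exact: continuous_subspaceT.
  by apply: compact_setX; exact: segment_compact.
apply: subclosed_compact cs _.
  have -> : [set z : C | cabs z <= r] = @cabs R @^-1` [set x | x <= r] by [].
  by apply: closed_comp; [move=> z _; exact: continuous_cabs|exact: closed_le].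
move=> z /= zr; exists (Re z, Im z); last by rewrite /f; case: z {zr}.
by split=> /=; rewrite in_itv /= -ler_norml; apply: le_trans zr; [exact: Re_le_cabs|exact: Im_le_cabs].
Unshelve. all: by end_near. Qed.

Lemma compact_cabs_bounded K : compact K -> exists r : R, forall z, K z -> cabs z <= r.
Proof.
move=> cK; have : compact (@cabs R @` K).
  by apply: continuous_compact cK; apply: continuous_subspaceT; exact: continuous_cabs.
move=> /compact_bounded[M [_ HM]]; exists (M + 1) => z Kz.
have M1 : M < M + 1 by rewrite ltrDl.
by have := HM _ M1 (cabs z) (ex_intro2 _ _ z Kz erefl); rewrite /= ger0_norm ?cabs_ge0.
Qed.

Lemma plane_hausdorff : hausdorff_space C.
Proof.
move=> z w H; apply/eqP; rewrite -subr_eq0 -cabs_eq0 eq_le cabs_ge0 andbT leNgt; apply/negP => d0.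
have d20 : 0 < cabs (z - w) / 2 by lra.
have [] := H [set y | cabs (y - z) < cabs (z - w) / 2] [set y | cabs (y - w) < cabs (z - w) / 2].
- by apply/nbhs_cabsP; exists (cabs (z - w) / 2).
- by apply/nbhs_cabsP; exists (cabs (z - w) / 2).
move=> y [/= y1 y2]; have := cabsD (z - y) (y - w); rewrite addrA subrK [cabs (z - y)]cabs_distC; lra.
Qed.

Lemma closed_disc_closed (r : R) : closed [set z : C | cabs z <= r].
Proof. exact: compact_closed plane_hausdorff (closed_disc_compact (r := r)). Qed.

Lemma CP1_hausdorff : hausdorff_space P1.
Proof.
apply: one_point_compactification_hausdorff; last exact: plane_hausdorff.
move=> z _; exists [set w | cabs w <= cabs z + 1].
  rewrite withinET; apply/nbhs_cabsP; exists 1 => // w wz /=.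
  by have := cabsD (w - z) z; rewrite subrK; lra.
by split; [exact: closed_disc_compact|exact: closed_disc_closed].
Qed.

Lemma continuous_inv_plane z : z != 0 -> {for z, continuous (fun w : C => w^-1)}.
Proof.
move=> z0; have [D _] := is_derive_inv z0.
exact/differentiable_continuous/derivable1_diffP.
Qed.

Lemma chart_at_inj p : injective (chart_at p).
Proof.
case: p => [t|] u w; first by rewrite /chart_at /= => -[/addrI].
rewrite /chart_at /= !add0r; case: eqVneq => [->|u0]; case: eqVneq => [->|w0] //.
by case=> /invr_inj.
Qed.

Lemma nbhs_infinity (N : set P1) : nbhs (None : P1) N <->
  N None /\ exists r : R, forall z, r < cabs z -> N (Some z).
Proof.
split=> [[K [cK _] HK]|[N0 [r Hr]]].
  split; first by apply: HK; right.
  have [r Hr] := compact_cabs_bounded cK; exists r => z rz; apply: HK; left; exists z => //.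
  by move=> /Hr; rewrite leNgt rz.
exists [set z | cabs z <= r].
  by split; [exact: closed_disc_compact|exact: closed_disc_closed].
move=> _ [[z /= /negP zr <-]|->//]; apply: Hr; by rewrite ltNge.
Qed.

Lemma chart_at_continuous p : continuous (chart_at p).
Proof.
case: p => [t|] z.
  apply: (@continuous_comp _ _ _ (fun u : C => t + u) (Some : C -> P1)).
    move=> N /nbhs_cabsP[r r0 Hr]; apply/nbhs_cabsP; exists r => // w wz.
    by apply: Hr; rewrite [t + w]addrC addrKA.
  exact: one_point_compactification_some_continuous.
have [->|z0] := eqVneq z 0.
  move=> N; rewrite {1}/chart_at /= add0r eqxx => /nbhs_infinity[N0 [r Hr]].
  have r0 : 0 < `|r| + 1 by rewrite ltr_wpDl.
  apply/nbhs_cabsP; exists (`|r| + 1)^-1; first by rewrite invr_gt0.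
  move=> w; rewrite subr0 /= /chart_at /= add0r => wr; case: eqVneq => // w0.
  apply: Hr; rewrite cabsV; apply: le_lt_trans (ler_norm r) _.
  apply: (@lt_trans _ _ (`|r| + 1)); first by rewrite ltrDl.
  by rewrite -[ltLHS]invrK ltf_pV2 // posrE ?invr_gt0 // cabs_gt0.
have E : \forall w \near z, Some w^-1 = chart_at None w.
  apply/nbhs_cabsP; exists (cabs z); first by rewrite cabs_gt0.
  move=> w wz; rewrite /chart_at /= add0r; case: eqVneq => // w0.
  by move: wz; rewrite w0 sub0r cabsN ltxx.
have H : (fun w : C => Some w^-1 : P1) @ z --> (Some z^-1 : P1).
  apply: (@continuous_comp _ _ _ (fun u : C => u^-1) (Some : C -> P1)).
    exact: continuous_inv_plane.
  exact: one_point_compactification_some_continuous.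
rewrite /continuous_at; have -> : chart_at None z = Some z^-1 by rewrite /chart_at /= add0r (negPf z0).
move=> N HN; apply: (@filterS2 _ (nbhs z) (nbhs_filter z) _ _ _ _ E (H N HN)) => w e.
by rewrite /= e.
Qed.

(** With continuity and injectivity this makes [chart_at p] an open embedding, infinity included. *)
Lemma chart_at_open p z (N : set C) : nbhs z N -> nbhs (chart_at p z) (chart_at p @` N).
Proof.
case: p => [t|] /nbhs_cabsP[r r0 Hr].
  apply: (@filterS _ _ _ (Some @` [set w | cabs (w - (t + z)) < r])).
    move=> _ [w /= wr <-]; exists (w - t); last by rewrite /chart_at /= addrC subrK.
    by apply: Hr; rewrite -addrA -opprD.
  by apply: one_point_compactification_some_nbhs; apply/nbhs_cabsP; exists r.
have [z0|z0] := eqVneq z 0.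
  rewrite z0 {1}/chart_at /= add0r eqxx; apply/nbhs_infinity; split.
    by exists 0; [apply: Hr; rewrite z0 subrr cabs0|rewrite /chart_at /= add0r eqxx].
  exists r^-1 => w wr; have w0 : w != 0.
    by rewrite -cabs_gt0; apply: lt_trans wr; rewrite invr_gt0.
  exists w^-1; last by rewrite /chart_at /= add0r invr_eq0 (negPf w0) invrK.
  apply: Hr; rewrite z0 subr0 cabsV -[ltRHS]invrK ltf_pV2 ?posrE ?invr_gt0 // cabs_gt0 //.
have -> : chart_at None z = Some z^-1 by rewrite /chart_at /= add0r (negPf z0).
have zi0 : z^-1 != 0 by rewrite invr_eq0.
have Hc : (fun w : C => w^-1) @ z^-1 --> z.
  have H := continuous_inv_plane zi0.
  by move=> M Mz; apply: H; rewrite /= invrK.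
have HN : nbhs z (N `&` [set w | w != 0]).
  apply: filterI; first by apply/nbhs_cabsP; exists r.
  apply/nbhs_cabsP; exists (cabs z); first by rewrite cabs_gt0.
  by move=> w wz; apply/eqP => w0; move: wz; rewrite w0 sub0r cabsN ltxx.
have K : nbhs (Some z^-1 : P1) (Some @` [set v : C | N v^-1 /\ v^-1 != 0]).
  by apply: one_point_compactification_some_nbhs; exact: Hc _ HN.
apply: (@filterS _ (nbhs (Some z^-1 : P1)) (nbhs_filter _) _ _ _ K) => _ [w [/= Nw w0] <-]; exists w^-1 => //.
by rewrite /chart_at /= add0r (negPf w0) invrK.
Qed.

End PlaneTopology.

(** * Images of convex sets are simply connected *)

Section ConvexImages.
Variable R : realType.
Local Notation C := (cplx R).
Local Notation P1 := (CP1 R).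
Implicit Types (z w u : C) (p : P1) (V : set C).

Lemma chart_at_image_open p V : open V -> open (chart_at p @` V).
Proof.
move=> Vo; rewrite openE => _ [z Vz <-].
by apply: chart_at_open; exact: open_nbhs_nbhs.
Qed.

Lemma segment_path_continuous z w : continuous (fun t : R => z + ofR t * w : C).
Proof.
move=> t N /nbhs_cabsP[r r0 Hr].
have w0 : 0 < cabs w + 1 by rewrite ltr_wpDl // cabs_ge0.
apply/nbhs_ballP; exists (r / (cabs w + 1)); first by rewrite /= divr_gt0.
move=> s; rewrite /ball /= distrC ltr_pdivlMr // => H; apply: Hr.
rewrite [z + _]addrC addrKA -mulrBl -ofRB cabsM cabs_real.
by apply: le_lt_trans H; apply: ler_wpM2l => //; rewrite lerDl.
Qed.

Lemma chart_at_convex_connected p V : convex_region V -> connected (chart_at p @` V).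
Proof.
move=> Vc; have [[z0 Vz0]|V0] := pselect (V !=set0); last first.
  rewrite (_ : V = set0) ?image_set0; first exact: connected0.
  by apply/seteqP; split=> // z Vz; case: V0; exists z.
pose S z := (fun t : R => chart_at p (z0 + ofR t * (z - z0))) @` `[0, 1].
have -> : chart_at p @` V = \bigcup_(z in V) S z.
  apply/seteqP; split=> [_ [z Vz <-]|_ [z Vz [t t01 <-]]].
    exists z => //; exists 1; first by rewrite /= in_itv /= ler01 lexx.
    by rewrite ofR1 mul1r [z - _]addrC addNKr.
  move: t01; rewrite /= in_itv /= => t01; exists (z0 + ofR t * (z - z0)) => //; exact: Vc.
apply: bigcup_connected.
  exists (chart_at p z0) => z Vz; exists 0; first by rewrite /= in_itv /= ler01 lexx.
  by rewrite ofR0 mul0r addr0.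
move=> z Vz; apply: connected_continuous_connected; first exact: segment_connected.
apply: continuous_subspaceT => t N /chart_at_continuous HN.
exact: (@segment_path_continuous z0 (z - z0) t _ HN).
Qed.

Lemma chart_at_lift p V (g : R -> P1) : {within `[0, 1], continuous g} -> g @` `[0, 1] `<=` chart_at p @` V ->
  exists2 k : R -> C, forall t : R, 0 <= t <= 1 -> V (k t) /\ chart_at p (k t) = g t &
    forall t : R, 0 <= t <= 1 -> forall e : R, 0 < e -> \forall s \near t, 0 <= s <= 1 -> cabs (k s - k t) < e.
Proof.
move=> gc gV.
have : forall t, exists z : C, 0 <= t <= 1 -> V z /\ chart_at p z = g t.
  move=> t; have [t01|] := boolP (0 <= t <= 1); last by exists 0.
  have [|z Vz E] := gV (g t); first by exists t => //=; rewrite in_itv.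
  by exists z.
move/choice => [k Hk]; exists k => // t t01 e e0.
have [Vt Et] := Hk t t01.
have H : nbhs (g t) (chart_at p @` [set w | cabs (w - k t) < e]).
  by rewrite -Et; apply: chart_at_open; apply/nbhs_cabsP; exists e.
have /subspace_continuousP := gc; move=> /(_ t); rewrite /= in_itv /= => /(_ t01 _ H) /=.
move=> K; apply: (@filterS _ (nbhs t) (nbhs_filter t) _ _ _ K) => s Hs s01.
have := Hs; rewrite /= in_itv /= => /(_ s01) [w /= wt].
by move=> E; rewrite -(chart_at_inj (etrans E (esym (Hk s s01).2))).
Qed.

(** The loop is lifted to the coordinate and contracted along straight lines to its base point. *)
Lemma chart_at_simply_connected p V : convex_region V -> simply_connected (chart_at p @` V).
Proof.
move=> Vc; split; first exact: chart_at_convex_connected.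
move=> g [gc g01 gV]; have [k Hk kc] := chart_at_lift gc gV.
have O01 : 0 <= (0 : R) <= 1 by rewrite ler01 lexx.
have I01 : 0 <= (1 : R) <= 1 by rewrite ler01 lexx.
exists (fun q => chart_at p (k q.1 + ofR q.2 * (k 0 - k q.1))), (chart_at p (k 0)); split.
- apply/subspace_continuousP => -[u0 v0] /= [].
  rewrite /= !in_itv /= => u01 v01.
  pose G (q : R * R) := k q.1 + ofR q.2 * (k 0 - k q.1).
  suff HG : G @ within (`[0, 1] `*` `[0, 1]) (nbhs (u0, v0)) --> G (u0, v0).
    by move=> N /(@chart_at_continuous R p) /HG.
  apply: cvg_cabsP => e e0; rewrite /within /=.
  have M0 : 0 < cabs (k 0 - k u0) + 1 by rewrite ltr_wpDl // cabs_ge0.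
  exists ([set u | 0 <= u <= 1 -> cabs (k u - k u0) < e / 2],
          [set v | `|v - v0| < e / 2 / (cabs (k 0 - k u0) + 1)]).
    split=> /=; first by apply: kc => //; lra.
    apply/nbhs_ballP; exists (e / 2 / (cabs (k 0 - k u0) + 1)); first by rewrite /= !divr_gt0.
    by move=> v; rewrite /ball /= distrC.
  move=> [u v] [/= Hu Hv] []; rewrite /= !in_itv /= => u1 v1.
  have -> : G (u, v) - G (u0, v0) =
      ofR (1 - v) * (k u - k u0) + ofR (v - v0) * (k 0 - k u0).
    by rewrite /G /= !ofRB ofR1; ring.
  apply: le_lt_trans (cabsD _ _) _; rewrite !cabsM !cabs_real.
  have := Hu u1; move: Hv; rewrite ltr_pdivlMr // => Hv {}Hu.
  have A : `|1 - v| * cabs (k u - k u0) <= cabs (k u - k u0).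
    by rewrite ler_piMl ?cabs_ge0 // ger0_norm; lra.
  have B : `|v - v0| * cabs (k 0 - k u0) <= `|v - v0| * (cabs (k 0 - k u0) + 1).
    by apply: ler_wpM2l => //; rewrite lerDl.
  by lra.
- move=> _ [[u v] [u01 v01] <-]; move: u01 v01; rewrite /= !in_itv /= => u01 v01.
  exists (k u + ofR v * (k 0 - k u)) => //.
  by apply: Vc => //; [exact: (Hk u u01).1|exact: (Hk 0 O01).1].
- move=> u u01 /=; rewrite ofR0 ofR1 mul0r mul1r addr0 [k 0 - _]addrC addNKr.
  by split=> //; exact: (Hk u u01).2.
- move=> v v01 /=; suff -> : k 1 = k 0 by [].
  by apply: (@chart_at_inj R p); rewrite (Hk 0 O01).2 (Hk 1 I01).2.
Qed.

End ConvexImages.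

(** * Closures, frontiers and edges in a chart *)

Section DiscImages.
Variable R : realType.
Local Notation C := (cplx R).
Local Notation P1 := (CP1 R).
Local Notation Re := (@complex.Re R).
Local Notation Im := (@complex.Im R).
Implicit Types (z w u : C) (p : P1) (V W : set C).

(** Boundedness makes the closure of [V] compact, so its image is compact, hence closed in the
    sphere. *)
Lemma chart_at_closure p V (r : R) : (forall z, V z -> cabs z <= r) ->
  closure (chart_at p @` V) = chart_at p @` closure V.
Proof.
move=> Vr; apply/seteqP; split; last first.
  move=> _ [z Vz <-] N /chart_at_continuous /Vz [w [Vw Nw]].
  by exists (chart_at p w); split=> //; exists w.
have cV : compact (closure V).
  apply: subclosed_compact (closed_disc_compact (r := r)) _; first exact: closed_closure.
  rewrite (closure_id [set z : C | cabs z <= r]).1; last exact: closed_disc_closed.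
  exact: closure_subset.
have cI : closed (chart_at p @` closure V).
  apply: compact_closed; first exact: CP1_hausdorff.
  apply: continuous_compact cV; apply: continuous_subspaceT; exact: chart_at_continuous.
rewrite [X in _ `<=` X](closure_id _).1 //; apply: closure_subset.
by apply: image_subset; exact: subset_closure.
Qed.

(** Arbitrarily small moves towards [z0] bring any point of [W] into [V], so [W] is the closure of
    [V]. *)
Lemma chart_at_frontier p V W (r : R) z0 : open V -> (forall z, V z -> cabs z <= r) -> closed W -> V `<=` W ->
  (forall z (t : R), W z -> 0 < t <= 1 -> V (z + ofR t * (z0 - z))) ->
  closure (chart_at p @` V) `\` interior (chart_at p @` V) = chart_at p @` (W `\` V).
Proof.
move=> Vo Vr Wc VW HW.
have -> : interior (chart_at p @` V) = chart_at p @` V.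
  by apply/interior_id; exact: chart_at_image_open.
rewrite (chart_at_closure _ Vr).
have -> : closure V = W.
  apply/seteqP; split.
    by rewrite [X in _ `<=` X](closure_id _).1 //; exact: closure_subset.
  move=> z Wz N Nz.
  have : nbhs (0 : R) ((fun t : R => z + ofR t * (z0 - z)) @^-1` N).
    by apply: segment_path_continuous; rewrite ofR0 mul0r addr0.
  move=> /nbhs_ballP[d /= d0 Hd]; exists (z + ofR (Num.min (d / 2) 1) * (z0 - z)).
  have m0 : 0 < Num.min (d / 2) 1 <= 1 by rewrite lt_min ltr01 divr_gt0 //= ge_min lexx orbT.
  split; first exact: HW.
  apply: (Hd (Num.min (d / 2) 1)); rewrite /ball /= sub0r normrN ger0_norm; last by case/andP: m0 => /ltW.
  by rewrite gt_min ltr_pdivrMr // ltr_pMr // ltr1n.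
apply/seteqP; split=> [_ [[z Wz <-] nV]|_ [z [Wz nV] <-]].
  by exists z => //; split=> // Vz; apply: nV; exists z.
by split; [exists z|move=> [w Vw /chart_at_inj wz]; apply: nV; rewrite -wz].
Qed.

Definition cis (a : R) : C := Complex (cos a) (sin a).

Lemma cisD a b : cis (a + b) = cis a * cis b.
Proof.
rewrite /cis cosD sinD; apply/eqP; rewrite eq_complex /=.
by apply/andP; split; apply/eqP; ring.
Qed.

Lemma cabs_cis a : cabs (cis a) = 1.
Proof.
by apply/eqP; rewrite -(eqrXn2 (n := 2)) ?cabs_ge0 // cabs_sqr /= cos2Dsin2 expr1n.
Qed.

Lemma cisN a : cis (- a) = (cis a)^-1.
Proof.
have n0 : cis a != 0 by rewrite -cabs_gt0 cabs_cis ltr01.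
apply: (mulfI n0); rewrite divff // -cisD subrr /cis cos0 sin0 //.
Qed.

Lemma cis_half_circle w : cabs w = 1 -> 0 <= Re w -> exists2 a, - (pi / 2) <= a <= pi / 2 & w = cis a.
Proof.
move=> w1; rewrite le_eqVlt => /orP[/eqP Re0|Rew].
  have : Im w ^+ 2 == 1 by have := cabs_sqr w; rewrite w1 -Re0 expr0n add0r expr1n => <-.
  have pi0 := pi_gt0 R.
  rewrite sqrf_eq1 => /orP[] /eqP Imw.
    exists (pi / 2); first by apply/andP; split; lra.
    by case: w w1 Re0 Imw => x y _ /= <- ->; rewrite /cis cos_pihalf sin_pihalf.
  exists (- (pi / 2)); first by apply/andP; split; lra.
  by case: w w1 Re0 Imw => x y _ /= <- ->; rewrite /cis cosN sinN cos_pihalf sin_pihalf.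
have [z [zw Rez]] := cexp_surj Rew; rewrite ltr_norml => /andP[z1 z2].
exists (Im z); first by rewrite !ltW.
rewrite -zw /cexp Rez w1 ln1 expR0 /cis; by rewrite ?mul1r ?ofR1 ?mul1r.
Qed.

Lemma cis_circle w : cabs w = 1 -> exists2 a, - (pi / 2) <= a <= pi / 2 + pi & w = cis a.
Proof.
move=> w1; have pi0 := pi_gt0 R; have [Re0|Re0] := leP 0 (Re w).
  have [a /andP[a1 a2] ->] := cis_half_circle w1 Re0; exists a => //; apply/andP; split; lra.
have [||a /andP[a1 a2] E] := @cis_half_circle (- w); first by rewrite cabsN.
  by rewrite cReN; lra.
exists (a + pi); first by apply/andP; split; lra.
by rewrite -[w]opprK E cisD /cis cospi sinpi; apply/eqP; rewrite eq_complex /=; apply/andP; split; apply/eqP; ring.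
Qed.

Lemma chart_at_infinity u : chart_at None u = (if u == 0 then None else Some u^-1) :> P1.
Proof. by rewrite /chart_at /= add0r. Qed.

(** At infinity the inversion replaces [r] by [r^-1] and reverses angles. *)
Lemma arc_edge p (r a b : R) : 0 < r -> a < b ->
  edge (chart_at p @` [set ofR r * cis t | t in `[a, b]]).
Proof.
move=> r0 ab; apply: Or31; case: p => [t|].
  exists t, r, a, b; split=> //; apply/seteqP; split=> [_ [_ [s sab <-] <-]|_ [s sab <-]].
    by exists s.
  by exists (ofR r * cis s) => //; exists s.
exists 0, r^-1, (- b), (- a); split; rewrite ?invr_gt0 ?ltrN2 //.
have n0 s : (ofR r * cis s == 0) = false.
  by apply/negbTE; rewrite -cabs_gt0 cabsM cabs_cis cabs_real mulr1 normr_gt0 gt_eqF.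
have E s : (ofR r * cis s)^-1 = ofR r^-1 * cis (- s) by rewrite invfM ofRV cisN.
apply/seteqP; split=> [_ [_ [s sab <-] <-]|_ [s sab <-]].
  exists (- s); first by move: sab; rewrite /= !in_itv /= !lerN2 andbC.
  by rewrite chart_at_infinity n0 E add0r.
exists (ofR r * cis (- s)).
  by exists (- s) => //; move: sab; rewrite /= !in_itv /= lerNr lerNl andbC.
by rewrite chart_at_infinity n0 E opprK add0r.
Qed.

(** At infinity the radius becomes a ray: [s v] goes to [(1 + u) (r v)^-1] with [u = r / s - 1], and
    [s = 0] goes to infinity. *)
Lemma radius_edge p (r : R) v : 0 < r -> v != 0 -> edge (chart_at p @` [set ofR s * v | s in `[0, r]]).
Proof.
move=> r0 v0; have rv0 : ofR r * v != 0 by rewrite mulf_neq0 // -cabs_gt0 cabs_real normr_gt0 gt_eqF.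
case: p => [t|].
  apply: Or32; exists t, (t + ofR r * v); split.
    by apply: contraNneq rv0 => /eqP; rewrite -subr_eq0 opprD addNKr oppr_eq0.
  apply/seteqP; split=> [_ [_ [s sr <-] <-]|_ [s s01 <-]].
    exists (s / r).
      by move: sr; rewrite /= !in_itv /= => /andP[s0 sr]; rewrite divr_ge0 ?(ltW r0) //= ler_pdivrMr // mul1r.
    rewrite /chart_at /= [t + _ - t]addrAC subrr add0r mulrA -[real_complex R _]/(ofR _) -ofRM divfK // gt_eqF //.
  exists (ofR (s * r) * v).
    exists (s * r) => //; move: s01; rewrite /= !in_itv /= => /andP[s0 s1].
    by rewrite mulr_ge0 ?(ltW r0) //= ler_piMl // (ltW r0).
  by rewrite /chart_at /= [t + _ - t]addrAC subrr add0r ofRM mulrA.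
apply: Or33; exists (ofR r * v)^-1, (ofR r * v)^-1; split; first by rewrite invr_eq0.
apply/seteqP; split=> [_ [_ [s sr <-] <-]|_ [[u u0 <-]|->]].
- have [->|s0] := eqVneq s 0; first by right; rewrite ofR0 mul0r /chart_at /= add0r eqxx.
  left; exists (r / s - 1).
    move: sr; rewrite /= !in_itv /= andbT subr_ge0 => /andP[s1 s2].
    by rewrite ler_pdivlMr ?mul1r // lt_def s0.
  have sv0 : ofR s * v != 0 by rewrite mulf_neq0 // -cabs_gt0 cabs_real normr_gt0.
  rewrite chart_at_infinity (negPf sv0); congr Some.
  rewrite -{1}[(ofR r * v)^-1]mul1r -mulrDl -[real_complex R _]/(ofR _) -ofR1 -ofRD addrCA subrr addr0.
  rewrite !invfM mulrA -!ofRV -ofRM mulrAC divff ?mul1r // gt_eqF //.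
- have {}u0 : 0 <= u by move: u0; rewrite /= in_itv /= andbT.
  have u1 : 0 < 1 + u by lra.
  exists (ofR (r / (1 + u)) * v).
    exists (r / (1 + u)) => //; rewrite /= in_itv /= divr_ge0 ?(ltW r0) ?(ltW u1) //=.
    by rewrite ler_pdivrMr // ler_peMr ?(ltW r0) // lerDl.
  have sv0 : ofR (r / (1 + u)) * v != 0.
    by rewrite mulf_neq0 // -cabs_gt0 cabs_real normr_gt0 mulf_neq0 ?gt_eqF // invr_gt0.
  rewrite chart_at_infinity (negPf sv0); congr Some.
  rewrite -{1}[(ofR r * v)^-1]mul1r -mulrDl -[real_complex R _]/(ofR _) -ofR1 -ofRD.
  by rewrite !invfM -!ofRV mulrA -ofRM; congr (ofR _ * _); rewrite invfM invrK mulrC.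
- exists 0; last by rewrite chart_at_infinity eqxx.
  by exists 0; rewrite ?ofR0 ?mul0r //= in_itv /= lexx ltW.
Qed.

End DiscImages.

Section Domains.
Variable R : realType.
Local Notation C := (cplx R).
Local Notation P1 := (CP1 R).
Local Notation Re := (@complex.Re R).
Local Notation Im := (@complex.Im R).
Implicit Types (z w u : C) (p : P1) (V W : set C).

(** Three edges fit a half disc, bounded by an arc and two radii; a disc repeats its circle three
    times. *)
Lemma chart_at_polygonal p V W A B D (r : R) z0 : convex_region V -> open V -> V z0 ->
  (forall z, V z -> cabs z <= r) -> closed W -> V `<=` W ->
  (forall z (t : R), W z -> 0 < t <= 1 -> V (z + ofR t * (z0 - z))) ->
  W `\` V = A `|` B `|` D ->
  edge (chart_at p @` A) -> edge (chart_at p @` B) -> edge (chart_at p @` D) ->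
  polygonal_domain (chart_at p @` V).
Proof.
move=> Vc Vo Vz0 Vr Wc VW HW WV eA eB eD; split.
- exact: chart_at_image_open.
- by exists (chart_at p z0); exists z0.
- exact: chart_at_simply_connected.
exists 3%N, (fun j => nth set0 [:: chart_at p @` A; chart_at p @` B; chart_at p @` D] j); split.
  by move=> [[|[|[|]]] //].
rewrite (chart_at_frontier p Vo Vr Wc VW HW) WV !image_setU; apply/seteqP; split.
  move=> q [[Aq|Bq]|Dq].
  - by exists ord0.
  - by exists (Ordinal (isT : 1 < 3)%N).
  - by exists (Ordinal (isT : 2 < 3)%N).
by move=> q [[[|[|[|]]] //]] _ _ /= Hq; [left; left|left; right|right].
Qed.

Lemma disc_open (r : R) : open [set z : C | cabs z < r].
Proof.
have -> : [set z : C | cabs z < r] = @cabs R @^-1` [set x | x < r] by [].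
by apply: open_comp; [move=> z _; exact: continuous_cabs|exact: open_lt].
Qed.

Lemma disc_convex (r : R) : convex_region [set z : C | cabs z < r].
Proof.
move=> z w t /= zr wr /andP[t0 t1].
have -> : z + ofR t * (w - z) = ofR (1 - t) * z + ofR t * w by rewrite ofRB ofR1; ring.
apply: le_lt_trans (cabsD _ _) _; rewrite !cabsM !cabs_real !ger0_norm ?subr_ge0 //.
have [->|tn] := eqVneq t 0; first by rewrite mul0r subr0 mul1r addr0.
have H1 : (1 - t) * cabs z <= (1 - t) * r by apply: ler_wpM2l; [lra|exact: ltW].
have tp : 0 < t by rewrite lt_def tn.
have H2 : t * cabs w < t * r by rewrite ltr_pM2l.
have -> : r = (1 - t) * r + t * r by ring.
exact: ler_ltD.
Qed.

Lemma disc_polygonal p (r : R) : 0 < r -> polygonal_domain (chart_at p @` [set z : C | cabs z < r]).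
Proof.
move=> r0; have pi0 := pi_gt0 R.
(* The full circle counts as one arc, over an interval of length [2 pi]. *)
pose A := [set ofR r * cis t | t in `[- (pi / 2), pi / 2 + pi]] : set C.
have eA : edge (chart_at p @` A) by apply: arc_edge => //; lra.
apply: (@chart_at_polygonal p _ [set z : C | cabs z <= r] A A A r 0) => //.
- exact: disc_convex.
- exact: disc_open.
- by rewrite /= cabs0.
- by move=> z /ltW.
- exact: closed_disc_closed.
- by move=> z /ltW.
- move=> z t /= zr /andP[t0 t1].
  have -> : z + ofR t * (0 - z) = ofR (1 - t) * z by rewrite ofRB ofR1; ring.
  rewrite cabsM cabs_real ger0_norm ?subr_ge0 //.
  have H1 : (1 - t) * cabs z <= (1 - t) * r by apply: ler_wpM2l; [lra|].
  by apply: le_lt_trans H1 _; rewrite gtr_pMl //; lra.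
rewrite !setUid; apply/seteqP; split=> [z [/= zr zn]|_ [t _ <-]].
  have zr' : cabs z = r by apply/eqP; rewrite eq_le zr leNgt; apply/negP.
  have r0' : ofR r != 0 :> C by rewrite -cabs_gt0 cabs_real normr_gt0 gt_eqF.
  have [|t tI E] := @cis_circle R (z / ofR r).
    by rewrite cabsM cabsV cabs_real zr' ger0_norm ?divff ?gt_eqF // ltW.
  by exists t; [rewrite /= in_itv|rewrite -E mulrC divfK].
by split; rewrite /= cabsM cabs_cis cabs_real mulr1 ger0_norm ?ltxx // ltW.
Qed.

Lemma half_plane_open w : open [set z : C | 0 < Re (z * w)].
Proof.
have -> : [set z : C | 0 < Re (z * w)] = (fun z => Re (z * w)) @^-1` [set x | 0 < x] by [].
by apply: open_comp; [move=> z _; exact: continuous_Re_mul|exact: open_gt].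
Qed.

Lemma half_disc_open (io : C) (r : R) : open (half_disc io r).
Proof.
have -> : half_disc io r = [set z | cabs z < r] `&` [set z | 0 < Re (z * io^-1)] by [].
by apply: openI; [exact: disc_open|exact: half_plane_open].
Qed.

Lemma Re_convex_comb z w v (t : R) :
  Re ((z + ofR t * (w - z)) * v) = (1 - t) * Re (z * v) + t * Re (w * v).
Proof.
have -> : (z + ofR t * (w - z)) * v = ofR (1 - t) * (z * v) + ofR t * (w * v) by rewrite ofRB ofR1; ring.
by rewrite cReD !Re_real_mul.
Qed.

Lemma half_disc_convex (io : C) (r : R) : convex_region (half_disc io r).
Proof.
move=> z w t [zr zi] [wr wi] t01; split; first exact: disc_convex.
rewrite Re_convex_comb; case/andP: t01 => t0 t1.
have [->|tn] := eqVneq t 0; first by rewrite mul0r subr0 mul1r addr0.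
have tp : 0 < t by rewrite lt_def tn.
by apply: ltr_wpDl; [apply: mulr_ge0; [lra|exact: ltW]|exact: mulr_gt0].
Qed.

Lemma cis_pihalf : cis (pi / 2) = Complex 0 1 :> C.
Proof. by rewrite /cis cos_pihalf sin_pihalf. Qed.

(** The diameter is cut at 0 into two radii because around infinity its image passes through
    infinity and is not a single segment or ray. *)
Lemma half_disc_frontier (a r : R) : 0 < r ->
  [set z : C | cabs z <= r /\ 0 <= Re (z / cis a)] `\` half_disc (cis a) r =
  [set ofR r * cis t | t in `[a - pi / 2, a + pi / 2]] `|`
  [set ofR s * cis (a + pi / 2) | s in `[0, r]] `|` [set ofR s * cis (a - pi / 2) | s in `[0, r]].
Proof.
move=> r0; have c0 t : cis t != 0 :> C by rewrite -cabs_gt0 cabs_cis ltr01.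
have r0' : ofR r != 0 :> C by rewrite -cabs_gt0 cabs_real normr_gt0 gt_eqF.
apply/seteqP; split=> [z [/= [zr zi] zn]|].
  have [zlt|] := ltP (cabs z) r; last first.
    move=> rz; have zr' : cabs z = r by apply/eqP; rewrite eq_le zr.
    have [||t tI E] := @cis_half_circle R (z / cis a / ofR r).
    - by rewrite !cabsM !cabsV cabs_cis cabs_real zr' invr1 mulr1 ger0_norm ?divff ?gt_eqF // ltW.
    - by rewrite mulrC -ofRV Re_real_mul mulr_ge0 // invr_ge0 ltW.
    left; left; exists (a + t); last by rewrite cisD -E mulrCA [ofR r * _]mulrC divfK // mulrC divfK.
    by move: tI => /andP[t1 t2]; rewrite /= in_itv /=; apply/andP; split; lra.
  have Re0 : Re (z / cis a) = 0.
    by apply/eqP; rewrite eq_le zi andbT leNgt; apply/negP => ?; apply: zn.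
  have zE : z = cis a * Complex 0 (Im (z / cis a)).
    have <- : z / cis a = Complex 0 (Im (z / cis a)) by move: Re0; case: (z / cis a) => x y /= ->.
    by rewrite mulrC divfK.
  have := Im_le_cabs (z / cis a); rewrite cabsM cabsV cabs_cis invr1 mulr1.
  move: (Im (z / cis a)) zE => y zE yz; have [y0|y0] := leP 0 y.
    left; right; exists y.
      by rewrite /= in_itv /= y0; move: yz; rewrite ger0_norm //; lra.
    rewrite cisD cis_pihalf zE mulrCA; congr (_ * _).
    by apply/eqP; rewrite eq_complex /=; apply/andP; split; apply/eqP; ring.
  right; exists (- y).
    by rewrite /= in_itv /=; move: yz; rewrite ltr0_norm // => yz; apply/andP; split; lra.
  rewrite cisD cisN cis_pihalf zE mulrCA; congr (_ * _).
  have -> : (Complex 0 1)^-1 = Complex 0 (- 1) :> C.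
    rewrite -cis_pihalf -cisN /cis cosN sinN cos_pihalf sin_pihalf //.
  by apply/eqP; rewrite eq_complex /=; apply/andP; split; apply/eqP; ring.
have rad s b : 0 <= s <= r -> b = pi / 2 \/ b = - (pi / 2) ->
    ([set z : C | cabs z <= r /\ 0 <= Re (z / cis a)] `\` half_disc (cis a) r) (ofR s * cis (a + b)).
  move=> /andP[s0 sr] Hb; have E : Re (ofR s * cis (a + b) / cis a) = 0.
    rewrite -mulrA cisD [cis a * _]mulrC mulfK // Re_real_mul /=.
    by case: Hb => ->; rewrite ?cosN cos_pihalf mulr0.
  split; last by case; rewrite E ltxx.
  by split; rewrite ?E ?lexx // cabsM cabs_cis cabs_real mulr1 ger0_norm.
move=> _ [[[t tI <-]|[s sI <-]]|[s sI <-]]; last 2 first.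
- by apply: rad; [move: sI; rewrite /= in_itv|left].
- by apply: rad; [move: sI; rewrite /= in_itv|right].
have E : cabs (ofR r * cis t) = r by rewrite cabsM cabs_cis cabs_real mulr1 ger0_norm // ltW.
split; last by case; rewrite E ltxx.
split; first by rewrite E.
rewrite -mulrA -cisN -cisD Re_real_mul; apply: mulr_ge0; first exact: ltW.
by move: tI; rewrite /= in_itv /= => /andP[t1 t2]; apply: cos_ge0_pihalf; apply/andP; split; lra.
Qed.

Lemma half_disc_polygonal p (a r : R) : 0 < r -> polygonal_domain (chart_at p @` half_disc (cis a) r).
Proof.
move=> r0; have pi0 := pi_gt0 R.
have c0 t : cis t != 0 :> C by rewrite -cabs_gt0 cabs_cis ltr01.
have zE : Re (ofR (r / 2) * cis a / cis a) = r / 2 by rewrite mulfK.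
have zc : cabs (ofR (r / 2) * cis a) = r / 2.
  by rewrite cabsM cabs_cis cabs_real mulr1 ger0_norm //; lra.
apply: (@chart_at_polygonal p _ _ _ _ _ r (ofR (r / 2) * cis a) _ _ _ _ _ _ _ (half_disc_frontier a r0)).
- exact: half_disc_convex.
- exact: half_disc_open.
- by split; rewrite ?zE ?zc; lra.
- by move=> z [/ltW].
- have -> : [set z : C | cabs z <= r /\ 0 <= Re (z / cis a)] =
      [set z | cabs z <= r] `&` (fun z => Re (z * (cis a)^-1)) @^-1` [set x | 0 <= x] by [].
  apply: closedI; first exact: closed_disc_closed.
  by apply: closed_comp; [move=> z _; exact: continuous_Re_mul|exact: closed_ge].
- by move=> z [/ltW z1 /ltW].
- move=> z t [zr zi] /andP[t0 t1]; split; last first.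
    rewrite Re_convex_comb zE; apply: ltr_wpDl; first by apply: mulr_ge0 => //; lra.
    by apply: mulr_gt0 => //; lra.
  have -> : z + ofR t * (ofR (r / 2) * cis a - z) = ofR (1 - t) * z + ofR t * (ofR (r / 2) * cis a).
    by rewrite ofRB ofR1; ring.
  apply: le_lt_trans (cabsD _ _) _; rewrite !cabsM !cabs_real cabs_cis mulr1 !ger0_norm; [|lra..].
  have H1 : (1 - t) * cabs z <= (1 - t) * r by apply: ler_wpM2l => //; lra.
  have H2 : 0 < t * r by exact: mulr_gt0.
  by lra.
- by apply: arc_edge => //; lra.
- exact: radius_edge.
- exact: radius_edge.
Qed.

End Domains.

(** * The finite covering *)

Section Counting.
Variables (R : realType) (n : nat).
Local Notation C := (cplx R).
Local Notation P1 := (CP1 R).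
Local Notation Re := (@complex.Re R).
Local Notation Im := (@complex.Im R).
Implicit Types (Omega : rat_form R n) (p : P1) (U : set P1).

Lemma counting_le (T : choiceType) (A : set T) (B : nat) :
  (forall s : seq T, uniq s -> (forall u, u \in s -> A u) -> (size s <= B)%N) ->
  (counting A <= B%:R%:E :> \bar R)%E.
Proof.
move=> H; rewrite /counting; case: asboolP => [fA|iA].
  rewrite lee_fin ler_nat; apply: H; first exact: finmap.fset_uniq.
  by move=> u; rewrite in_fset_set // inE.
have [D DA DB] := infinite_set_fset B.+1 iA.
by have := H _ (finmap.fset_uniq D) DA; rewrite leqNgt DB.
Qed.

Lemma zero_count_le Omega U (B : nat) :
  (forall x (c : 'rV[C]_n), solution Omega U x -> forall ps : seq P1, uniq ps ->
    (forall q, q \in ps -> isolated (zeros U x c) q) -> (size ps <= B)%N) ->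
  (zero_count Omega U <= B%:R%:E)%E.
Proof.
move=> H; apply: ge_ereal_sup => _ [x [c [sol ->]]]; apply: counting_le => ps ups Hps.
exact: (H x c sol).
Qed.

Lemma seq_preimage (S T : eqType) (f : S -> T) (P : S -> Prop) (ts : seq T) :
  (forall t, t \in ts -> exists2 s, P s & f s = t) ->
  exists2 ss, map f ss = ts & forall s, s \in ss -> P s.
Proof.
elim: ts => [|t ts IH] H; first by exists [::].
have [|ss E Hss] := IH; first by move=> y yts; apply: H; rewrite in_cons yts orbT.
have [s Ps fs] := H t (mem_head _ _); exists (s :: ss); first by rewrite /= fs E.
by move=> y; rewrite in_cons => /orP[/eqP ->|/Hss].
Qed.

Lemma not_isolated_image p (V : set C) (Z : set P1) u : open V -> V u ->
  (forall v, V v -> Z (chart_at p v)) -> ~ isolated Z (chart_at p u).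
Proof.
move=> Vo Vu HZ [_ [N Nu NZ]].
have : nbhs u (chart_at p @^-1` N `&` V).
  by apply: filterI; [exact: chart_at_continuous|exact: open_nbhs_nbhs].
move=> /nbhs_cabsP[d d0 Hd].
have d2 : 0 < d / 2 by lra.
have [|Nv Vv] := Hd (u + ofR (d / 2)).
  by rewrite addrAC subrr add0r cabs_real gtr0_norm //; lra.
have : (N `&` Z) (chart_at p (u + ofR (d / 2))) by split=> //; exact: HZ.
rewrite NZ => /chart_at_inj /eqP; rewrite -subr_eq0 addrAC subrr add0r -cabs_eq0 cabs_real.
by rewrite normr_eq0 gt_eqF.
Qed.

(** If the combination vanishes identically on the half disc, no zero there is isolated and nothing
    is counted. *)
Lemma isolated_zeros_half_disc Omega p : (pole_order Omega p <= 1)%N ->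
  (forall a : C, eigenvalue (residue Omega p) a -> a \is Num.real) ->
  exists (r0 : R) (B : nat), 0 < r0 /\ forall (io : C) (r : R) U x (c : 'rV[C]_n),
    cabs io = 1 -> 0 < r -> r <= r0 -> solution Omega U x -> (chart_at p @` half_disc io r `<=` U) ->
    forall us : seq C, uniq us ->
    (forall u, u \in us -> half_disc io r u /\ isolated (zeros U x c) (chart_at p u)) ->
    (size us <= B)%N.
Proof.
move=> pole1 Hreal; have [r0 [B [r00 HB]]] := zeros_near_point pole1 Hreal.
exists r0, B; split=> // io r U x c io1 rp rr0 sol HU us uus Hus.
have HU' u : half_disc io r u -> U (chart_at p u) by move=> Hu; apply: HU; exists u.
have [Z|H] := HB io r U x c io1 rp rr0 sol HU'; last first.
  by apply: H => // u /Hus[Hu [/set_mem[_ E] _]].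
case: us uus Hus => [//|u us] _ /(_ u (mem_head _ _))[Hu].
move=> Hiso; have HZ v : half_disc io r v -> zeros U x c (chart_at p v).
  by move=> Hv; split; [exact: HU'|exact: Z].
by case: (not_isolated_image (half_disc_open (io := io) (r := r)) Hu HZ Hiso).
Qed.

Lemma punctured_disc_quadrants (r : R) (u : C) : cabs u < r -> u != 0 ->
  has (fun a => `[< half_disc (cis a) r u >]) [:: 0; pi / 2; pi; - (pi / 2)].
Proof.
move=> ur u0; have [xy|xy] := eqVneq (Re u) 0.
  have y0 : Im u != 0.
    by apply: contraNneq u0 => y0; case: u ur xy y0 => x y _ /= -> ->.
  have i2 : cis (- (pi / 2)) = Complex 0 (- 1) :> C by rewrite /cis cosN sinN cos_pihalf sin_pihalf.
  have [yp|yn] := ltP 0 (Im u).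
    apply/hasP; exists (pi / 2); first by rewrite !inE eqxx !orbT.
    by apply/asboolP; split=> //; rewrite -cisN i2 cReM /=; lra.
  apply/hasP; exists (- (pi / 2)); first by rewrite !inE eqxx !orbT.
  apply/asboolP; split=> //; rewrite -cisN opprK cis_pihalf cReM /= mulr0 sub0r mulr1 oppr_gt0.
  by rewrite lt_def eq_sym y0.
have [xp|xn] := ltP 0 (Re u).
  apply/hasP; exists 0; first by rewrite !inE eqxx.
  by apply/asboolP; split=> //; rewrite -cisN oppr0 /cis cos0 sin0 cReM /=; lra.
apply/hasP; exists pi; first by rewrite !inE eqxx !orbT.
apply/asboolP; split=> //; rewrite -cisN /cis cosN sinN cospi sinpi cReM /= oppr0 mulr0 subr0 mulrN1 oppr_gt0.
by rewrite lt_def eq_sym xy.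
Qed.

Lemma zero_counts_finite Omega p : (pole_order Omega p <= 1)%N ->
  (forall a : C, eigenvalue (residue Omega p) a -> a \is Num.real) ->
  exists2 r0 : R, 0 < r0 & forall r, 0 < r -> r <= r0 ->
    (forall a, (zero_count Omega (chart_at p @` half_disc (cis a) r) < +oo)%E) /\
    (zero_count Omega (chart_at p @` [set u : C | (cabs u < r)%R]) < +oo)%E.
Proof.
move=> pole1 Hreal; have [r0 [B [r00 HB]]] := isolated_zeros_half_disc pole1 Hreal.
exists r0 => // r rp rr0; split=> [a|].
  apply: (@le_lt_trans _ _ B%:R%:E); last exact: ltry.
  apply: zero_count_le => x c sol ps ups Hps.
  have [|us E Hus] := @seq_preimage _ _ (chart_at p) (half_disc (cis a) r) ps.
    by move=> q /Hps[/set_mem[[u Hu <-] _] _]; exists u.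
  rewrite -E size_map; apply: (HB _ r _ x c (cabs_cis a) rp rr0 sol (fun _ => id)).
    by rewrite -(map_inj_uniq (@chart_at_inj R p)) E.
  by move=> u uus; split; [exact: Hus|apply: Hps; rewrite -E; exact: map_f].
(* Five cells: four half discs with at most [B] zeros each, and the centre with at most one; [B.+1]
   bounds all of them. *)
apply: (@le_lt_trans _ _ (5 * B.+1)%:R%:E); last exact: ltry.
apply: zero_count_le => x c sol ps ups Hps.
have [|us E Hus] := @seq_preimage _ _ (chart_at p) [set u : C | cabs u < r] ps.
  by move=> q /Hps[/set_mem[[u Hu <-] _] _]; exists u.
have uus : uniq us by rewrite -(map_inj_uniq (@chart_at_inj R p)) E.
rewrite -E size_map.
pose cell (o : option R) : pred C := fun u => if o is Some a then `[< half_disc (cis a) r u >] else u == 0.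
apply: (@size_le_cells _ _ cell [:: None, Some 0, Some (pi / 2), Some pi & [:: Some (- (pi / 2))]]).
  move=> u /Hus ur; have [u0|u0] := eqVneq u 0; first by apply/orP; left; exact/eqP.
  have := punctured_disc_quadrants ur u0; rewrite /= => H; apply/orP; right; exact: H.
move=> [a|].
  apply: leqW; apply: (HB _ r _ x c (cabs_cis a) rp rr0 sol).
  - by move=> _ [u [ur _] <-]; exists u.
  - exact: filter_uniq.
  - move=> u; rewrite mem_filter => /andP[/asboolP Hu uus']; split=> //.
    by apply: Hps; rewrite -E; exact: map_f.
rewrite -[X in (_ <= X)%N]/(B.+1); apply: (@leq_trans 1%N) => //.
have -> : [seq u <- us | cell None u] = [seq u <- us | u == 0] by [].
by rewrite size_filter; case: (0 \in us) (count_uniq_mem (0 : C) uus) => /= ->.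
Qed.

(** Brings ordinary points under the result on half discs, as the zero matrix has real spectrum. *)
Lemma regular_residue Omega p : pole_order Omega p = 0%N -> residue Omega p = 0.
Proof.
move=> po0; apply/matrixP => i j; rewrite !mxE.
have : rat_pole_order (coef Omega p i j) (local_coord p) = 0%N.
  by apply/eqP; rewrite -leqn0 -po0; exact: entry_pole_order.
rewrite /rat_pole_order => mu0; set f := coef Omega p i j; set s := local_coord p.
have ds : (rat_den f).[s] != 0.
  apply/negP => ds; have := XsubC_dvd s (rat_den_neq0 f).
  by rewrite mu0 ltnn dvdp_XsubCl /root ds.
rewrite (rat_evalE (a := rat_num f * ('X - s%:P)) ds).
  by rewrite hornerM !hornerE subrr mulr0 mul0r.
by rewrite mulrA tofrac_rat_den tofracM.
Qed.

End Counting.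

Section FiniteCovers.
Variables (R : realType) (n : nat) (Omega : rat_form R n).
Local Notation C := (cplx R).
Local Notation P1 := (CP1 R).
Implicit Types (p : P1) (A B : set P1).

Definition coverable A := exists (k : nat) (U : 'I_k -> set P1),
  (forall a, polygonal_domain (U a) /\ (zero_count Omega (U a) < +oo)%E) /\ \bigcup_a U a = A.

Lemma coverable0 : coverable set0.
Proof. by exists 0%N, (fun _ => set0); split=> [[]//|]; apply/seteqP; split=> // x [[]]. Qed.

Lemma coverable1 A : polygonal_domain A -> (zero_count Omega A < +oo)%E -> coverable A.
Proof.
move=> pA zA; exists 1%N, (fun _ => A); split=> //.
by apply/seteqP; split=> [x [_ _]//|x Ax]; exists ord0.
Qed.

Lemma coverableU A B : coverable A -> coverable B -> coverable (A `|` B).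
Proof.
move=> [k [U [HU <-]]] [l [V [HV <-]]].
exists (k + l)%N, (fun i => match fintype.split i with inl a => U a | inr b => V b end); split.
  by move=> i; case: (fintype.split i).
apply/seteqP; split=> [x [i _]|x [[a _ Ux]|[b _ Vx]]].
- by case: (fintype.split i) => [a Ux|b Vx]; [left; exists a|right; exists b].
- by exists (lshift l a) => //; rewrite (unsplitK (inl a : 'I_k + 'I_l)).
- by exists (rshift k b) => //; rewrite (unsplitK (inr b : 'I_k + 'I_l)).
Qed.

Lemma coverable_bigcup (T : eqType) (s : seq T) (F : T -> set P1) :
  (forall t, t \in s -> coverable (F t)) -> coverable (\bigcup_(t in [set` s]) F t).
Proof.
elim: s => [|t s IH] H; first by rewrite set_nil bigcup_set0; exact: coverable0.
have -> : \bigcup_(u in [set` t :: s]) F u = F t `|` \bigcup_(u in [set` s]) F u.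
  apply/seteqP; split=> [x [u /=]|x [Fx|[u us Fx]]].
  - by rewrite in_cons => /orP[/eqP ->|us Fx]; [left|right; exists u].
  - by exists t => //=; exact: mem_head.
  - by exists u => //=; rewrite in_cons us orbT.
apply: coverableU; first by apply: H; exact: mem_head.
by apply: IH => u us; apply: H; rewrite in_cons us orbT.
Qed.

Lemma coverable_zero_bound : coverable (~` polar_locus Omega) -> (zero_bound Omega < +oo)%E.
Proof.
move=> [k [U [HU EU]]]; apply: (@le_lt_trans _ _ (covering_zero_count Omega U)).
  by apply: ereal_inf_lbound; exists k, U; split=> //; split=> // a; exact: (HU a).1.
by apply: lte_sum_pinfty => a _; exact: (HU a).2.
Qed.

Lemma chart_at0 p : chart_at p 0 = p.
Proof. by rewrite /chart_at addr0; case: p => //=; rewrite eqxx. Qed.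

(** The poles being finitely many, a small disc around [p] contains no other pole. It is itself a
    domain when [p] is regular; at a pole, four half discs cover the punctured disc. *)
Lemma local_cover p : finite_set (polar_locus Omega) -> (pole_order Omega p <= 1)%N ->
  (forall a : C, eigenvalue (residue Omega p) a -> a \is Num.real) ->
  exists N : set P1, [/\ open N, N p & coverable (N `\` polar_locus Omega)].
Proof.
move=> fin pole1 Hreal; have [r0 r00 Hr0] := zero_counts_finite pole1 Hreal.
have closedS : closed (polar_locus Omega `\` [set p]).
  apply: (accessible_finite_set_closed.1 (hausdorff_accessible (@CP1_hausdorff R))).
  exact: finite_setD.
have : nbhs p (~` (polar_locus Omega `\` [set p])).
  by apply: open_nbhs_nbhs; split; [exact: closed_openC|move=> [_ /(_ erefl)]].
rewrite -{1}(chart_at0 p) => /chart_at_continuous /nbhs_cabsP[r1 r10 Hr1].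
pose r := Num.min r0 r1; have rp : 0 < r by rewrite lt_min r00.
have rr0 : r <= r0 by rewrite ge_min lexx.
have [Hhalf Hdisc] := Hr0 r rp rr0.
pose D := [set u : C | cabs u < r].
have Hr u : D u -> polar_locus Omega (chart_at p u) -> u = 0.
  move=> ur pu; have : cabs (u - 0) < r1 by rewrite subr0; apply: lt_le_trans ur _; rewrite ge_min lexx orbT.
  move=> /Hr1 /= H; apply: (@chart_at_inj R p); rewrite chart_at0.
  by apply: contrapT => np; apply: H.
exists (chart_at p @` D); split.
- by apply: chart_at_image_open; exact: disc_open.
- by exists 0; [rewrite /D /= cabs0|exact: chart_at0].
have [Sp|nSp] := pselect (polar_locus Omega p); last first.
  rewrite (_ : _ `\` _ = chart_at p @` D); first by apply: coverable1 => //; exact: disc_polygonal.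
  apply/seteqP; split=> [q []//|_ [u Du <-]]; split; first by exists u.
  by move=> pu; apply: nSp; move: (pu); rewrite (Hr u Du pu) chart_at0.
rewrite (_ : _ `\` _ = \bigcup_(a in [set` [:: 0; pi / 2; pi; - (pi / 2)] : seq R]) chart_at p @` half_disc (cis a) r).
  by apply: coverable_bigcup => a _; apply: coverable1 => //; exact: half_disc_polygonal.
apply/seteqP; split=> [_ [[u Du <-] np]|_ [a _ [u [ur ua] <-]]].
  have u0 : u != 0 by apply: contra_notN np => /eqP ->; rewrite chart_at0.
  have /hasP[a aI /asboolP Ha] := punctured_disc_quadrants Du u0.
  by exists a => //; exists u.
split; first by exists u.
by move=> /(Hr u ur) u0; move: ua; rewrite u0 mul0r ltxx.
Qed.

Lemma coverable_regular_locus : finite_set (polar_locus Omega) ->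
  (forall p, (pole_order Omega p <= 1)%N) ->
  (forall p (a : C), eigenvalue (residue Omega p) a -> a \is Num.real) ->
  coverable (~` polar_locus Omega).
Proof.
move=> fin pole1 Hreal.
have /choice[N HN] : forall p, exists N : set P1, [/\ open N, N p & coverable (N `\` polar_locus Omega)].
  by move=> p; apply: local_cover => // a; exact: Hreal.
have : compact [set: P1] by exact: one_point_compactification_compact.
rewrite compact_cover => /(_ P1 setT N)[||s _ sN].
- by move=> p _; have [] := HN p.
- by move=> p _; exists p => //; have [] := HN p.
rewrite (_ : ~` _ = \bigcup_(p in [set` finmap.enum_fset s]) (N p `\` polar_locus Omega)).
  by apply: coverable_bigcup => p _; have [] := HN p.
apply/seteqP; split=> [p np|p [q _ []]//].
by have [q qs Nq] := sN p I; exists q.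
Qed.

End FiniteCovers.

Theorem theorem1 (R : realType) (n m : nat) (Omega : rat_form R n)
    (tau : 'I_m -> CP1 R)
    (tau_inj : injective tau)
    (polesE : polar_locus Omega = range tau)
    (simple_poles : forall i, pole_order Omega (tau i) = 1%N)
    (real_spec : forall i (a : cplx R),
        eigenvalue (residue Omega (tau i)) a -> a \is Num.real) :
  (zero_bound Omega < +oo)%E.
Proof.
have dich p : pole_order Omega p = 0%N \/ exists i, p = tau i.
  have [po|po] := posnP (pole_order Omega p); first by left.
  have : polar_locus Omega p by [].
  by rewrite polesE => -[i _ <-]; right; exists i.
apply: coverable_zero_bound; apply: coverable_regular_locus.
- by rewrite polesE; exact: finite_image.
- by move=> p; have [->//|[i ->]] := dich p; rewrite simple_poles.
(* At an ordinary point the residue is 0, whose eigenvalues can only be 0. *)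
move=> p a; have [po|[i ->]] := dich p; last exact: real_spec.
rewrite regular_residue // => /eigenvalueP[v]; rewrite mulmx0 => /esym/eqP.
by rewrite scaler_eq0 => /orP[/eqP -> _|/eqP ->]; rewrite ?eqxx ?real0.
Qed.
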